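(* In the mixture regression setting described in the context, with the estimators $\hat\lambda_1,\hat\lambda_2,\hat\lambda_3$ and the standing assumption on the weight function $w$ given there, the estimators $\hat\lambda_2$ and $\hat\lambda_3$ (of $\lambda_2=2\mu_1$ and $\lambda_3=p^{-1}$) are consistent, asymptotically normal, and have the following asymptotic characterizations: $$\sqrt n(\hat\lambda_2-\lambda_2)=\sqrt n\{\hat\lambda_1-\lambda_1\}^T D_{\lambda_1}\lambda_2(\lambda_1)+\{g_3(\lambda_1)\,\mathbf P w\}^{-1}\,\mathbb G_n\big(w\{a_1(\lambda_1)f^1-a_2(\lambda_1)f^2\}\big)+o_P(1),$$ $$\sqrt n(\hat\lambda_3-\lambda_3)=\sqrt n\{\hat\lambda_1-\lambda_1\}^T D_{\lambda_1}\lambda_3(\lambda_1)+\{g_3(\lambda_1)\,\mathbf P w\}^{-1}\,\mathbb G_n\big(w\{a_3(\lambda_1)f^2-a_2(\lambda_1)f^1\}\big)+o_P(1),$$ where $a_1(\lambda_1)$, $a_2(\lambda_1)$, $a_3(\lambda_1)$, $g_3(\lambda_1)$, $\lambda_2(\lambda_1)$, $\lambda_3(\lambda_1)$ are the limits in probability of $a_1^n(\lambda_1)$, $a_2^n(\lambda_1)$, $a_3^n(\lambda_1)$, $g_3^n(\lambda_1)$, $\lambda_2^n(\lambda_1)$, $\lambda_3^n(\lambda_1)$, respectively, and $$f_i^1=\Big(\eta_i-\frac{\mathbf P(\eta\cdot w)}{\mathbf P w}\Big)\{Y_i^2-E(Y_i^2\mid X_i)\},\qquad f_i^2=\Big(\eta_i^2-\frac{\mathbf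 P(\eta^2\cdot w)}{\mathbf P w}\Big)\{Y_i^2-E(Y_i^2\mid X_i)\}.$$
   Context: Model. Let $Y=PY_1+(1-P)Y_2$, where $\Pr(P=1)=1-\Pr(P=0)=p$ for some $p\in(0,1)$, and $Y_1$ and $Y_2$ are independent random variables from the two underlying distributions. $X$ is a vector of $m$ predictors. Assume $E(Y_1\mid X)=\mu_1+\beta^TX$ and $V(Y_1\mid X)=\sigma_1^2$, with $\beta\in\mathbb R^m$, while $Y_2$ is independent of $X$ with well-defined mean $E(Y_2)=\mu_2$ and variance $V(Y_2)=\sigma_2^2$. No distributional form is assumed. In this model $$E(Y\mid X)=p(\mu_1+\beta^TX)+(1-p)\mu_2,\qquad E(Y^2\mid X)=p\{(\mu_1+\beta^TX)^2+\sigma_1^2\}+(1-p)(\mu_2^2+\sigma_2^2).$$ The data are i.i.d. samples $(X_i,Y_i)$, $i=1,\dots,n$, of $(X,Y)$, with $X_i\in\mathbb R^m$, $Y_i\in\mathbb R$. Parameters. $\lambda_1=p\beta$, $\lambda_2=2\mu_1$, $\lambda_3=p^{-1}$, $\eta_i=\lambda_1^TX_i$. Then $E(Y_i^2\mid X_i)=\tilde\alpha+\lambda_2\eta_i+\lambda_3\eta_i^2$ for a constant $\tilde\alpha$. First-stage estimator. With $\tilde X_i=(1,X_i^T)^T$, $\tilde X=(\tilde X_1,\dots,\tilde X_n)^T$, $\mathbf Y=(Y_1,\dots,Y_n)^T$, and $A(m)$ the $m\times(m+1)$ matrix projecting an $(m+1)$-vector to its last $m$ components, $\hat\lambda_1=A(m)(\tilde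 X^T\tilde X)^{-1}\tilde X^T\mathbf Y$. Second-stage estimators. Let $w$ be a weight function on $\mathbb R$, and for $f_i=f(Y_i,X_i)$ let $\mathbb P_n^w(f)=\sum_{i=1}^n f_iw_i/\sum_{i=1}^n w_i$ with $w_i=w(\eta_i)$. Viewing $\eta_i=\lambda_1^TX_i$ and $w_i=w(\lambda_1^TX_i)$ as functions of the argument $\lambda_1$, define $a_1^n(\lambda_1)=\mathbb P_n^w(\eta^4)-\mathbb P_n^w(\eta^2)^2$, $a_2^n(\lambda_1)=\mathbb P_n^w(\eta^3)-\mathbb P_n^w(\eta)\mathbb P_n^w(\eta^2)$, $a_3^n(\lambda_1)=\mathbb P_n^w(\eta^2)-\mathbb P_n^w(\eta)^2$, $b_1^n(\lambda_1)=\mathbb P_n^w(\eta Y^2)-\mathbb P_n^w(\eta)\mathbb P_n^w(Y^2)$, $b_2^n(\lambda_1)=\mathbb P_n^w(\eta^2Y^2)-\mathbb P_n^w(\eta^2)\mathbb P_n^w(Y^2)$, $g_3^n(\lambda_1)=a_1^n(\lambda_1)a_3^n(\lambda_1)-a_2^n(\lambda_1)^2$, $\lambda_2^n(\lambda_1)=\{a_1^n(\lambda_1)b_1^n(\lambda_1)-a_2^n(\lambda_1)b_2^n(\lambda_1)\}/g_3^n(\lambda_1)$, $\lambda_3^n(\lambda_1)=\{a_3^n(\lambda_1)b_2^n(\lambda_1)-a_2^n(\lambda_1)b_1^n(\lambda_1)\}/g_3^n(\lambda_1)$. The estimators are $\hat\lambda_2=\lambda_2^n(\hat\lambda_1)$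 and $\hat\lambda_3=\lambda_3^n(\hat\lambda_1)$, i.e. $\eta_i$ and $w_i$ are replaced by $\hat\eta_i=\hat\lambda_1^TX_i$ and $\hat w_i=w(\hat\eta_i)$. Notation. $\mathbf Pf=E f(X_i,Y_i)$ and $\mathbb G_n(f)=n^{-1/2}\sum_{i=1}^n(f_i-\mathbf Pf)$. The limits in probability are given by the same formulas with each $\mathbb P_n^w(f)$ replaced by $\mathbf P(f\cdot w)/\mathbf Pw$. $D_{\lambda_1}$ denotes the derivative (gradient) with respect to $\lambda_1$; in the expansions $\lambda_1$ is the true value, and $\eta_i=\lambda_1^TX_i$, $w_i=w(\eta_i)$. Standing assumption. $w$ is twice continuously differentiable, and $\lambda_1\mapsto w(\lambda_1^TX)$ and the derivatives $\lambda_1\mapsto D_{\lambda_1}w(\lambda_1^TX)$ and $\lambda_1\mapsto D_{\lambda_1}^2w(\lambda_1^TX)$ are bounded by functions with finite means in some open neighbourhood of the true value of $\lambda_1$.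
   Formalization: Added, as limits may otherwise not exist: X_j, X_jY and wη^k(Y²−E(Y²|X)) (k≤2) in L²; invertible second-moment matrix of (1,X); domination also for wη^k (k≤4), wη^kY² (k≤2); Pw≠0, g_3≠0. The mixing variable P is independent of (X,Y_1,Y_2). *)

(* Defs.v *)
From HB Require Import structures.
From mathcomp Require Import all_boot all_order all_algebra.
From mathcomp Require Import all_classical all_reals all_analysis.

Set Implicit Arguments.
Unset Strict Implicit.
Unset Printing Implicit Defensive.

Import Order.TTheory GRing.Theory Num.Theory.
Import numFieldNormedType.Exports.

Local Open Scope classical_set_scope.
Local Open Scope ring_scope.

Section probability_notions.
Context {R : realType}.

Definition independent2 {d d1 d2} {T : measurableType d}
    {U : measurableType d1} {V : measurableType d2}
    (P : probability T R) (X : T -> U) (Y : T -> V) : Prop :=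
  forall A B, measurable A -> measurable B ->
    P (X @^-1` A `&` Y @^-1` B) = (P (X @^-1` A) * P (Y @^-1` B))%E.

(* [Z i], on the probability space [(T, P)], are i.i.d. copies of [Z0], which
   may live on another probability space [(T0, Q)]. *)
Definition iid_copies {d0 d d1} {T0 : measurableType d0}
    {T : measurableType d} {U : measurableType d1}
    (Q : probability T0 R) (Z0 : T0 -> U)
    (P : probability T R) (Z : nat -> T -> U) : Prop :=
  [/\ forall i, measurable_fun setT (Z i),
      forall i A, measurable A -> P (Z i @^-1` A) = Q (Z0 @^-1` A)
    & forall (s : seq nat) (A : nat -> set U), uniq s ->
        (forall i, measurable (A i)) ->
        P (\bigcap_(i in [set` s]) (Z i @^-1` A i)) =
        (\prod_(i <- s) P (Z i @^-1` A i))%E].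

(* [g \o X] is a version of E(V | X), i.e. of the conditional expectation of
   [V] given the sigma-algebra generated by [X]. *)
Definition is_cond_exp {d d1} {T : measurableType d} {U : measurableType d1}
    (P : probability T R) (V : T -> R) (X : T -> U) (g : U -> R) : Prop :=
  [/\ measurable_fun setT g,
      P.-integrable setT (EFin \o V),
      P.-integrable setT (EFin \o (g \o X))
    & forall B, measurable B ->
        (\int[P]_(t in X @^-1` B) (g (X t))%:E =
         \int[P]_(t in X @^-1` B) (V t)%:E)%E].

(* E(V | X) = g(X) and V(V | X) = v(X). *)
Definition is_cond_mean_var {d d1} {T : measurableType d}
    {U : measurableType d1} (P : probability T R) (V : T -> R) (X : T -> U)
    (g v : U -> R) : Prop :=
  is_cond_exp P V X g /\
  is_cond_exp P (fun t => (V t - g (X t)) ^+ 2) X v.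

Definition cvg_in_prob {d} {T : measurableType d} (P : probability T R)
    (S : nat -> T -> R) (c : R) : Prop :=
  forall e : R, 0 < e ->
    P [set t | e <= `|S n t - c|] @[n --> \oo] --> 0%E.

(* S_n = S'_n + o_P(1). *)
Definition eq_oP1 {d} {T : measurableType d} (P : probability T R)
    (S S' : nat -> T -> R) : Prop :=
  cvg_in_prob P (fun n t => S n t - S' n t) 0.

(* Convergence in distribution to N(0, s^2).  The limit is written as the law
   of [s * N] with [N] standard normal, because [normal_prob 0 0] is not the
   Dirac mass at 0. *)
Definition cvg_to_normal {d} {T : measurableType d} (P : probability T R)
    (S : nat -> T -> R) (s : R) : Prop :=
  forall f : R -> R, continuous f -> (exists M, forall x, `|f x| <= M) ->
    ('E_P[fun t => f (S n t)] @[n --> \oo] -->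
     'E_(normal_prob 0 1)[fun x => f (s * x)%R])%E.

Definition asymptotically_normal {d} {T : measurableType d}
    (P : probability T R) (S : nat -> T -> R) (theta : R) : Prop :=
  exists2 s : R, 0 <= s &
    cvg_to_normal P (fun n t => Num.sqrt n%:R * (S n t - theta)) s.

End probability_notions.

Section calculus.
Context {R : realType} {m : nat}.

Definition dot (u v : 'cV[R]_m) : R := (u^T *m v) 0 0.

Definition grad (f : 'cV[R]_m -> R) (l : 'cV[R]_m) : 'cV[R]_m :=
  \col_j 'D_(delta_mx j 0) f l.

Definition hess (f : 'cV[R]_m -> R) (l : 'cV[R]_m) : 'M[R]_m :=
  \matrix_(j, k) 'D_(delta_mx k 0) ('D_(delta_mx j 0) f) l.

Definition twice_continuously_differentiable (w : R -> R) : Prop :=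
  [/\ forall t, derivable w t 1, forall t, derivable (w^`())%classic t 1
    & continuous ((w^`())^`())%classic].

End calculus.

Section mixture_regression.
Context {R : realType} {m : nat}.

(* Predictors are tuples, which carry the product sigma-algebra. *)
Definition obs : Type := (m.-tuple R * R)%type.

Definition cvec (x : m.-tuple R) : 'cV[R]_m := \col_j tnth x j.

Definition mixture {T0 : Type} (I Y1 Y2 : T0 -> R) (t : T0) : R :=
  I t * Y1 t + (1 - I t) * Y2 t.

(* [I] is the 0/1 mixing variable; its independence of [(X, Y1, Y2)] is what
   yields E(Y | X) = p E(Y1 | X) + (1 - p) mu2 and its analogue for [Y ^+ 2]. *)
Record mixture_model {d0} {T0 : measurableType d0} (Q : probability T0 R)
    (X : T0 -> m.-tuple R) (I Y1 Y2 : T0 -> R)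
    (p mu1 mu2 sigma1 sigma2 : R) (beta : 'cV[R]_m) : Prop := MixtureModel {
  mix_measX : measurable_fun setT X ;
  mix_measI : measurable_fun setT I ;
  mix_measY1 : measurable_fun setT Y1 ;
  mix_measY2 : measurable_fun setT Y2 ;
  mix_p : 0 < p < 1 ;
  mix_I1 : Q [set t | I t = 1] = p%:E ;
  mix_I0 : Q [set t | I t = 0] = (1 - p)%:E ;
  mix_indepY : independent2 Q Y1 Y2 ;
  mix_indepI : independent2 Q I (fun t => (X t, (Y1 t, Y2 t))) ;
  mix_Y1 : is_cond_mean_var Q Y1 X
             (fun x => mu1 + dot beta (cvec x)) (fun=> sigma1 ^+ 2) ;
  mix_indepY2 : independent2 Q Y2 X ;
  mix_Y2 : Y2 \in Lfun Q 2%:E ;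
  mix_EY2 : ('E_Q[Y2] = mu2%:E)%E ;
  mix_VY2 : ('V_Q[Y2] = (sigma2 ^+ 2)%:E)%E }.

Definition etaX (l : 'cV[R]_m) (z : obs) : R := dot l (cvec z.1).

(* A data set is a sequence of observations; the estimators with sample size
   [n] use the first [n] of them. *)
Definition tildeX (x : m.-tuple R) : 'cV[R]_(1 + m) := col_mx 1 (cvec x).

Definition design n (z : nat -> obs) : 'M[R]_(n, 1 + m) :=
  \matrix_(i < n) (tildeX (z i).1)^T.

Definition response n (z : nat -> obs) : 'cV[R]_n := \col_(i < n) (z i).2.

Definition Aproj : 'M[R]_(m, 1 + m) := row_mx 0 1%:M.

Definition lambda1_hat n (z : nat -> obs) : 'cV[R]_m :=
  Aproj *m invmx ((design n z)^T *m design n z)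
    *m ((design n z)^T *m response n z).

Definition Pnw (w : R -> R) n (z : nat -> obs) (l : 'cV[R]_m)
    (f : obs -> R) : R :=
  (\sum_(i < n) f (z i) * w (etaX l (z i))) / \sum_(i < n) w (etaX l (z i)).

Definition PP {d0} {T0 : measurableType d0} (Q : probability T0 R)
  (Z0 : T0 -> obs) (f : obs -> R) : R := fine ('E_Q[f \o Z0])%E.

Definition Pw {d0} {T0 : measurableType d0} (Q : probability T0 R)
    (Z0 : T0 -> obs) (w : R -> R) (l : 'cV[R]_m) (f : obs -> R) : R :=
  PP Q Z0 (fun z => f z * w (etaX l z)) / PP Q Z0 (fun z => w (etaX l z)).

Definition Gn {d0} {T0 : measurableType d0} (Q : probability T0 R)
    (Z0 : T0 -> obs) n (z : nat -> obs) (f : obs -> R) : R :=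
  (Num.sqrt n%:R)^-1 * \sum_(i < n) (f (z i) - PP Q Z0 f).

(* The formulas below are parameterised by the averaging operator: with
   [M := Pnw w n z] they give the empirical quantities, with [M := Pw Q Z0 w]
   their limits. *)
Section coefficients.
Variables (M : 'cV[R]_m -> (obs -> R) -> R) (l : 'cV[R]_m).

Definition a1 := M l (fun z => etaX l z ^+ 4) - M l (fun z => etaX l z ^+ 2) ^+ 2.
Definition a2 :=
  M l (fun z => etaX l z ^+ 3) - M l (etaX l) * M l (fun z => etaX l z ^+ 2).
Definition a3 := M l (fun z => etaX l z ^+ 2) - M l (etaX l) ^+ 2.
Definition b1 :=
  M l (fun z => etaX l z * z.2 ^+ 2) - M l (etaX l) * M l (fun z => z.2 ^+ 2).
Definition b2 :=
  M l (fun z => etaX l z ^+ 2 * z.2 ^+ 2) -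
  M l (fun z => etaX l z ^+ 2) * M l (fun z => z.2 ^+ 2).
Definition g3 := a1 * a3 - a2 ^+ 2.
Definition lambda2 := (a1 * b1 - a2 * b2) / g3.
Definition lambda3 := (a3 * b2 - a2 * b1) / g3.

End coefficients.

Definition lambda2_hat (w : R -> R) n (z : nat -> obs) : R :=
  lambda2 (Pnw w n z) (lambda1_hat n z).
Definition lambda3_hat (w : R -> R) n (z : nat -> obs) : R :=
  lambda3 (Pnw w n z) (lambda1_hat n z).

(* [f1] and [f2] of the expansions; [h] is a version of x |-> E(Y^2 | X = x). *)
Definition f1 {d0} {T0 : measurableType d0} (Q : probability T0 R)
    (Z0 : T0 -> obs) (w : R -> R) (h : m.-tuple R -> R) (l : 'cV[R]_m)
    (z : obs) : R :=
  (etaX l z - Pw Q Z0 w l (etaX l)) * (z.2 ^+ 2 - h z.1).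
Definition f2 {d0} {T0 : measurableType d0} (Q : probability T0 R)
    (Z0 : T0 -> obs) (w : R -> R) (h : m.-tuple R -> R) (l : 'cV[R]_m)
    (z : obs) : R :=
  (etaX l z ^+ 2 - Pw Q Z0 w l (fun z => etaX l z ^+ 2)) * (z.2 ^+ 2 - h z.1).

(* In a neighbourhood of [l0], [s] and its first two derivatives in [l] are
   bounded by a function of the observation with finite mean. *)
Definition dominated {d0} {T0 : measurableType d0} (Q : probability T0 R)
    (Z0 : T0 -> obs) (l0 : 'cV[R]_m) (s : 'cV[R]_m -> obs -> R) : Prop :=
  exists F : obs -> R,
    [/\ measurable_fun setT F,
        Q.-integrable setT (EFin \o (F \o Z0))
      & \forall l \near l0, forall z : obs,
          [/\ `|s l z| <= F z, `|grad (s ^~ z) l| <= F z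
            & `|hess (s ^~ z) l| <= F z]].

Definition weight_assumption {d0} {T0 : measurableType d0}
    (Q : probability T0 R) (Z0 : T0 -> obs) (w : R -> R) (l0 : 'cV[R]_m)
    : Prop :=
  twice_continuously_differentiable w /\
  dominated Q Z0 l0 (fun l z => w (etaX l z)).

(* Moment and nondegeneracy conditions without which the estimators, the
   limits of the weighted averages and their derivatives, or the asymptotic
   variances are not defined. *)
Record regularity {d0} {T0 : measurableType d0} (Q : probability T0 R)
    (Z0 : T0 -> obs) (w : R -> R) (h : m.-tuple R -> R) (l0 : 'cV[R]_m)
    : Prop := Regularity {
  reg_X : forall j, (fun t => tnth (Z0 t).1 j) \in Lfun Q 2%:E ;
  reg_XY : forall j, (fun t => tnth (Z0 t).1 j * (Z0 t).2) \in Lfun Q 2%:E ;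
  reg_gram : \matrix_(i, j)
      PP Q Z0 (fun z => tildeX z.1 i 0 * tildeX z.1 j 0) \in unitmx ;
  reg_eta : forall k : nat, (k <= 4)%N ->
    dominated Q Z0 l0 (fun l z => w (etaX l z) * etaX l z ^+ k) ;
  reg_etaY : forall k : nat, (k <= 2)%N ->
    dominated Q Z0 l0 (fun l z => w (etaX l z) * (etaX l z ^+ k * z.2 ^+ 2)) ;
  reg_score : forall k : nat, (k <= 2)%N ->
    (fun t => w (etaX l0 (Z0 t)) * etaX l0 (Z0 t) ^+ k *
              ((Z0 t).2 ^+ 2 - h (Z0 t).1)) \in Lfun Q 2%:E ;
  reg_Pw : PP Q Z0 (fun z => w (etaX l0 z)) != 0 ;
  reg_g3 : g3 (Pw Q Z0 w) l0 != 0 }.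

End mixture_regression.

Arguments obs : clear implicits.

(* Main.v *)
Require Import Defs.
From HB Require Import structures.
From mathcomp Require Import all_boot all_order all_algebra.
From mathcomp Require Import all_classical all_reals all_analysis.
From mathcomp Require Import measurable_realfun ring lra.

(** The second stage is a weighted least-squares fit of [Y ^+ 2] on the estimated
    linear predictor and its square. It is consistent because, in the mixture
    model, E(Y | X) is affine in X with slope [lam1 = p *: beta], and
    E(Y ^+ 2 | X) is a quadratic polynomial in [eta = dot lam1 X] with
    coefficients [2 * mu1] and [p^-1] ([regression_linear],
    [regression2_quadratic]).

    The error of the second stage has two sources. At the true value [lam1] the
    normal equations can be solved exactly: with [Y ^+ 2] written as the
    quadratic polynomial plus a residual, the estimator equals the true
    coefficient plus a combination of the centered weighted moments of the
    residual ([lambda2_residual], [lambda3_residual]). These moments are of order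
    [n^(-1/2)], so their coefficients may be replaced by limits in probability,
    and what remains is the empirical process at a score of mean zero
    ([lambda2_at_truth], [lambda3_at_truth]).

    Replacing [lam1] by its estimator adds the differential of the limit function
    at [lam1], applied to the error of the first stage. For sample averages this
    is a Taylor expansion: all statistics depend on the parameter through linear
    predictors, and the domination assumption gives remainders with an integrable
    bound, to which the weak law of large numbers applies ([ridge_expansion],
    [delta_expansion_avg]). The property passes through sums, products and
    inverses ([delta_expansionD], [delta_expansionM], [delta_expansionV]), hence
    to the rational functions that define the estimators.

    The first stage is ordinary least squares and is asymptotically linear by the
    usual argument ([ols_linear]); square integrability of its scores comes from
    that of [X_j Y], because E(Y ^+ 2 | X) is at least [p] times the square of
    E(Y1 | X) ([L2_regressor_mean1]). Altogether each second-stage estimator, and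
    every linear combination of them, is up to [o_P(1)] an empirical process at a
    square integrable function ([second_stage_linear]), which gives consistency
    and, by the central limit theorem ([clt]), asymptotic normality.

    The central limit theorem is proved by replacing the summands one at a time
    by normal ones ([lindeberg_step], [lindeberg_bound]). The test functions are
    threefold sliding averages of a continuous function, whose expansions come
    from the mean value theorem ([ex_quad_approx]), and the convolution of normal
    laws is an exchange of integrals ([gauss_convolution_ge0]). *)

Set Implicit Arguments.
Unset Strict Implicit.
Unset Printing Implicit Defensive.

Import Order.TTheory GRing.Theory Num.Theory.
Import numFieldNormedType.Exports.

Local Open Scope classical_set_scope.
Local Open Scope ring_scope.

(** * Means and square integrability *)

Section means.
Context {d : measure_display} {T : measurableType d} {R : realType}.
Variable P : probability T R.
Implicit Types f g : T -> R.

(** Real-valued means, with integrability of a real function as the single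
    side condition, keep extended reals out of the algebra of moments. *)
Definition mean f : R := fine (\int[P]_x (f x)%:E)%E.

Definition L1 f : Prop := P.-integrable setT (EFin \o f).

Lemma L1_measurable f : L1 f -> measurable_fun setT f.
Proof. by move=> /measurable_int /measurable_EFinP. Qed.

Lemma meanE f : L1 f -> (\int[P]_x (f x)%:E)%E = (mean f)%:E.
Proof. by move=> f1; rewrite /mean fineK//; exact: integrable_fin_num. Qed.

Lemma eq_L1 f g : f =1 g -> L1 f -> L1 g.
Proof. by move=> /funext ->. Qed.

Lemma L1D f g : L1 f -> L1 g -> L1 (fun x => f x + g x).
Proof. by move=> f1 g1; apply: eq_integrable (integrableD _ f1 g1). Qed.

Lemma L1B f g : L1 f -> L1 g -> L1 (fun x => f x - g x).
Proof. by move=> f1 g1; apply: eq_integrable (integrableB _ f1 g1). Qed.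

Lemma L1Z k f : L1 f -> L1 (fun x => k * f x).
Proof. by move=> f1; apply: eq_integrable (integrableZl _ k f1). Qed.

Lemma L1_cst k : L1 (fun=> k).
Proof. exact: finite_measure_integrable_cst. Qed.

Lemma L1_sum (I : Type) (s : seq I) (h : I -> T -> R) :
  (forall i, L1 (h i)) -> L1 (fun x => \sum_(i <- s) h i x).
Proof.
move=> h1; elim: s => [|i s ih].
  by apply: eq_L1 (L1_cst 0) => x; rewrite big_nil.
by apply: eq_L1 (L1D (h1 i) ih) => x; rewrite big_cons.
Qed.

Lemma L1_le f g : measurable_fun setT f -> (forall x, `|f x| <= g x) ->
  L1 g -> L1 f.
Proof.
move=> mf fg; apply: le_integrable => //=; first exact/measurable_EFinP.
by move=> x _; rewrite lee_fin (le_trans (fg x))// ler_norm.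
Qed.

Lemma L1_norm f : L1 f -> L1 (fun x => `|f x|).
Proof. exact: integrable_norm. Qed.

Lemma L1_bounded f M : measurable_fun setT f -> (forall x, `|f x| <= M) -> L1 f.
Proof. by move=> mf fM; apply: L1_le fM (L1_cst M). Qed.

Lemma mean_cst k : mean (fun=> k) = k.
Proof. by rewrite /mean integral_cst//= probability_setT mule1. Qed.

Lemma meanD f g : L1 f -> L1 g -> mean (fun x => f x + g x) = mean f + mean g.
Proof. by move=> f1 g1; exact: RintegralD. Qed.

Lemma meanB f g : L1 f -> L1 g -> mean (fun x => f x - g x) = mean f - mean g.
Proof. by move=> f1 g1; exact: RintegralB. Qed.

Lemma meanZ k f : L1 f -> mean (fun x => k * f x) = k * mean f.
Proof. by move=> f1; exact: RintegralZl. Qed.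

Lemma mean_sum (I : Type) (s : seq I) (h : I -> T -> R) :
  (forall i, L1 (h i)) ->
  mean (fun x => \sum_(i <- s) h i x) = \sum_(i <- s) mean (h i).
Proof.
move=> h1; elim: s => [|i s ih].
  by rewrite big_nil -[RHS](mean_cst 0); congr mean; apply/funext => x;
     rewrite big_nil.
rewrite big_cons -ih -meanD//; last exact: L1_sum.
by congr mean; apply/funext => x; rewrite big_cons.
Qed.

Lemma mean_ge0 f : (forall x, 0 <= f x) -> 0 <= mean f.
Proof. by move=> f0; exact: Rintegral_ge0. Qed.

Lemma le_mean f g : L1 f -> L1 g -> (forall x, f x <= g x) -> mean f <= mean g.
Proof. by move=> f1 g1 fg; apply: le_Rintegral. Qed.

Lemma norm_mean f : L1 f -> `|mean f| <= mean (fun x => `|f x|).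
Proof. by move=> f1; exact: le_normr_Rintegral. Qed.

Lemma norm_mean_le f g : L1 f -> L1 g -> (forall x, `|f x| <= g x) ->
  `|mean f| <= mean g.
Proof.
move=> f1 g1 fg; apply: le_trans (norm_mean f1) _.
by apply: le_mean => //; exact: L1_norm.
Qed.

Lemma mean_indic A : measurable A -> (mean (\1_A : T -> R))%:E = P A.
Proof.
move=> mA; rewrite /mean integral_indic// setIT fineK//.
exact: fin_num_measure.
Qed.

Definition L2 f : Prop :=
  measurable_fun setT f /\ L1 (fun x => f x ^+ 2).

Lemma L1_mul f g : L2 f -> L2 g -> L1 (fun x => f x * g x).
Proof.
move=> [mf f2] [mg g2].
apply: (@L1_le _ (fun x => f x ^+ 2 + g x ^+ 2)).
- exact: measurable_funM.
- move=> x; rewrite ler_norml.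
  have := sqr_ge0 (f x + g x); have := sqr_ge0 (f x - g x).
  have := sqr_ge0 (f x); have := sqr_ge0 (g x); rewrite sqrrB sqrrD => *.
  by apply/andP; split; lra.
- exact: L1D.
Qed.

Lemma L2_cst k : L2 (fun=> k).
Proof. by split; [exact: measurable_cst | exact: L1_cst]. Qed.

Lemma L2_L1 f : L2 f -> L1 f.
Proof.
move=> f2; apply: eq_L1 (L1_mul f2 (L2_cst 1)) => x; exact: mulr1.
Qed.

Lemma L2D f g : L2 f -> L2 g -> L2 (fun x => f x + g x).
Proof.
move=> [mf f2] [mg g2]; split; first exact: measurable_funD.
apply: (@L1_le _ (fun x => 2 * f x ^+ 2 + 2 * g x ^+ 2)).
- by apply: measurable_funX; exact: measurable_funD.
- move=> x; rewrite ger0_norm ?sqr_ge0//.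
  by have := sqr_ge0 (f x - g x); rewrite sqrrB sqrrD => ?; lra.
- by apply: L1D; exact: L1Z.
Qed.

Lemma L2Z k f : L2 f -> L2 (fun x => k * f x).
Proof.
move=> [mf f2]; split; first by apply: measurable_funM => //; exact: measurable_cst.
by apply: eq_L1 (L1Z (k ^+ 2) f2) => x; rewrite exprMn.
Qed.

Lemma L2B f g : L2 f -> L2 g -> L2 (fun x => f x - g x).
Proof.
move=> f2 g2; have := L2D f2 (L2Z (-1) g2).
by congr L2; apply/funext => x; rewrite mulN1r.
Qed.

Lemma L2_sum (I : Type) (s : seq I) (h : I -> T -> R) :
  (forall i, L2 (h i)) -> L2 (fun x => \sum_(i <- s) h i x).
Proof.
move=> h1; elim: s => [|i s ih].
  by have := L2_cst 0; congr L2; apply/funext => x; rewrite big_nil.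
have := L2D (h1 i) ih; congr L2; apply/funext => x; by rewrite big_cons.
Qed.

Lemma L2_Lfun f : f \in Lfun P 2%:E -> L2 f.
Proof.
move=> f2; split; last exact: Lfun2_integrable_sqr.
have fT : P setT \is a fin_num by rewrite probability_setT.
exact: L1_measurable ((Lfun1_integrable _ _).1 (Lfun_subset12 fT f2)).
Qed.

(** Markov's inequality for the square. *)
Lemma chebyshev2 f (K : R) : L2 f -> 0 < K ->
  (P [set x | (K <= `|f x|)%R] <= (mean (fun x => f x ^+ 2) / K ^+ 2)%:E)%E.
Proof.
move=> [mf f2] K0.
have mA : measurable [set x | K <= `|f x|].
  rewrite -[X in measurable X]setTI.
  by apply: measurable_fun_le => //; exact: measurableT_comp.
rewrite -mean_indic// lee_fin ler_pdivlMr ?exprn_gt0// mulrC -meanZ; last first.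
  exact: integrable_indic.
apply: le_mean => //; first by apply: L1Z; exact: integrable_indic.
move=> x; rewrite indicE; have [|_] := boolP (x \in _); last by rewrite mulr0 sqr_ge0.
rewrite inE/= mulr1 => Kx; rewrite -[leRHS]real_normK ?num_real// lerXn2r ?nnegrE//.
exact: ltW.
Qed.

Lemma markov1 f (K : R) : L1 f -> 0 < K ->
  (P [set x | (K <= `|f x|)%R] <= (mean (fun x => `|f x|) / K)%:E)%E.
Proof.
move=> f1 K0; have mf := L1_measurable f1.
have mA : measurable [set x | K <= `|f x|].
  rewrite -[X in measurable X]setTI.
  by apply: measurable_fun_le => //; exact: measurableT_comp.
rewrite -mean_indic// lee_fin ler_pdivlMr// mulrC -meanZ; last first.
  exact: integrable_indic.
apply: le_mean => //.
- by apply: L1Z; exact: integrable_indic.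
- exact: L1_norm.
- move=> x; rewrite indicE; have [|_] := boolP (x \in _); last by rewrite mulr0.
  by rewrite inE/= mulr1.
Qed.

End means.

(** * Convergence in probability and tightness *)

Section measurable_events.
Context {d : measure_display} {T : measurableType d} {R : realType}.
Implicit Types f g : T -> R.

Lemma measurable_le f g : measurable_fun setT f -> measurable_fun setT g ->
  measurable [set x | f x <= g x].
Proof.
move=> mf mg; rewrite -[X in measurable X]setTI; exact: measurable_fun_le.
Qed.

Lemma measurable_norm_ge f (K : R) : measurable_fun setT f ->
  measurable [set x | K <= `|f x|].
Proof. by move=> mf; apply: measurable_le => //; exact: measurableT_comp. Qed.

Lemma measurable_eqc f (c : R) : measurable_fun setT f ->
  measurable [set x | f x = c].
Proof.
move=> mf; rewrite (_ : [set _ | _] = f @^-1` [set c])//.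
rewrite -[X in measurable X]setTI; exact: mf.
Qed.

Lemma measurable_neqc f (c : R) : measurable_fun setT f ->
  measurable [set x | f x <> c].
Proof. by move=> mf; exact/measurableC/measurable_eqc. Qed.

(** Inversion is continuous away from [0], and a single point carries the
    convention [0^-1 = 0]; so ratios need no case distinction later on. *)
Lemma measurable_fun_inv f : measurable_fun setT f ->
  measurable_fun setT (fun x => (f x)^-1).
Proof.
move=> mf; have -> : (fun x => (f x)^-1) =
    (fun x => if f x == 0 then 0 else (f x)^-1).
  by apply/funext => x; case: eqP => // ->; rewrite invr0.
apply: (measurable_fun_if _ _ _ _) => //=.
- apply: (measurable_fun_bool true) => //.
  rewrite setTI (_ : _ @^-1` _ = [set x | f x = 0]); last first.
    by apply/seteqP; split => x /= /eqP.
  exact: measurable_eqc.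
- rewrite setTI.
  have mV : measurable_fun (~` [set (0:R)]) (@GRing.inv R).
    apply: open_continuous_measurable_fun; first exact/closed_openC/closed_eq.
    by move=> x; rewrite inE/= => /eqP x0; exact: inv_continuous.
  apply: (@measurable_comp _ _ _ _ _ _ (~` [set (0:R)])) => //.
  + exact: measurableC.
  + by move=> _ [x /= /eqP + <-]; exact/contra_not.
  + exact: measurable_funTS.
Qed.

End measurable_events.

Section convergence_in_probability.
Context {d : measure_display} {T : measurableType d} {R : realType}.
Variable P : probability T R.
Implicit Types (A B : nat -> set T) (S : nat -> T -> R).

(** Formulated with upper bounds instead of a limit, this passes to smaller
    events and finite unions at once. *)
Definition rare A := (forall n, measurable (A n)) /\
  forall e : R, 0 < e -> \forall n \near \oo, (P (A n) <= e%:E)%E.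

Lemma rareP A : (forall n, measurable (A n)) ->
  rare A <-> (P (A n) @[n --> \oo] --> 0%E).
Proof.
move=> mA; have fA n : P (A n) \is a fin_num by exact: fin_num_measure.
split=> [[_ rA]|cA].
  apply: cvg_EFin; first exact: nearW.
  apply/cvgr0Pnorm_le => e e0; near=> n.
  rewrite ger0_norm ?fine_ge0// -lee_fin fineK//.
  by near: n; exact: rA.
split=> // e e0.
have /fine_cvg/cvgr0Pnorm_le/(_ e e0) := cA.
apply: filterS => n /=; rewrite ger0_norm ?fine_ge0// -lee_fin fineK//.
Unshelve. all: by end_near. Qed.

Lemma rareS A B : (forall n, measurable (B n)) ->
  (\forall n \near \oo, B n `<=` A n) -> rare A -> rare B.
Proof.
move=> mB BA [mA rA]; split => // e e0; near=> n.
apply: (@le_trans _ _ (P (A n))); last by near: n; exact: rA.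
by apply: le_measure; rewrite ?inE//; near: n.
Unshelve. all: by end_near. Qed.

Lemma rareU A B : rare A -> rare B -> rare (fun n => A n `|` B n).
Proof.
move=> [mA rA] [mB rB]; split=> [n|e e0]; first exact: measurableU.
have e20 : 0 < e / 2 by lra.
near=> n; apply: le_trans (measureU2 _ _ _) _ => //.
rewrite (_ : e = e / 2 + e / 2); last by lra.
by rewrite EFinD; apply: leeD; near: n; [exact: rA|exact: rB].
Unshelve. all: by end_near. Qed.

(** Convergence in probability. Measurability is part of the notion, so that
    every exceptional event of the calculus has a probability. *)
Definition cvpr S (c : R) := (forall n, measurable_fun setT (S n)) /\
  forall e : R, 0 < e -> rare (fun n => [set t | e <= `|S n t - c|]).

(** The sequences usually written [O_P(1)]. *)
Definition tightP S := (forall n, measurable_fun setT (S n)) /\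
  forall e : R, 0 < e -> exists2 K : R, 0 < K &
    \forall n \near \oo, (P [set t | (K <= `|S n t|)%R] <= e%:E)%E.

Lemma cvprE S c : cvpr S c <->
  (forall n, measurable_fun setT (S n)) /\ cvg_in_prob P S c.
Proof.
split=> -[mS h]; split => // e /h.
  case=> mA rA; exact/rareP.
by move=> cA; apply/rareP => // n; apply: measurable_norm_ge; exact: measurable_funB.
Qed.

Lemma cvpr_measurable S c : cvpr S c -> forall n, measurable_fun setT (S n).
Proof. by case. Qed.

Lemma cvpr_near S S' c : (forall n, measurable_fun setT (S' n)) ->
  rare (fun n => [set t | S n t <> S' n t]) -> cvpr S c -> cvpr S' c.
Proof.
move=> mS' rS [mS cS]; split=> // e /cS /(rareU rS); apply: rareS.
  by move=> n; apply: measurable_norm_ge; exact: measurable_funB.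
apply: nearW => n t /= h; case: (pselect (S n t = S' n t)) => [->|]; [by right|by left].
Qed.

Lemma eq_cvpr S S' c : (\forall n \near \oo, S n =1 S' n) ->
  (forall n, measurable_fun setT (S' n)) -> cvpr S c -> cvpr S' c.
Proof.
move=> SS' mS' [mS cS]; split=> // e /cS; apply: rareS.
  by move=> n; apply: measurable_norm_ge; exact: measurable_funB.
by apply: filterS SS' => n SS' t /=; rewrite SS'.
Qed.

Lemma cvpr_cst c : cvpr (fun _ _ => c) c.
Proof.
split=> [n|e e0]; first exact: measurable_cst.
rewrite (_ : (fun n => _) = fun=> set0); last first.
  apply/funext => n; apply/seteqP; split => t //=.
  by rewrite subrr normr0 leNgt e0.
split=> // e' e'0; apply: nearW => n; by rewrite measure0 lee_fin ltW.
Qed.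

(** The continuous mapping theorem for two arguments, from which the algebraic
    rules follow: outside two rare events both arguments are close to their
    limits. *)
Lemma cvpr_map2 (F : R -> R -> R) S S' a b :
  {for (a, b), continuous (fun z : R * R => F z.1 z.2)} ->
  (forall n, measurable_fun setT (fun t => F (S n t) (S' n t))) ->
  cvpr S a -> cvpr S' b -> cvpr (fun n t => F (S n t) (S' n t)) (F a b).
Proof.
move=> cF mF [mS cS] [mS' cS']; split => // e e0.
have /cvgrPdist_lt/(_ e e0) := cF.
case=> -[U V] /= [/nbhs_ballP[r1 r10 U1] /nbhs_ballP[r2 r20 V2]] UV.
apply: rareS (rareU (cS _ r10) (cS' _ r20)).
  by move=> n; apply: measurable_norm_ge; exact: measurable_funB.
apply: nearW => n t /=; apply: contraPP => /not_orP[/negP + /negP].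
rewrite -!ltNge => h1 h2; apply/negP; rewrite -ltNge distrC.
apply: (UV (S n t, S' n t)); split => /=.
  by apply: U1; rewrite /ball/= distrC.
by apply: V2; rewrite /ball/= distrC.
Qed.

Lemma cvprD S S' a b : cvpr S a -> cvpr S' b ->
  cvpr (fun n t => S n t + S' n t) (a + b).
Proof.
move=> cS cS'; apply: (@cvpr_map2 (fun x y => x + y)) => //.
  by apply: cvgD; [exact: cvg_fst|exact: cvg_snd].
by move=> n; apply: measurable_funD; [case: cS|case: cS'].
Qed.

Lemma cvprB S S' a b : cvpr S a -> cvpr S' b ->
  cvpr (fun n t => S n t - S' n t) (a - b).
Proof.
move=> cS cS'; apply: (@cvpr_map2 (fun x y => x - y)) => //.
  by apply: cvgB; [exact: cvg_fst|exact: cvg_snd].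
by move=> n; apply: measurable_funB; [case: cS|case: cS'].
Qed.

Lemma cvprM S S' a b : cvpr S a -> cvpr S' b ->
  cvpr (fun n t => S n t * S' n t) (a * b).
Proof.
move=> cS cS'; apply: (@cvpr_map2 (fun x y => x * y)) => //.
  by apply: cvgM; [exact: cvg_fst|exact: cvg_snd].
by move=> n; apply: measurable_funM; [case: cS|case: cS'].
Qed.

Lemma cvprV S a : a != 0 -> cvpr S a -> cvpr (fun n t => (S n t)^-1) a^-1.
Proof.
move=> a0 cS; apply: (@cvpr_map2 (fun x _ => x^-1) S (fun _ _ => 0) a 0) => //.
- by apply: cvgV => //; exact: cvg_fst.
- by move=> n; apply: measurable_fun_inv; case: cS.
- exact: cvpr_cst.
Qed.

Lemma cvprZ k S a : cvpr S a -> cvpr (fun n t => k * S n t) (k * a).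
Proof. by apply: cvprM; exact: cvpr_cst. Qed.

Lemma cvprX k S a : cvpr S a -> cvpr (fun n t => S n t ^+ k) (a ^+ k).
Proof.
move=> cS; elim: k => [|k ih].
  by rewrite expr0; under eq_fun do under eq_fun do rewrite expr0; exact: cvpr_cst.
by rewrite exprS; under eq_fun do under eq_fun do rewrite exprS; exact: cvprM.
Qed.

Lemma cvpr_sum (I : Type) (s : seq I) (S : I -> nat -> T -> R) (a : I -> R) :
  (forall i, cvpr (S i) (a i)) ->
  cvpr (fun n t => \sum_(i <- s) S i n t) (\sum_(i <- s) a i).
Proof.
move=> h; elim: s => [|i s ih].
  by rewrite big_nil; under eq_fun do under eq_fun do rewrite big_nil; exact: cvpr_cst.
by rewrite big_cons; under eq_fun do under eq_fun do rewrite big_cons; exact: cvprD.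
Qed.

Lemma cvpr_prod (I : Type) (s : seq I) (S : I -> nat -> T -> R) (a : I -> R) :
  (forall i, cvpr (S i) (a i)) ->
  cvpr (fun n t => \prod_(i <- s) S i n t) (\prod_(i <- s) a i).
Proof.
move=> h; elim: s => [|i s ih].
  by rewrite big_nil; under eq_fun do under eq_fun do rewrite big_nil; exact: cvpr_cst.
by rewrite big_cons; under eq_fun do under eq_fun do rewrite big_cons; exact: cvprM.
Qed.

Lemma rare_eq0 S a : a != 0 -> cvpr S a -> rare (fun n => [set t | S n t = 0]).
Proof.
move=> a0 [mS cS]; apply: rareS (cS `|a| _); last by rewrite normr_gt0.
  by move=> n; exact: measurable_eqc.
by apply: nearW => n t /= ->; rewrite sub0r normrN.
Qed.

Lemma cvpr0_neq S : (forall n, measurable_fun setT (S n)) ->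
  rare (fun n => [set t | S n t <> 0]) -> cvpr S 0.
Proof.
move=> mS rS; apply: cvpr_near (cvpr_cst 0) => //.
apply: rareS rS => [n|]; last by apply: nearW => n t /= /eqP + /eqP; rewrite eq_sym => /negP.
rewrite (_ : [set _ | _] = [set t | S n t <> 0]); last first.
  by apply/seteqP; split => t /= h1 h2; apply: h1.
exact: measurable_neqc.
Qed.

Lemma cvpr_tight S a : cvpr S a -> tightP S.
Proof.
move=> [mS cS]; split => // e e0; exists (`|a| + 1); first by rewrite ltr_wpDl.
have [_ rA] : rare (fun n => [set t | `|a| + 1 <= `|S n t|]).
  apply: rareS (cS 1 ltr01) => [n|]; first exact: measurable_norm_ge.
  apply: nearW => n t /= h.
  by have := ler_normD (S n t - a) a; rewrite subrK; lra.
exact: rA.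
Qed.

Lemma tightPD S S' : tightP S -> tightP S' -> tightP (fun n t => S n t + S' n t).
Proof.
move=> [mS tS] [mS' tS']; split=> [n|e e0]; first exact: measurable_funD.
have e20 : 0 < e / 2 by lra.
have [K K0 hK] := tS _ e20; have [L L0 hL] := tS' _ e20.
exists (K + L); first by rewrite addr_gt0.
near=> n.
apply: (@le_trans _ _ (P ([set t | K <= `|S n t|] `|` [set t | L <= `|S' n t|]))).
  apply: le_measure; rewrite ?inE.
  - by apply: measurable_norm_ge; exact: measurable_funD.
  - by apply: measurableU; exact: measurable_norm_ge.
  - move=> t /=; apply: contraPP => /not_orP[/negP + /negP].
    rewrite -!ltNge => h1 h2; apply/negP; rewrite -ltNge.
    by apply: le_lt_trans (ler_normD _ _) _; exact: ltrD.
apply: le_trans (measureU2 _ _ _) _; try exact: measurable_norm_ge.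
rewrite (_ : e = e / 2 + e / 2); last by lra.
by rewrite EFinD; apply: leeD; near: n.
Unshelve. all: by end_near. Qed.

Lemma tightPM S S' : tightP S -> tightP S' -> tightP (fun n t => S n t * S' n t).
Proof.
move=> [mS tS] [mS' tS']; split=> [n|e e0]; first exact: measurable_funM.
have e20 : 0 < e / 2 by lra.
have [K K0 hK] := tS _ e20; have [L L0 hL] := tS' _ e20.
exists (K * L); first by rewrite mulr_gt0.
near=> n.
apply: (@le_trans _ _ (P ([set t | K <= `|S n t|] `|` [set t | L <= `|S' n t|]))).
  apply: le_measure; rewrite ?inE.
  - by apply: measurable_norm_ge; exact: measurable_funM.
  - by apply: measurableU; exact: measurable_norm_ge.
  - move=> t /=; apply: contraPP => /not_orP[/negP + /negP].
    rewrite -!ltNge => h1 h2; apply/negP; rewrite -ltNge normrM.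
    by apply: ltr_pM.
apply: le_trans (measureU2 _ _ _) _; try exact: measurable_norm_ge.
rewrite (_ : e = e / 2 + e / 2); last by lra.
by rewrite EFinD; apply: leeD; near: n.
Unshelve. all: by end_near. Qed.

Lemma tightP_sum (I : Type) (s : seq I) (S : I -> nat -> T -> R) :
  (forall i, tightP (S i)) -> tightP (fun n t => \sum_(i <- s) S i n t).
Proof.
move=> h; elim: s => [|i s ih].
  under eq_fun do under eq_fun do rewrite big_nil.
  exact: cvpr_tight (cvpr_cst 0).
by under eq_fun do under eq_fun do rewrite big_cons; exact: tightPD.
Qed.

(** [o_P(1) O_P(1) = o_P(1)]. *)
Lemma cvpr0_tightM S S' : cvpr S 0 -> tightP S' ->
  cvpr (fun n t => S n t * S' n t) 0.
Proof.
move=> [mS cS] [mS' tS']; split=> [n|e e0]; first exact: measurable_funM.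
split=> [n|e' e'0].
  by apply: measurable_norm_ge; apply: measurable_funB => //; exact: measurable_funM.
have e20 : 0 < e' / 2 by lra.
have [L L0 hL] := tS' _ e20; have [_ /(_ _ e20) hS] := cS (e / L) (divr_gt0 e0 L0).
near=> n.
apply: (@le_trans _ _
    (P ([set t | e / L <= `|S n t - 0|] `|` [set t | L <= `|S' n t|]))).
  apply: le_measure; rewrite ?inE.
  - apply: measurable_norm_ge; apply: measurable_funB => //; exact: measurable_funM.
  - by apply: measurableU; apply: measurable_norm_ge => //; exact: measurable_funB.
  - move=> t /=; rewrite !subr0; apply: contraPP => /not_orP[/negP + /negP].
    rewrite -!ltNge => h1 h2; apply/negP; rewrite -ltNge normrM.
    by rewrite -(divfK (lt0r_neq0 L0) e); apply: ltr_pM.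
apply: le_trans (measureU2 _ _ _) _; try exact: measurable_norm_ge.
  by apply: measurable_norm_ge => //; exact: measurable_funB.
rewrite (_ : e' = e' / 2 + e' / 2); last by lra.
by rewrite EFinD; apply: leeD; near: n.
Unshelve. all: by end_near. Qed.

Lemma cvpr0_le S S' A : (forall n, measurable_fun setT (S n)) -> rare A ->
  (\forall n \near \oo, forall t, ~ A n t -> `|S n t| <= `|S' n t|) ->
  cvpr S' 0 -> cvpr S 0.
Proof.
move=> mS rA SS' [mS' cS']; split=> // e e0.
apply: rareS (rareU rA (cS' _ e0)).
  by move=> n; apply: measurable_norm_ge; exact: measurable_funB.
apply: filterS SS' => n SS' t /=; rewrite !subr0 => h.
by case: (pselect (A n t)) => [|/SS' h']; [left|right; exact: le_trans h'].
Qed.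

Lemma cvpr_subr0 S c : cvpr S c <-> cvpr (fun n t => S n t - c) 0.
Proof.
split=> [cS|cS].
  by rewrite -(subrr c); apply: cvprB cS (cvpr_cst c).
rewrite -[c]add0r (_ : S = fun n t => S n t - c + c).
  exact: cvprD cS (cvpr_cst c).
by apply/funext => n; apply/funext => t; rewrite subrK.
Qed.

Lemma tightP_add S S' : tightP S -> cvpr (fun n t => S' n t - S n t) 0 ->
  tightP S'.
Proof.
move=> tS /cvpr_tight /(tightPD tS); congr tightP.
by apply/funext => n; apply/funext => t; rewrite addrC subrK.
Qed.

(** Division by a diverging sequence: this turns a normalized error bounded in
    probability into consistency. *)
Lemma tight_div_cvpr0 S (c : nat -> R) : c @ \oo --> 0 -> tightP S ->
  cvpr (fun n t => c n * S n t) 0.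
Proof.
move=> c0 tS; apply: (@cvpr0_tightM (fun n _ => c n)) => //.
split=> [n|e e0]; first exact: measurable_cst.
split=> [n|e' e'0].
  by apply: measurable_norm_ge; apply: measurable_funB => //; exact: measurable_cst.
move/cvgr0Pnorm_lt : c0 => /(_ _ e0); apply: filterS => n cn.
have -> : [set t : T | e <= `|c n - 0|] = set0.
  by apply/seteqP; split => t //=; rewrite subr0 leNgt cn.
by rewrite measure0 lee_fin ltW.
Qed.

End convergence_in_probability.

(** * Equality in law, independence and i.i.d. sequences *)

Section equality_in_law.
Context {R : realType} {dU : measure_display} {U : measurableType dU}.
Local Open Scope ereal_scope.

Lemma integral_law {d : measure_display} {T : measurableType d}
    (mu : {measure set T -> \bar R}) (phi : T -> U) (f : U -> \bar R) :
  measurable_fun setT phi -> measurable_fun setT f ->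
  \int[pushforward mu phi]_y f y = \int[mu]_x f (phi x).
Proof.
move=> mphi mf; rewrite [LHS]integralE [RHS]integralE.
rewrite (ge0_integral_pushforward mphi)//; last exact: measurable_funepos.
rewrite (ge0_integral_pushforward mphi)//; last exact: measurable_funeneg.
by rewrite preimage_setT -(funepos_comp f phi) -(funeneg_comp f phi).
Qed.

Context {d1 d2 : measure_display} {T1 : measurableType d1}
  {T2 : measurableType d2}.
Variables (mu1 : {measure set T1 -> \bar R}) (mu2 : {measure set T2 -> \bar R}).
Variables (phi1 : T1 -> U) (phi2 : T2 -> U).
Hypotheses (mphi1 : measurable_fun setT phi1) (mphi2 : measurable_fun setT phi2).
Hypothesis law12 : forall A, measurable A ->
  mu1 (phi1 @^-1` A) = mu2 (phi2 @^-1` A).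

Lemma eq_law_integral (f : U -> \bar R) : measurable_fun setT f ->
  \int[mu1]_x f (phi1 x) = \int[mu2]_x f (phi2 x).
Proof.
move=> mf; rewrite -(integral_law mu1 mphi1 mf) -(integral_law mu2 mphi2 mf).
by apply: eq_measure_integral => A mA _; exact: law12.
Qed.

Lemma eq_law_integrable (f : U -> \bar R) : measurable_fun setT f ->
  mu1.-integrable setT (f \o phi1) -> mu2.-integrable setT (f \o phi2).
Proof.
move=> mf /integrableP[_ h]; apply/integrableP; split.
  exact: measurableT_comp.
rewrite -(@eq_law_integral (fun u => `|f u|))//; exact: measurableT_comp.
Qed.

End equality_in_law.

Section equality_in_law_mean.
Context {R : realType} {dU d1 d2 : measure_display} {U : measurableType dU}
  {T1 : measurableType d1} {T2 : measurableType d2}.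
Variables (P1 : probability T1 R) (P2 : probability T2 R).
Variables (phi1 : T1 -> U) (phi2 : T2 -> U).
Hypotheses (mphi1 : measurable_fun setT phi1) (mphi2 : measurable_fun setT phi2).
Hypothesis law12 : forall A, measurable A ->
  P1 (phi1 @^-1` A) = P2 (phi2 @^-1` A).

Lemma eq_law_mean (f : U -> R) : measurable_fun setT f ->
  mean P1 (f \o phi1) = mean P2 (f \o phi2).
Proof.
move=> mf; rewrite /mean; congr fine.
apply: (@eq_law_integral _ _ _ _ _ _ _ _ _ _ _ _ _ _ (EFin \o f)) => //.
exact/measurable_EFinP.
Qed.

Lemma eq_law_L1 (f : U -> R) : measurable_fun setT f ->
  L1 P1 (f \o phi1) -> L1 P2 (f \o phi2).
Proof.
move=> mf; apply: (@eq_law_integrable _ _ _ _ _ _ _ _ _ _ _ _ _ _ (EFin \o f)) => //.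
exact/measurable_EFinP.
Qed.

Lemma eq_law_L2 (f : U -> R) : measurable_fun setT f ->
  L2 P1 (f \o phi1) -> L2 P2 (f \o phi2).
Proof.
move=> mf [_ f2]; split; first exact: measurableT_comp.
apply: (@eq_law_L1 (fun u => f u ^+ 2)) f2; exact: measurable_funX.
Qed.

End equality_in_law_mean.

Section independence.
Context {R : realType} {d d1 d2 : measure_display} {T : measurableType d}
  {U : measurableType d1} {V : measurableType d2}.
Variables (P : probability T R) (X : T -> U) (Y : T -> V).
Hypotheses (mX : measurable_fun setT X) (mY : measurable_fun setT Y).
Hypothesis XY : independent2 P X Y.

Let mX_mixin := isMeasurableFun.Build _ _ _ _ _ mX.
Let X' : {mfun T >-> U} := HB.pack X mX_mixin.
Let mY_mixin := isMeasurableFun.Build _ _ _ _ _ mY.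
Let Y' : {mfun T >-> V} := HB.pack Y mY_mixin.

Let mXY : measurable_fun setT (fun t => (X t, Y t)).
Proof. exact: measurable_fun_pair. Qed.

Let law_pair (C : set (U * V)) : measurable C ->
  (distribution P X' \x distribution P Y')%E C = P ((fun t => (X t, Y t)) @^-1` C).
Proof.
move=> mC.
apply: (@product_measure_unique _ _ _ _ _ (distribution P X') (distribution P Y')
  (pushforward P (fun t => (X t, Y t)))) => //.
Qed.

(** Fubini's theorem for the joint law, which is the product of the two laws. *)
Lemma indep_mean (F : U * V -> R) : measurable_fun setT F ->
  L1 P (fun t => F (X t, Y t)) ->
  mean P (fun t => F (X t, Y t)) = mean P (fun t => mean P (fun s => F (X t, Y s))).
Proof.
move=> mF F1.
have mEF : measurable_fun setT (EFin \o F) by exact/measurable_EFinP.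
have i2 : (distribution P X' \x distribution P Y')%E.-integrable setT (EFin \o F).
  have := @eq_law_integrable _ _ _ _ _ _ _ P
    (distribution P X' \x distribution P Y')%E
    (fun t => (X t, Y t)) id mXY _ _ _ mEF F1; apply => //.
  by move=> A mA; exact/esym/law_pair.
have E1 : (\int[P]_t (F (X t, Y t))%:E)%E =
    (\int[distribution P X' \x distribution P Y']_z (F z)%:E)%E.
  apply: (@eq_law_integral _ _ _ _ _ _ _ P
    (distribution P X' \x distribution P Y')%E
    (fun t => (X t, Y t)) id mXY _ _ (EFin \o F)) => //.
  by move=> A mA; exact/esym/law_pair.
rewrite {1}/mean E1 -(integral12_prod_meas1 i2).
have iF := integrable_fubini_F i2.
have mFF := measurable_int _ iF.
rewrite /distribution integral_law// {1}/mean; congr fine.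
pose N := [set x | fubini_F (distribution P Y') (EFin \o F) x \is a fin_num].
have FE t : fubini_F (distribution P Y') (EFin \o F) (X t) =
   (\int[P]_s (F (X t, Y s))%:E)%E.
  rewrite /fubini_F /distribution integral_law//.
  by apply/measurable_EFinP; apply: measurableT_comp => //; exact: measurable_pair1.
have iFP : P.-integrable setT (fubini_F (distribution P Y') (EFin \o F) \o X).
  apply: (@eq_law_integrable _ _ _ _ _ _ _ (distribution P X') P id X) => //.
have := integrable_ae measurableT iFP.
move=> ae; apply: ae_eq_integral => //.
- exact: measurable_int iFP.
- apply/measurable_EFinP; apply: measurableT_comp => //.
  rewrite (_ : (fun t => _) = fubini_F (distribution P Y') (EFin \o F) \o X); last first.
    by apply/funext => t; rewrite /= FE.
  exact: measurable_int iFP.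
- apply: filterS ae => t /(_ Logic.I) /= ft _.
  by rewrite /mean -FE fineK// FE.
Qed.

Lemma indep_meanM (f : U -> R) (g : V -> R) :
  measurable_fun setT f -> measurable_fun setT g ->
  L2 P (f \o X) -> L2 P (g \o Y) ->
  mean P (fun t => f (X t) * g (Y t)) = mean P (f \o X) * mean P (g \o Y).
Proof.
move=> mf mg f2 g2.
rewrite (@indep_mean (fun z => f z.1 * g z.2)); first last.
- exact: (L1_mul f2 g2).
- by apply: measurable_funM; exact: measurableT_comp.
rewrite mulrC -meanZ; last exact: L2_L1.
by congr mean; apply/funext => t; rewrite /= meanZ 1?mulrC//; exact: L2_L1 g2.
Qed.

End independence.

Section dominated_convergence_mean.
Context {d : measure_display} {T : measurableType d} {R : realType}.
Variable P : probability T R.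

Lemma dominated_mean (f_ : nat -> T -> R) (f g : T -> R) :
  (forall n, measurable_fun setT (f_ n)) -> measurable_fun setT f ->
  (forall x, f_ n x @[n --> \oo] --> f x) ->
  (forall n x, `|f_ n x| <= g x) -> L1 P g ->
  mean P (f_ n) @[n --> \oo] --> mean P f.
Proof.
move=> mf_ mf f_f f_g g1.
have mEf_ n : measurable_fun setT (EFin \o f_ n) by exact/measurable_EFinP.
have mEf : measurable_fun setT (EFin \o f) by exact/measurable_EFinP.
have [||f1 _ h] := @dominated_convergence _ _ _ P setT measurableT
  (fun n => EFin \o f_ n) (EFin \o f) (EFin \o g) mEf_ mEf _ g1.
- by apply: aeW => x _; apply: cvg_EFin; [exact: nearW|exact: f_f].
- by apply: aeW => x n _; rewrite /= lee_fin.
by move: h; rewrite (meanE f1) => /fine_cvg.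
Qed.

(** Uniform integrability of a single function, by dominated convergence. *)
Lemma mean_tail_cvg0 (f : T -> R) : L1 P f ->
  mean P (fun x => `|f x| * (n%:R < `|f x|)%R%:R) @[n --> \oo] --> (0 : R).
Proof.
move=> f1; have mf := L1_measurable f1; rewrite -[X in _ --> X](mean_cst P 0).
apply: (@dominated_mean _ _ (fun x => `|f x|)).
- move=> n; apply: measurable_funM; first exact: measurableT_comp.
  rewrite (_ : (fun x => _) = \1_[set x | n%:R < `|f x|]); last first.
    apply/funext => x; rewrite indicE; congr (_%:R); congr nat_of_bool.
    by apply/idP/idP; rewrite inE.
  apply: measurable_indic.
  rewrite (_ : [set _ | _] = ~` [set x | `|f x| <= n%:R]).
    by apply/measurableC/measurable_le => //; exact: measurableT_comp.
  by apply/seteqP; split => x /=; rewrite ltNge => /negP.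
- exact: measurable_cst.
- move=> x; apply: cvg_near_cst; near=> n.
  rewrite ltNge (_ : `|f x| <= n%:R) ?mulr0//.
  by near: n; exact: nbhs_infty_ger.
- move=> n x; rewrite normrM normr_id ler_piMr//.
  by case: (_ < _); rewrite ?normr1 ?normr0.
- exact: L1_norm.
Unshelve. all: by end_near. Qed.

End dominated_convergence_mean.

Section iid.
Context {R : realType} {d0 d dU : measure_display} {T0 : measurableType d0}
  {T : measurableType d} {U : measurableType dU}.
Variables (Q : probability T0 R) (Z0 : T0 -> U).
Variables (P : probability T R) (Z : nat -> T -> U).
Hypotheses (mZ0 : measurable_fun setT Z0) (iidZ : iid_copies Q Z0 P Z).

Lemma iid_measurable i : measurable_fun setT (Z i).
Proof. by case: iidZ. Qed.

Lemma iid_law i A : measurable A -> Q (Z0 @^-1` A) = P (Z i @^-1` A).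
Proof. by case: iidZ => _ h _ mA; rewrite h. Qed.

Lemma iid_L1 i (f : U -> R) : measurable_fun setT f ->
  L1 Q (f \o Z0) -> L1 P (f \o Z i).
Proof. by apply: eq_law_L1 => //; [exact: iid_measurable|exact: iid_law]. Qed.

Lemma iid_L2 i (f : U -> R) : measurable_fun setT f ->
  L2 Q (f \o Z0) -> L2 P (f \o Z i).
Proof. by apply: eq_law_L2 => //; [exact: iid_measurable|exact: iid_law]. Qed.

Lemma iid_mean i (f : U -> R) : measurable_fun setT f ->
  mean P (f \o Z i) = mean Q (f \o Z0).
Proof.
by move=> mf; apply/esym/eq_law_mean => //; [exact: iid_measurable|exact: iid_law].
Qed.

Lemma iid_indep2 i j : i != j -> independent2 P (Z i) (Z j).
Proof.
move=> ij A B mA mB; pose C k := if k == i then A else B.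
have ji : (j == i) = false by rewrite eq_sym; exact/negbTE.
have mC k : measurable (C k) by rewrite /C; case: ifP.
have uij : uniq [:: i; j] by rewrite /= inE ij.
have := let: And3 _ _ h := iidZ in h [:: i; j] C uij mC.
rewrite !big_cons big_nil mule1 /C eqxx ji => <-.
congr (P _); apply/seteqP; split => t.
  by move=> [hA hB] k /=; rewrite !inE => /orP[/eqP->|/eqP->]; rewrite ?eqxx ?ji.
move=> h; split; first by have := h i; rewrite /= !inE eqxx => /(_ isT).
by have := h j; rewrite /= !inE eqxx orbT ji => /(_ isT).
Qed.

Lemma eq_measure_rect {d1 d2 : measure_display} {U1 : measurableType d1}
    {U2 : measurableType d2} (m1 m2 : {measure set (U1 * U2) -> \bar R}) :
  (m1 setT < +oo)%E ->
  (forall A B, measurable A -> measurable B -> m1 (A `*` B) = m2 (A `*` B)) ->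
  forall C, measurable C -> m1 C = m2 C.
Proof.
move=> fin h C mC.
apply: (measure_unique [set A `*` B | A in measurable & B in measurable]
  (fun=> setT)) => //.
- by rewrite measurable_prod_measurableType.
- move=> _ _ [A1 mA1 [B1 mB1 <-]] [A2 mA2 [B2 mB2 <-]].
  exists (A1 `&` A2); first exact: measurableI.
  by exists (B1 `&` B2); [exact: measurableI|rewrite setXI].
- by move=> _; exists setT => //; exists setT => //; rewrite setXTT.
- by rewrite bigcup_const//; exists 0%N.
- by move=> _ [A mA [B mB <-]]; exact: h.
Qed.

Variable phi : U -> R.
Hypothesis mphi : measurable_fun setT phi.

Definition psum k t := \sum_(i < k) phi (Z i t).

Lemma measurable_psum k : measurable_fun setT (psum k).
Proof.
apply: measurable_sum => i; apply: measurableT_comp => //; exact: iid_measurable.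
Qed.

Let cyl (s : seq nat) (A : nat -> set U) := \bigcap_(i in [set` s]) (Z i @^-1` A i).

Let mpre i A : measurable A -> measurable (Z i @^-1` A).
Proof.
by move=> mA; rewrite -[X in measurable X]setTI; exact: iid_measurable.
Qed.

Let mcyl s A : (forall i, measurable (A i)) -> measurable (cyl s A).
Proof.
by move=> mA; apply: fin_bigcap_measurable => // i _; exact: mpre.
Qed.

Let cyl_cons k s A : cyl (k :: s) A = Z k @^-1` A k `&` cyl s A.
Proof.
apply/seteqP; split => t.
  move=> h; split; first by apply: (h k); rewrite /= mem_head.
  by move=> i /= si; apply: (h i); rewrite /= inE si orbT.
move=> [hk hs] i /=; rewrite inE => /orP[/eqP->//|]; exact: hs.
Qed.

(** By induction on [k]. On the cylinder [E] of the remaining coordinates the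
    joint law of the [k]-th partial sum and the [k]-th observation is a finite
    measure on a product. On rectangles it agrees, by induction, with [P E]
    times the law without [E], hence it does so on the measurable set of pairs
    that put the next partial sum in [B]. *)
Let psum_indep_cyl k : forall (s : seq nat) A B, uniq s -> all (fun i => k <= i)%N s ->
  (forall i, measurable (A i)) -> measurable B ->
  P (psum k @^-1` B `&` cyl s A) =
    (P (psum k @^-1` B) * \prod_(i <- s) P (Z i @^-1` A i))%E.
Proof.
have cylE s A : uniq s -> (forall i, measurable (A i)) ->
    P (cyl s A) = (\prod_(i <- s) P (Z i @^-1` A i))%E.
  by case: iidZ => _ _ h us mA; exact: h.
elim: k => [|k ih] s A B us ks mA mB.
  have -> : psum 0 = cst 0.
    by apply/funext => t; rewrite /psum big_ord0.
  rewrite preimage_cst; case: ifPn => _; last by rewrite set0I measure0 mul0e.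
  by rewrite setTI probability_setT mul1e cylE.
have ks' : all (fun i => k <= i)%N s by apply: sub_all ks => i; exact: ltnW.
have kNs : k \notin s by apply/negP => /(allP ks); rewrite ltnn.
pose E := cyl s A; have mE : measurable E by exact: mcyl.
pose W t := (psum k t, Z k t).
have mW : measurable_fun setT W.
  by apply: measurable_fun_pair; [exact: measurable_psum|exact: iid_measurable].
have c0 : 0 <= fine (P E) by exact: fine_ge0.
pose m1 := pushforward (mrestr P mE) W.
pose m2 := pushforward (mscale (NngNum c0) P) W.
have PE : (fine (P E))%:E = P E by rewrite fineK//; exact: fin_num_measure.
have mB' B' : measurable B' -> measurable (psum k @^-1` B').
  by move=> mB'; rewrite -[X in measurable X]setTI; exact: measurable_psum.
have m2E C : (m2 C = P E * P (W @^-1` C))%E by rewrite -PE.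
have m12 C : measurable C -> m1 C = m2 C.
  apply: (eq_measure_rect (m1 := m1) (m2 := m2)).
    have : (P E < +oo)%E by rewrite -PE ltry.
    by rewrite -[X in P X]setTI.
  move=> B' A' mB'' mA'; rewrite [RHS]m2E.
  transitivity (P (W @^-1` (B' `*` A') `&` E)); first by [].
  (* the cylinder with base A' at the new coordinate k *)
  pose A2 i := if i == k then A' else A i.
  have mA2 i : measurable (A2 i) by rewrite /A2; case: ifP.
  have prodE : (\prod_(i <- s) P (Z i @^-1` A2 i) = P E)%E.
    rewrite cylE//; apply: eq_big_seq => i si; rewrite /A2; case: eqP => // ik.
    by rewrite -ik si in kNs.
  have cE : cyl s A2 = E.
    apply/seteqP; split => t h i /= si; have := h i si; rewrite /= /A2; case: eqP => // ik.
      by rewrite -ik si in kNs.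
    by rewrite -ik si in kNs.
  have -> : W @^-1` (B' `*` A') `&` E = psum k @^-1` B' `&` cyl (k :: s) A2.
    by rewrite cyl_cons cE setIA /A2 eqxx.
  have -> : W @^-1` (B' `*` A') = psum k @^-1` B' `&` cyl [:: k] A2.
    rewrite cyl_cons /A2 eqxx [cyl [::] _](_ : _ = setT) ?setIT//.
    by apply/seteqP; split => // t _ i /=.
  rewrite !ih//=; first last.
  - by rewrite leqnn.
  - by rewrite kNs.
  - by rewrite leqnn.
  by rewrite !big_cons big_nil prodE mule1 muleA [RHS]muleC.
have := m12 ((fun z => z.1 + phi z.2) @^-1` B); rewrite m2E.
rewrite -[m1 _]/(P (W @^-1` _ `&` E)).
have -> : W @^-1` ((fun z => z.1 + phi z.2) @^-1` B) = psum k.+1 @^-1` B.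
  by apply/seteqP; split => t; rewrite /preimage/= /psum big_ord_recr.
rewrite -cylE// muleC; apply.
rewrite -[X in measurable X]setTI.
have : measurable_fun setT (fun z : R * U => z.1 + phi z.2).
  by apply: measurable_funD => //; exact: measurableT_comp.
exact.
Qed.

Lemma psum_indep k : independent2 P (psum k) (Z k).
Proof.
move=> B A mB mA; have := @psum_indep_cyl k [:: k] (fun=> A) B.
rewrite /= leqnn big_cons big_nil mule1 cyl_cons [cyl [::] _](_ : _ = setT) ?setIT.
  by apply.
by apply/seteqP; split => // t _ i /=.
Qed.

End iid.

(** * Sample averages and the weak law of large numbers *)

Section law_of_large_numbers.
Context {R : realType} {d0 d dU : measure_display} {T0 : measurableType d0}
  {T : measurableType d} {U : measurableType dU}.
Variables (Q : probability T0 R) (Z0 : T0 -> U).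
Variables (P : probability T R) (Z : nat -> T -> U).
Hypotheses (mZ0 : measurable_fun setT Z0) (iidZ : iid_copies Q Z0 P Z).
Implicit Types phi : U -> R.

Definition avg phi n t := n%:R^-1 * \sum_(i < n) phi (Z i t).

(** The empirical process: centered sums over the square root of the sample
    size. *)
Definition emp phi n t :=
  (Num.sqrt n%:R)^-1 * \sum_(i < n) (phi (Z i t) - mean Q (phi \o Z0)).

Lemma measurable_avg phi n : measurable_fun setT phi ->
  measurable_fun setT (avg phi n).
Proof.
move=> mphi; apply: measurable_funM => //; exact: (measurable_psum iidZ).
Qed.

Lemma measurable_emp phi n : measurable_fun setT phi ->
  measurable_fun setT (emp phi n).
Proof.
move=> mphi; apply: measurable_funM => //.
apply: measurable_sum => i; apply: measurable_funB => //.
by apply: measurableT_comp => //; exact: (iid_measurable iidZ).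
Qed.

(** The variance of a sum of centered independent terms is the sum of the
    variances: pairwise independence kills the off-diagonal products. *)
Lemma mean_sqr_psum phi n : measurable_fun setT phi -> L2 Q (phi \o Z0) ->
  mean Q (phi \o Z0) = 0 ->
  mean P (fun t => (\sum_(i < n) phi (Z i t)) ^+ 2) =
  n%:R * mean Q (fun t => phi (Z0 t) ^+ 2).
Proof.
move=> mphi phi2 phi0.
have L2i i : L2 P (phi \o Z i) by exact: (iid_L2 mZ0 iidZ).
have -> : (fun t => (\sum_(i < n) phi (Z i t)) ^+ 2) =
   (fun t => \sum_(i < n) \sum_(j < n) phi (Z i t) * phi (Z j t)).
  by apply/funext => t; rewrite expr2 big_distrlr.
rewrite mean_sum; last by move=> i; apply: L1_sum => j; exact: (L1_mul (L2i _) (L2i _)).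
rewrite (eq_bigr (fun=> mean Q (fun t => phi (Z0 t) ^+ 2))).
  by rewrite sumr_const card_ord mulr_natl.
move=> i _; rewrite mean_sum; last by move=> j; exact: (L1_mul (L2i _) (L2i _)).
rewrite (bigD1 i)//= big1 ?addr0; last first.
  move=> j ji; rewrite (indep_meanM (X := Z i) (Y := Z j))//.
  - by rewrite !(iid_mean mZ0 iidZ)// phi0 mul0r.
  - exact: (iid_measurable iidZ).
  - exact: (iid_measurable iidZ).
  - by apply: (iid_indep2 iidZ); rewrite eq_sym.
rewrite -(iid_mean mZ0 iidZ i (f := fun u => phi u ^+ 2))//.
exact: measurable_funX.
Qed.

Lemma L2_psum phi n : measurable_fun setT phi -> L2 Q (phi \o Z0) ->
  L2 P (fun t => \sum_(i < n) phi (Z i t)).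
Proof. by move=> mphi phi2; apply: L2_sum => i; exact: (iid_L2 mZ0 iidZ). Qed.

Lemma mean_sqr_emp phi n : measurable_fun setT phi -> L2 Q (phi \o Z0) ->
  L2 P (emp phi n) /\ mean P (fun t => emp phi n t ^+ 2) <=
    mean Q (fun t => (phi (Z0 t) - mean Q (phi \o Z0)) ^+ 2).
Proof.
move=> mphi phi2; pose psi u := phi u - mean Q (phi \o Z0).
have mpsi : measurable_fun setT psi by exact: measurable_funB.
have psi2 : L2 Q (psi \o Z0) by apply: L2B phi2 (L2_cst _ _).
have psi0 : mean Q (psi \o Z0) = 0.
  rewrite [LHS]meanB; [by rewrite mean_cst subrr|exact: L2_L1|exact: L1_cst].
split; first by apply: L2Z; exact: (@L2_psum psi).
have -> : (fun t => emp phi n t ^+ 2) =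
    fun t => (Num.sqrt n%:R)^-1 ^+ 2 * (\sum_(i < n) psi (Z i t)) ^+ 2.
  by apply/funext => t; rewrite exprMn.
rewrite meanZ; last by case: (@L2_psum psi n).
rewrite mean_sqr_psum// exprVn sqr_sqrtr// mulrA.
have [->|n0] := eqVneq n 0%N.
  by rewrite mulr0 mul0r; apply: mean_ge0 => t; exact: sqr_ge0.
by rewrite mulVf ?mul1r// pnatr_eq0.
Qed.

(** The variance of the empirical process does not grow with the sample size,
    so Chebyshev's inequality bounds it in probability. *)
Lemma tight_emp phi : measurable_fun setT phi -> L2 Q (phi \o Z0) ->
  tightP P (emp phi).
Proof.
move=> mphi phi2; split=> [n|e e0]; first exact: measurable_emp.
set v := mean Q (fun t => (phi (Z0 t) - mean Q (phi \o Z0)) ^+ 2).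
have v0 : 0 <= v by apply: mean_ge0 => t; exact: sqr_ge0.
have K0 : 0 < (v + 1) / e + 1 by rewrite ltr_wpDl// divr_ge0 ?ltW//; lra.
exists ((v + 1) / e + 1) => //; apply: nearW => n.
have [e2 ev] := mean_sqr_emp n mphi phi2.
apply: (le_trans (chebyshev2 e2 K0)); rewrite lee_fin.
rewrite ler_pdivrMr ?exprn_gt0//; apply: (le_trans ev); rewrite -/v.
have h : v + 1 <= e * ((v + 1) / e + 1).
  by rewrite mulrDr mulr1 mulrC divfK ?gt_eqF//; lra.
have h1 : 1 <= (v + 1) / e + 1 by rewrite lerDr divr_ge0 ?ltW//; lra.
have h2 : e * ((v + 1) / e + 1) <= e * ((v + 1) / e + 1) ^+ 2.
  by rewrite ler_pM2l// expr2 ler_peMr// ltW.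
by apply: le_trans h2; lra.
Qed.

Lemma L2_bounded (X : T0 -> R) M : measurable_fun setT X ->
  (forall x, `|X x| <= M) -> L2 Q X.
Proof.
move=> mX XM; split=> //; apply: (@L1_bounded _ _ _ _ _ (M ^+ 2)).
  exact: measurable_funX.
by move=> x; rewrite normrX lerXn2r ?nnegrE// (le_trans _ (XM x)).
Qed.

Lemma avg_emp phi n t : avg phi n t - n%:R / n%:R * mean Q (phi \o Z0) =
  (Num.sqrt n%:R)^-1 * emp phi n t.
Proof.
rewrite /avg /emp mulrA -invfM -expr2 sqr_sqrtr// sumrB sumr_const card_ord.
by rewrite mulrBr -[_ *+ n]mulr_natl; ring.
Qed.

Lemma sqrt_inv_cvg0 : (fun n : nat => (Num.sqrt n%:R : R)^-1) @ \oo --> (0 : R).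
Proof.
apply/cvgr0Pnorm_lt => e e0; near=> n.
have h : (e^-1) ^+ 2 < n%:R by near: n; exact: nbhs_infty_gtr.
have n0 : 0 < (n%:R : R) by apply: le_lt_trans h; exact: sqr_ge0.
rewrite ger0_norm ?invr_ge0// invf_plt ?posrE ?sqrtr_gt0//.
by rewrite -[ltLHS]ger0_norm ?invr_ge0 ?ltW// -sqrtr_sqr ltr_sqrt.
Unshelve. all: by end_near. Qed.

(** For square integrable [phi] the average is [n^(-1/2)] times a tight
    sequence. *)
Lemma wlln_L2 phi : measurable_fun setT phi -> L2 Q (phi \o Z0) ->
  cvpr P (avg phi) (mean Q (phi \o Z0)).
Proof.
move=> mphi phi2.
have h := tight_div_cvpr0 sqrt_inv_cvg0 (tight_emp mphi phi2).
rewrite -[X in cvpr _ _ X]add0r.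
have := cvprD h (cvpr_cst P (mean Q (phi \o Z0))).
apply: eq_cvpr => [|n]; last exact: measurable_avg.
near=> n => t; rewrite -avg_emp divff ?mul1r ?subrK//.
by rewrite pnatr_eq0 -lt0n; near: n; exists 1%N.
Unshelve. all: by end_near. Qed.

(** The weak law for integrable [phi]: truncation at a level [M] splits the
    average into a bounded part, covered by the square integrable case, and a
    tail part of small mean. *)
Lemma wlln phi : measurable_fun setT phi -> L1 Q (phi \o Z0) ->
  cvpr P (avg phi) (mean Q (phi \o Z0)).
Proof.
move=> mphi phi1; split=> [n|e e0]; first exact: measurable_avg.
have mA n c : measurable [set t | e <= `|avg phi n t - c|].
  by apply: measurable_norm_ge; apply: measurable_funB => //; exact: measurable_avg.
split=> // e' e'0.
pose tail (M : nat) u : R := `|phi u| * (M%:R < `|phi u|)%R%:R.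
have : mean Q (tail M \o Z0) @[M --> \oo] --> (0 : R) by exact: mean_tail_cvg0.
move/cvgr0Pnorm_le => /(_ (e * e' / 8)); have ee : 0 < e * e' / 8 by nra.
move=> /(_ ee) [M _ /(_ M (leqnn M)) tM].
pose high u : R := phi u * (M%:R < `|phi u|)%R%:R.
pose low u : R := phi u * (`|phi u| <= M%:R)%R%:R.
have low_high u : phi u = low u + high u.
  by rewrite /low /high -mulrDr ltNge; case: (_ <= _); rewrite /= ?addr0 ?add0r mulr1.
have norm_high u : `|high u| = tail M u.
  by rewrite /high /tail normrM; congr (_ * _); case: (_ < _); rewrite ?normr1 ?normr0.
have low_le u : `|low u| <= M%:R.
  rewrite /low normrM; have [h|h] := boolP (`|phi u| <= M%:R).
    by rewrite normr1 mulr1.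
  by rewrite normr0 mulr0.
have mlow : measurable_fun setT low.
  apply: measurable_funM => //.
  rewrite (_ : (fun _ => _%:R) = \1_[set u | `|phi u| <= M%:R]).
    by apply/measurable_indic/measurable_le => //; exact: measurableT_comp.
  apply/funext => u; rewrite indicE; congr (_%:R); congr nat_of_bool.
  by apply/idP/idP; rewrite inE.
have highE : high = fun u => phi u - low u.
  by apply/funext => u; apply/eqP; rewrite eq_sym subr_eq addrC -low_high.
have mhigh : measurable_fun setT high by rewrite highE; exact: measurable_funB.
have high1 : L1 Q (high \o Z0).
  apply: L1_le (L1_norm phi1) => [|t]; first exact: measurableT_comp.
  by rewrite /= norm_high /tail ler_piMr//; case: (_ < _).
have low2 : L2 Q (low \o Z0).
  by apply: (@L2_bounded _ M%:R) => [|t]; [exact: measurableT_comp|exact: low_le].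
have [_ /(_ (e / 2))] := wlln_L2 mlow low2.
have e20 : 0 < e / 2 by lra.
have e'20 : 0 < e' / 2 by lra.
move=> /(_ e20) [_ /(_ _ e'20) hlow].
set mu := mean Q (high \o Z0).
have mu_le : `|mu| <= e * e' / 8.
  apply: le_trans (norm_mean high1) _; apply: le_trans (ler_norm _) _.
  by apply: le_trans tM; rewrite (_ : (fun x => _) = tail M \o Z0)//; apply/funext => t;
    rewrite /= norm_high.
have highP i : L1 P (high \o Z i) by exact: (iid_L1 mZ0 iidZ).
near=> n.
have n0 : 0 < (n%:R : R) by rewrite ltr0n; near: n; exists 1%N.
have avg1 : L1 P (avg high n) by apply: L1Z; apply: L1_sum => i; exact: highP.
have avg_le : mean P (fun t => `|avg high n t|) <= e * e' / 8.
  have sum1 : L1 P (fun t => \sum_(i < n) `|high (Z i t)|).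
    by apply: L1_sum => i; exact: L1_norm (highP i).
  apply: (@le_trans _ _ (mean P (fun t => n%:R^-1 * \sum_(i < n) `|high (Z i t)|))).
    apply: le_mean; [exact: L1_norm|exact: L1Z|move=> t].
    rewrite normrM ger0_norm ?invr_ge0// ler_pM2l ?invr_gt0//.
    exact: ler_norm_sum.
  rewrite meanZ// mean_sum; last by move=> i; exact: L1_norm (highP i).
  rewrite (eq_bigr (fun=> mean Q (tail M \o Z0))); last first.
    move=> i _; rewrite -(iid_mean mZ0 iidZ i).
      by congr mean; apply/funext => t; rewrite /= norm_high.
    by apply: eq_measurable_fun (measurableT_comp (@normr_measurable R setT) mhigh) => u _; rewrite /= norm_high.
  rewrite sumr_const card_ord -[X in _ * X]mulr_natl mulKf ?gt_eqF//.
  exact: le_trans (ler_norm _) tM.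
apply: (@le_trans _ _ (P ([set t | e / 2 <= `|avg low n t - mean Q (low \o Z0)|] `|`
    [set t | e / 2 <= `|avg high n t - mu|]))).
  have -> : mean Q (phi \o Z0) = mean Q (low \o Z0) + mu.
    rewrite -meanD//; last exact: L2_L1.
    by congr mean; apply/funext => t; rewrite /= low_high.
  apply: le_measure; rewrite ?inE//.
    by apply: measurableU; apply: measurable_norm_ge; apply: measurable_funB => //;
      exact: measurable_avg.
  move=> t /=.
  have -> : avg phi n t = avg low n t + avg high n t.
    by rewrite /avg -mulrDr -big_split/=; congr (_ * _); apply: eq_bigr => i _.
  apply: contraPP => /not_orP[/negP + /negP]; rewrite -!ltNge => h1 h2.
  apply/negP; rewrite -ltNge.
  have -> : avg low n t + avg high n t - (mean Q (low \o Z0) + mu) =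
      avg low n t - mean Q (low \o Z0) + (avg high n t - mu) by ring.
  by apply: le_lt_trans (ler_normD _ _) _; lra.
apply: le_trans (measureU2 _ _ _) _; try by
  apply: measurable_norm_ge; apply: measurable_funB => //; exact: measurable_avg.
rewrite (_ : e' = e' / 2 + e' / 2); last by lra.
rewrite EFinD; apply: leeD; first by near: n.
apply: le_trans (markov1 (L1B avg1 (L1_cst _ mu)) e20) _.
rewrite lee_fin ler_pdivrMr//.
apply: (@le_trans _ _ (mean P (fun t => `|avg high n t| + `|mu|))).
  apply: le_mean; [exact/L1_norm/L1B/L1_cst|by apply: L1D; [exact: L1_norm|exact: L1_cst]|].
  by move=> t; exact: ler_normB.
rewrite meanD ?mean_cst; [|exact: L1_norm|exact: L1_cst].
lra.
Unshelve. all: by end_near. Qed.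

End law_of_large_numbers.

(** * Weighted integrals transported by a map *)

Section weighted_integrals.
Context {R : realType} {dU : measure_display} {U : measurableType dU}.
Local Open Scope ereal_scope.
Import HBNNSimple.

Section one_side.
Context {d : measure_display} {T : measurableType d}.
Variables (mu : {measure set T -> \bar R}) (X : T -> U) (V : T -> R).
Hypotheses (mX : measurable_fun setT X) (mV : measurable_fun setT V)
  (V0 : forall t, (0 <= V t)%R).

Let mEV : measurable_fun setT (EFin \o V).
Proof. exact/measurable_EFinP. Qed.

Let weighted_nnsfun (h : {nnsfun U >-> R}) :
  \int[mu]_t ((h (X t))%:E * (V t)%:E) =
  \sum_(r \in range h) (r%:E * \int[mu]_(t in X @^-1` (h @^-1` [set r])) (V t)%:E).
Proof.
have mXB B : measurable B -> measurable (X @^-1` B).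
  by move=> mB; rewrite -[X in measurable X]setTI; exact: mX.
have mhr r : measurable (h @^-1` [set r]) by exact: measurable_sfunP.
have m1 r : measurable_fun setT (fun t => (\1_(h @^-1` [set r]) (X t))%:E : \bar R).
  by apply/measurable_EFinP; apply: measurableT_comp => //.
have ind_ge0 r t : 0 <= (r * \1_(h @^-1` [set r]) (X t))%:E.
  by rewrite EFinM nnfun_muleindic_ge0.
transitivity (\int[mu]_t \sum_(r \in range h)
    ((r * \1_(h @^-1` [set r]) (X t))%:E * (V t)%:E)).
  apply: eq_integral => t _; rewrite fimfunE -fsumEFin//.
  by rewrite ge0_mule_fsuml.
rewrite ge0_integral_fsum//; first last.
- by move=> r t _; rewrite mule_ge0// lee_fin.
- move=> r; apply: emeasurable_funM => //.
  by under eq_fun do rewrite EFinM; exact: measurable_funeM.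
apply: eq_fsbigr => r /[!inE] -[u _ hu].
have r0 : (0 <= r)%R by rewrite -hu.
under eq_integral do rewrite EFinM -muleA.
rewrite ge0_integralZl//; first last.
- by move=> t _; rewrite mule_ge0// lee_fin.
- exact: emeasurable_funM.
congr (_ * _); rewrite [RHS]integral_mkcond; apply: eq_integral => t _.
rewrite patchE /= indicE.
have -> : (t \in X @^-1` (h @^-1` [set r])) = (X t \in h @^-1` [set r]).
  by apply/idP/idP; rewrite !inE.
by case: ifPn; rewrite ?mul1e ?mul0e.
Qed.

(** The right-hand side refers to [mu], [X] and [V] only through the weighted
    measures of the preimages under [X]: approximate [k] from below by simple
    functions and use monotone convergence. *)
Lemma weighted_integral_lim (k : U -> \bar R) (mk : measurable_fun setT k) :
  (forall u, 0 <= k u) ->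
  \int[mu]_t (k (X t) * (V t)%:E) =
  limn (fun n => \sum_(r \in range (nnsfun_approx measurableT mk n))
    (r%:E * \int[mu]_(t in X @^-1` (nnsfun_approx measurableT mk n @^-1` [set r]))
       (V t)%:E)).
Proof.
move=> k0; pose k_ := nnsfun_approx measurableT mk.
transitivity (limn (fun n => \int[mu]_t ((k_ n (X t))%:E * (V t)%:E))).
  rewrite -monotone_convergence//=.
  - apply: eq_integral => t _; apply/esym/cvg_lim => //=.
    apply: cvgeZr => //.
    exact: (cvg_nnsfun_approx measurableT mk (fun u _ => k0 u)).
  - move=> n; apply: emeasurable_funM => //.
    by apply/measurable_EFinP; apply: measurableT_comp.
  - by move=> n t _; rewrite mule_ge0// lee_fin.
  - move=> t _ m n mn; rewrite lee_wpmul2r ?lee_fin//.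
    exact/lefP/nd_nnsfun_approx.
by apply: congr_lim; apply/funext => n; rewrite weighted_nnsfun.
Qed.

End one_side.

Context {d1 d2 : measure_display} {T1 : measurableType d1} {T2 : measurableType d2}.

(** This extends an equality of integrals over events, such as the one that
    defines conditional means, to weights that are functions. *)
Lemma weighted_integral_eq
    (mu1 : {measure set T1 -> \bar R}) (X1 : T1 -> U) (V1 : T1 -> R)
    (mu2 : {measure set T2 -> \bar R}) (X2 : T2 -> U) (V2 : T2 -> R)
    (k : U -> \bar R) :
  measurable_fun setT X1 -> measurable_fun setT V1 -> (forall t, (0 <= V1 t)%R) ->
  measurable_fun setT X2 -> measurable_fun setT V2 -> (forall t, (0 <= V2 t)%R) ->
  (forall B, measurable B -> \int[mu1]_(t in X1 @^-1` B) (V1 t)%:E =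
                             \int[mu2]_(t in X2 @^-1` B) (V2 t)%:E) ->
  measurable_fun setT k -> (forall u, 0 <= k u) ->
  \int[mu1]_t (k (X1 t) * (V1 t)%:E) = \int[mu2]_t (k (X2 t) * (V2 t)%:E).
Proof.
move=> mX1 mV1 V10 mX2 mV2 V20 h mk k0.
rewrite (weighted_integral_lim mu1 mX1 mV1 V10 mk k0).
rewrite (weighted_integral_lim mu2 mX2 mV2 V20 mk k0).
apply: congr_lim; apply/funext => n; apply: eq_fsbigr => r _.
by rewrite h//; exact: measurable_sfunP.
Qed.

End weighted_integrals.

(** * The standard normal law *)

Section gaussian.
Context {R : realType}.
Local Notation leb := (@lebesgue_measure R).

Definition gauss : probability (measurableTypeR R) R := normal_prob 0 1.

Let phi : R -> R := normal_pdf 0 1.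

Let mphi : measurable_fun setT phi.
Proof. exact: measurable_normal_pdf. Qed.

Let phi0 x : 0 <= phi x.
Proof. exact: normal_pdf_ge0. Qed.

Let phiE x : phi x = normal_peak 1 * expR (- (x ^+ 2 / 2)).
Proof.
rewrite /phi normal_pdfE ?oner_eq0// /normal_fun subr0 expr1n.
by rewrite mulNr.
Qed.

Let cphi : continuous phi.
Proof. by apply: continuous_normal_pdf; rewrite oner_eq0. Qed.

Lemma integral_gauss (k : R -> \bar R) : measurable_fun setT k ->
  (forall x, 0 <= k x)%E ->
  (\int[gauss]_x k x = \int[leb]_x (k x * (phi x)%:E))%E.
Proof.
move=> mk k0.
have := @weighted_integral_eq R _ (measurableTypeR R) _ _ (measurableTypeR R)
  (measurableTypeR R) gauss id (cst 1) leb id phi k.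
move=> h; rewrite -h//.
- by apply: eq_integral => x _; rewrite mule1.
- move=> B mB; transitivity (\int[gauss]_(t in B) (cst 1%E t))%E; first by [].
  by rewrite integral_cst// mul1e.
Qed.

Lemma integral_affine (G : R -> R) (a e : R) : 0 < a -> continuous G ->
  (forall x, 0 <= G x) ->
  (\int[leb]_x (G x)%:E = \int[leb]_x (G (a * x + e) * a)%:E)%E.
Proof.
move=> a0 cG G0; pose F x := a * x + e.
have F' : F^`()%classic = cst a.
  apply/funext => x; rewrite derive1E /F deriveD// deriveM// derive_cst derive_id.
  by rewrite derive_cst scaler0 !addr0; exact: mulr1.
rewrite (@increasing_ge0_integration_by_substitutionT R F G)//.
- by apply: eq_integral => x _; rewrite F'.
- by move=> x y xy; rewrite /F ltrD2r ltr_pM2l.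
- by rewrite F' => ?; exact: cvg_cst.
- by rewrite F'; exact: is_cvg_cst.
- by rewrite F'; exact: is_cvg_cst.
- by apply/cvgrNyPle => A; near=> x; rewrite /F -lerBrDr -ler_pdivlMl//;
    near: x; exact: nbhs_ninfty_le.
- by apply/cvgryPge => A; near=> x; rewrite /F -lerBlDr -ler_pdivrMl//;
    near: x; exact: nbhs_pinfty_ge.
Unshelve. all: by end_near. Qed.

(** The two expressions of the density of [(x, b x + c z)]. *)
Let phi_rot (b c r x u : R) : c != 0 -> b ^+ 2 + c ^+ 2 = r ^+ 2 ->
  phi x * phi ((r * u - b * x) / c) = phi u * phi ((r * x - b * u) / c).
Proof.
move=> c0 bcr; rewrite !phiE mulrACA [RHS]mulrACA -!expRD; congr (_ * expR _).
have c20 : c ^+ 2 != 0 by rewrite expf_neq0.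
rewrite -!opprD -!mulrDl; congr (- (_ / _)).
rewrite !expr_div_n; apply: (mulIf c20); rewrite !mulrDl !divfK//.
have -> : c ^+ 2 = r ^+ 2 - b ^+ 2 by rewrite -bcr addrC addKr.
by ring.
Qed.

(** Rotation invariance of the standard normal law: [b N + c N'] has the law
    of [r N] when [b ^+ 2 + c ^+ 2 = r ^+ 2]. Substituting
    [u = (b x + c z) / r] in the inner integral and exchanging the integrals
    leaves, by [phi_rot], a normal density in [x] that integrates to [1]. *)
Lemma gauss_convolution_ge0 (f : R -> R) (b c r y : R) : 0 < c -> 0 < r ->
  b ^+ 2 + c ^+ 2 = r ^+ 2 -> continuous f -> (forall x, 0 <= f x) ->
  (\int[gauss]_x \int[gauss]_z (f (y + b * x + c * z))%:E =
   \int[gauss]_u (f (y + r * u))%:E)%E.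
Proof.
move=> c0 r0 bcr cf f0.
have c_neq0 : c != 0 by rewrite gt_eqF.
have mf : measurable_fun setT f by exact: continuous_measurable_fun.
have f0' x : (0 <= (f x)%:E)%E by rewrite lee_fin.
pose H (z : R * R) := f (y + r * z.2) * (phi z.2 * phi ((r * z.1 - b * z.2) / c) * (r / c)).
have mlin (s t : R) : measurable_fun setT (fun z : R * R => (s * z.1 - t * z.2) / c).
  apply: measurable_funM => //; apply: measurable_funB; apply: measurable_funM => //.
have mH : measurable_fun setT H.
  apply: measurable_funM.
    apply: measurableT_comp => //; apply: measurable_funD => //.
    exact: measurable_funM.
  apply: measurable_funM => //; apply: measurable_funM; first exact: measurableT_comp.
  exact: (measurableT_comp mphi (mlin r b)).
have maff (g : R -> R) (s t : R) : measurable_fun setT g ->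
    measurable_fun setT (fun u : R => g (s * u + t)).
  move=> mg; apply: (measurableT_comp mg).
  by apply: measurable_funD => //; exact: measurable_funM.
have maff' (g : R -> R) (s t : R) : measurable_fun setT g ->
    measurable_fun setT (fun u : R => g (t + s * u)).
  move=> mg; apply: (measurableT_comp mg).
  by apply: measurable_funD => //; exact: measurable_funM.
have rc0 : 0 < r / c by rewrite divr_gt0.
have H0 z : (0 <= (EFin \o H) z)%E.
  by rewrite lee_fin !mulr_ge0 ?invr_ge0// ltW.
have inner x : (\int[gauss]_z (f (y + b * x + c * z))%:E * (phi x)%:E =
    \int[leb]_u (H (x, u))%:E)%E.
  rewrite integral_gauss//; last first.
    apply/measurable_EFinP; apply: measurableT_comp => //.
    by apply: measurable_funD => //; exact: measurable_funM.
  under eq_integral do rewrite -EFinM.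
  rewrite (@integral_affine (fun z => f (y + b * x + c * z) * phi z) (r / c) (- (b * x / c)))//.
  - rewrite -ge0_integralZr//.
    + apply: eq_integral => u _; rewrite -EFinM /H/=; congr _%:E.
      have -> : r / c * u - b * x / c = (r * u - b * x) / c by field.
      have -> : y + b * x + c * ((r * u - b * x) / c) = y + r * u by field.
      by rewrite -(phi_rot x u c_neq0 bcr); ring.
    + apply/measurable_EFinP.
      apply: (maff (fun z => f (y + b * x + c * z) * phi z * (r / c))).
      apply: measurable_funM => //; apply: measurable_funM => //; exact: maff'.
    + by move=> u _; rewrite lee_fin mulr_ge0 ?(ltW rc0)// mulr_ge0.
    + by rewrite lee_fin.
  - move=> z; apply: cvgM; last exact: cphi.
    apply: (@continuous_comp _ _ _ (fun z => y + b * x + c * z) f); last exact: cf.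
    by apply: cvgD; [exact: cvg_cst|apply: cvgM; [exact: cvg_cst|exact: cvg_id]].
  - by move=> z; rewrite mulr_ge0.
rewrite integral_gauss; first last.
- by move=> x; exact: integral_ge0.
- have := @measurable_fun_fubini_tonelli_F _ _ (measurableTypeR R) (measurableTypeR R) R gauss
    (fun z => (f (y + b * z.1 + c * z.2))%:E); apply => //.
  apply/measurable_EFinP; apply: measurableT_comp => //.
  by apply: measurable_funD; [apply: measurable_funD => //|]; exact: measurable_funM.
under eq_integral do rewrite inner.
rewrite (fubini_tonelli (m1 := leb) (m2 := leb) (EFin \o H)); [|exact/measurable_EFinP|exact: H0].
rewrite integral_gauss//; last first.
  apply/measurable_EFinP; apply: measurableT_comp => //.
  by apply: measurable_funD => //; exact: measurable_funM.
apply: eq_integral => u _.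
rewrite /H /=.
transitivity (\int[leb]_x ((f (y + r * u) * phi u)%:E *
   (phi ((r / c) * x + - (b * u / c)) * (r / c))%:E))%E.
  apply: eq_integral => x _; rewrite -EFinM; congr _%:E.
  have -> : r / c * x - b * u / c = (r * x - b * u) / c by field.
  by ring.
rewrite ge0_integralZl//; first last.
- by rewrite lee_fin mulr_ge0.
- by move=> x _; rewrite lee_fin mulr_ge0// ltW.
- apply/measurable_EFinP; apply: measurable_funM => //.
  exact: (maff phi).
by rewrite -integral_affine// integral_normal_pdf mule1 EFinM.
Qed.

Let is_derive_phi (x : R) : is_derive x 1 phi (- x * phi x).
Proof.
have -> : phi = fun x => normal_peak 1 * expR (- (2^-1 * x ^+ 2)).
  by apply/funext => z; rewrite phiE mulrC [2^-1 * _]mulrC mulrC.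
have h : is_derive x 1 (fun x : R => - (2^-1 * x ^+ 2)) (- x).
  apply: is_derive_eq; rewrite ?scaler0 ?add0r.
  by rewrite /GRing.scale/=; field.
have := is_derive1_comp (is_derive_expR _) h.
move=> /(is_deriveZ (normal_peak 1)) [h2 h3]; apply: DeriveDef; first exact: h2.
by rewrite [LHS]h3 /GRing.scale/=; ring.
Qed.

(** Integration by parts in disguise: [F] is a primitive of
    [(x ^+ 2 - 1) phi x], so the second moment equals the total mass. The half
    line is cut at [1], where the integrand changes sign, in order to work with
    nonnegative integrands only. *)
Let F (x : R) := - (x * phi x).

Let is_derive_F (x : R) : is_derive x 1 F ((x ^+ 2 - 1) * phi x).
Proof.
have := is_deriveN (is_deriveM (is_derive_id x 1) (is_derive_phi x)).
case=> h1 h2; apply: DeriveDef; first exact: h1.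
by rewrite [LHS]h2 /GRing.scale/=; ring.
Qed.

Let F_cvg0 : F x @[x --> +oo] --> (0 : R).
Proof.
set c : R := normal_peak 1.
have c0 : 0 < c by apply: normal_peak_gt0; rewrite oner_eq0.
apply/cvgr0Pnorm_lt => e e0; near=> x.
have x0 : 0 < x by near: x; exact: nbhs_pinfty_gt.
have hx : 2 * c / e < x by near: x; apply: nbhs_pinfty_gt; rewrite num_real.
rewrite normrN ger0_norm; last by rewrite mulr_ge0// ltW.
have h : phi x * (1 + x ^+ 2 / 2) <= c.
  rewrite phiE -/c -mulrA ler_piMr ?(ltW c0)//.
  rewrite expRN ler_pdivrMl ?expR_gt0// mulr1; exact: expR_ge1Dx.
have h2 : phi x * x ^+ 2 <= 2 * c by have := phi0 x; nra.
rewrite -(ltr_pM2r x0) -mulrA mulrC.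
rewrite (_ : phi x * x * x = phi x * x ^+ 2); last by ring.
apply: le_lt_trans h2 _.
by move: hx; rewrite ltr_pdivrMr// [x * e]mulrC.
Unshelve. all: by end_near. Qed.

Let cF' : continuous (fun x : R => (x ^+ 2 - 1) * phi x).
Proof.
move=> x; apply: cvgM; last exact: cphi.
by apply: cvgB; [exact: exprn_continuous|exact: cvg_cst].
Qed.

Let dF x : derivable F x 1. Proof. by have [] := is_derive_F x. Qed.
Let F'E x : F^`()%classic x = (x ^+ 2 - 1) * phi x.
Proof. by rewrite derive1E; have [_] := is_derive_F x. Qed.

Let cF : continuous F.
Proof. by move=> x; apply/differentiable_continuous/derivable1_diffP. Qed.

Let tail1 : (\int[leb]_(x in `[1%R, +oo[) ((x ^+ 2 - 1) * phi x)%:E = (phi 1)%:E)%E.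
Proof.
rewrite (@ge0_continuous_FTC2y _ (fun x => (x ^+ 2 - 1) * phi x) F 1 0)//.
- by rewrite /F mul1r sub0e -EFinN opprK.
- move=> x x1; rewrite mulr_ge0// subr_ge0; exact: exprn_ege1.
- exact: continuous_subspaceT.
- by apply: cvg_at_right_filter; exact: cF.
Qed.

Let head1 : (\int[leb]_(x in `[0%R, 1%R]) ((1 - x ^+ 2) * phi x)%:E = (phi 1)%:E)%E.
Proof.
rewrite (@continuous_FTC2 _ (fun x => (1 - x ^+ 2) * phi x) (- F) 0 1)//.
- by rewrite -[(- F) 1]/(- F 1) -[(- F) 0]/(- F 0) /F mul1r mul0r !opprK sube0.
- apply: continuous_subspaceT => x.
  have -> : (fun x : R => (1 - x ^+ 2) * phi x) = fun x => - ((x ^+ 2 - 1) * phi x).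
    by apply/funext => z; ring.
  by apply: cvgN; exact: cF'.
- split.
  + by move=> x _; exact: derivableN.
  + by apply: cvg_at_right_filter; apply: cvgN; exact: cF.
  + by apply: cvg_at_left_filter; apply: cvgN; exact: cF.
- by move=> x _; rewrite derive1E deriveN// -derive1E F'E; ring.
Qed.

Let halfline : [set x : R | 0 <= x] = `[0%R, 1%R]%classic `|` `]1%R, +oo[%classic.
Proof.
apply/seteqP; split => x /=; rewrite !in_itv/= andbT.
  by move=> x0; case: (leP x 1); [left; rewrite x0|right].
by case=> [/andP[]//|x1]; rewrite (le_trans ler01)// ltW.
Qed.

Let mk_phi (k : R -> R) : measurable_fun setT k ->
  measurable_fun setT (fun x => (k x * phi x)%:E).
Proof. by move=> mk; apply/measurable_EFinP; exact: measurable_funM. Qed.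

Let integral_split (k : R -> R) : measurable_fun setT k -> (forall x, 0 <= k x) ->
  (\int[leb]_(x in [set x : R | (0 <= x)%R]) (k x * phi x)%:E =
   \int[leb]_(x in `[0%R, 1%R]) (k x * phi x)%:E +
   \int[leb]_(x in `]1%R, +oo[) (k x * phi x)%:E)%E.
Proof.
move=> mk k0; rewrite halfline ge0_integral_setU//.
- by apply: measurable_funTS; exact: mk_phi.
- by move=> x _; rewrite lee_fin mulr_ge0.
- by apply/disj_setPS => x /=; rewrite !in_itv/= andbT => -[/andP[_ /le_lt_trans h] /h]; rewrite ltxx.
Qed.

Let half_second_moment :
  (\int[leb]_(x in [set x : R | (0 <= x)%R]) (x ^+ 2 * phi x)%:E =
   \int[leb]_(x in [set x : R | (0 <= x)%R]) (1 * phi x)%:E)%E.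
Proof.
rewrite (@integral_split (fun x => x ^+ 2))//; last by move=> x; exact: sqr_ge0.
rewrite (@integral_split (fun=> 1))//.
have tailE : (\int[leb]_(x in `]1%R, +oo[) (x ^+ 2 * phi x)%:E =
    (phi 1)%:E + \int[leb]_(x in `]1%R, +oo[) (1 * phi x)%:E)%E.
  rewrite -tail1 -integral_itv_obnd_cbnd; last first.
    apply: measurable_funTS; apply: (mk_phi (k := fun x => x ^+ 2 - 1)).
    exact: measurable_funB.
  rewrite -ge0_integralD//.
  - by apply: eq_integral => x _; rewrite -EFinD; congr _%:E; ring.
  - move=> x /=; rewrite in_itv/= andbT => x1; rewrite lee_fin mulr_ge0//.
    by rewrite subr_ge0 exprn_ege1// ltW.
  - apply: measurable_funTS; apply: (mk_phi (k := fun x => x ^+ 2 - 1)).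
    exact: measurable_funB.
  - by move=> x _; rewrite lee_fin mulr_ge0.
  - by apply: measurable_funTS; exact: (mk_phi (k := fun=> 1)).
have headE : (\int[leb]_(x in `[0%R, 1%R]) (1 * phi x)%:E =
    (phi 1)%:E + \int[leb]_(x in `[0%R, 1%R]) (x ^+ 2 * phi x)%:E)%E.
  rewrite -head1 -ge0_integralD//.
  - by apply: eq_integral => x _; rewrite -EFinD; congr _%:E; ring.
  - move=> x /=; rewrite in_itv/= => /andP[x0 x1]; rewrite lee_fin mulr_ge0//.
    by rewrite subr_ge0 exprn_ile1.
  - apply: measurable_funTS; apply: (mk_phi (k := fun x => 1 - x ^+ 2)).
    exact: measurable_funB.
  - by move=> x _; rewrite lee_fin mulr_ge0// sqr_ge0.
  - by apply: measurable_funTS; exact: mk_phi.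
by rewrite tailE headE addeCA addeA.
Qed.

Lemma gauss_sqr : (\int[gauss]_x (x ^+ 2)%:E = 1)%E.
Proof.
rewrite integral_gauss; [|exact/measurable_EFinP|by move=> x; rewrite lee_fin sqr_ge0].
rewrite -(integral_normal_pdf 0 1) -/phi.
rewrite (@ge0_symfun_integralT _ phi)//; last first.
  by move=> x /=; rewrite !phiE sqrrN.
transitivity (\int[leb]_x (x ^+ 2 * phi x)%:E)%E; first by [].
rewrite (@ge0_symfun_integralT _ (fun x => x ^+ 2 * phi x))//.
- rewrite half_second_moment; congr (_ * _)%E.
  by apply: eq_integral => x _; rewrite mul1r.
- by move=> x; rewrite mulr_ge0// sqr_ge0.
- by move=> x; apply: cvgM; [exact: exprn_continuous|exact: cphi].
- by move=> x /=; rewrite !phiE sqrrN.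
Qed.

Lemma L2_gauss : L2 gauss (fun x : R => x).
Proof.
split; first exact: measurable_id.
apply/integrableP; split; first exact/measurable_EFinP.
rewrite (_ : integral _ _ _ = \int[gauss]_x (x ^+ 2)%:E)%E; last first.
  by apply: eq_integral => x _; rewrite /= ger0_norm// sqr_ge0.
by rewrite gauss_sqr ltry.
Qed.

Lemma mean_gauss_sqr : mean gauss (fun x : R => x ^+ 2) = 1.
Proof. by rewrite /mean gauss_sqr. Qed.

(** By symmetry [|x|] has twice the integral of its restriction to the positive
    half line, which is [(|x| + x) / 2]; so the integral of [x] vanishes. *)
Lemma mean_gauss : mean gauss (fun x : R => x) = 0.
Proof.
have g1 : L1 gauss (fun x : R => x) by exact: L2_L1 L2_gauss.
have a1 : L1 gauss (fun x : R => `|x|) by exact: (L1_norm g1).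
have p1 : L1 gauss (fun x : R => 2^-1 * (`|x| + x)) by apply: L1Z; exact: L1D.
have mabs : measurable_fun setT (fun x : R => `|x|) by exact: normr_measurable.
have h0 (x : R) : 0 <= `|x| + x by rewrite -lerBlDr sub0r -normrN ler_norm.
have : (\int[gauss]_x (`|x|)%:E = 2%:E * \int[gauss]_x (2^-1 * (`|x| + x))%:E)%E.
  rewrite (@integral_gauss (fun x => (`|x|)%:E)); first last.
  - by move=> x; rewrite lee_fin.
  - exact/measurable_EFinP.
  rewrite (@integral_gauss (fun x => (2^-1 * (`|x| + x))%:E)); first last.
  - by move=> x; rewrite lee_fin mulr_ge0.
  - apply/measurable_EFinP; apply: measurable_funM => //; exact: measurable_funD.
  transitivity (\int[leb]_x (`|x| * phi x)%:E)%E; first by [].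
  rewrite (@ge0_symfun_integralT _ (fun x => `|x| * phi x)).
  - congr (_ * _)%E; rewrite integral_mkcond; apply: eq_integral => x _.
    rewrite patchE; case: ifPn; rewrite ?inE/= => x0.
      by rewrite ger0_norm// -EFinM; congr _%:E; field.
    rewrite notin_setE/= in x0; move/negP : x0; rewrite -ltNge => x0.
    by rewrite ltr0_norm// addNr mulr0 mul0e.
  - by move=> x; rewrite mulr_ge0.
  - by move=> x; apply: cvgM; [exact: norm_continuous|exact: cphi].
  - by move=> x /=; rewrite normrN !phiE sqrrN.
rewrite !meanE//= -EFinM => -[].
rewrite meanZ ?meanD//; last exact: L1D.
by rewrite mulVKf//; lra.
Qed.

End gaussian.

(** * Taylor bounds and sliding averages *)

Section taylor.
Context {R : realType}.

Lemma increment_bound (f f1 : R -> R) (h K : R) :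
  (forall t : R, `|t| <= `|h| -> is_derive t 1 f (f1 t)) ->
  (forall t : R, `|t| <= `|h| -> `|f1 t| <= K) ->
  `|f h - f 0| <= K * `|h|.
Proof.
move=> df f1K.
have cont (a b : R) : (forall t : R, a <= t <= b -> `|t| <= `|h|) ->
    {within `[a, b], continuous f}.
  move=> ab; apply: derivable_within_continuous => t; rewrite in_itv/= => /ab tab.
  by have [] := df _ tab.
have [h0|h0] := leP 0 h.
  have hh t : 0 <= t <= h -> `|t| <= `|h|.
    by move=> /andP[t0 th]; rewrite !ger0_norm.
  have dseg t : t \in `]0, h[ -> is_derive t 1 f (f1 t).
     rewrite in_itv/= => /andP[t0 th]; apply: df; apply: hh.
    by rewrite !ltW.
  have [c] := MVT_segment h0 dseg (cont 0 h hh).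
  rewrite in_itv/= => /hh ch ->; rewrite subr0 normrM ler_wpM2r//.
  exact: f1K.
have hh t : h <= t <= 0 -> `|t| <= `|h|.
  by move=> /andP[t0 th]; rewrite !ler0_norm ?(ltW h0)// lerN2.
have dseg t : t \in `]h, 0[ -> is_derive t 1 f (f1 t).
   rewrite in_itv/= => /andP[t0 th]; apply: df; apply: hh.
  by rewrite !ltW.
have [c] := MVT_segment (ltW h0) dseg (cont h 0 hh).
rewrite in_itv/= => /hh ch; rewrite distrC => ->; rewrite sub0r normrM normrN ler_wpM2r//.
exact: f1K.
Qed.

Lemma taylor1_bound (f f1 f2 : R -> R) (h K : R) :
  (forall t : R, `|t| <= `|h| -> is_derive t 1 f (f1 t)) ->
  (forall t : R, `|t| <= `|h| -> is_derive t 1 f1 (f2 t)) ->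
  (forall t : R, `|t| <= `|h| -> `|f2 t| <= K) ->
  `|f h - f 0 - f1 0 * h| <= K * h ^+ 2.
Proof.
move=> df df1 f2K.
have := @increment_bound (fun t => f t - f1 0 * t) (fun t => f1 t - f1 0) h (K * `|h|).
rewrite mulr0 subr0 addrAC -mulrA -expr2 real_normK ?num_real//; apply.
  move=> t /df dft; have := is_deriveB dft (is_deriveZ (f1 0) (is_derive_id t 1)).
  case=> h1 h2; apply: DeriveDef; first exact: h1.
  by rewrite [LHS]h2 /GRing.scale/= mulr1.
move=> t th; apply: le_trans (@increment_bound f1 f2 t K _ _) _.
- by move=> s st; apply: df1; exact: le_trans th.
- by move=> s st; apply: f2K; exact: le_trans th.
- rewrite ler_wpM2l//; apply: le_trans (f2K 0 _) => //; by rewrite normr0.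
Qed.

Lemma taylor2_bound (f f1 f2 f3 : R -> R) (h K : R) :
  (forall t : R, is_derive t 1 f (f1 t)) -> (forall t : R, is_derive t 1 f1 (f2 t)) ->
  (forall t : R, is_derive t 1 f2 (f3 t)) -> (forall t : R, `|f3 t| <= K) ->
  `|f h - f 0 - f1 0 * h - f2 0 * h ^+ 2 / 2| <= K * `|h| ^+ 3.
Proof.
move=> df df1 df2 f3K.
have := @increment_bound (fun t => f t - f1 0 * t - f2 0 * t ^+ 2 / 2)
  (fun t => f1 t - f1 0 - f2 0 * t) h (K * `|h| ^+ 2).
rewrite mulr0 subr0 expr0n mulr0 mul0r subr0 -[K * _ * _]mulrA -exprSr.
rewrite (_ : f h - f1 0 * h - f2 0 * h ^+ 2 / 2 - f 0 =
  f h - f 0 - f1 0 * h - f2 0 * h ^+ 2 / 2); last by ring.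
apply.
  move=> t _.
  have dq : is_derive t 1 (fun t : R => f2 0 * t ^+ 2 / 2) (f2 0 * t).
    by apply: is_derive_eq; rewrite /GRing.scale/=; field.
  have [h1 h2] := is_deriveB (is_deriveB (df t) (is_deriveZ (f1 0) (is_derive_id t 1))) dq.
  apply: DeriveDef; first exact: h1.
  by rewrite [LHS]h2 /GRing.scale/= mulr1.
move=> t th; apply: le_trans (@taylor1_bound f1 f2 f3 t K _ _ _) _ => //.
rewrite -real_normK ?num_real// ler_wpM2l//; first exact: le_trans (f3K 0).
by rewrite lerXn2r ?nnegrE.
Qed.

End taylor.

Section sliding_average.
Context {R : realType}.

(** Minus its value near [-oo] the function is integrable on left half lines, and
    the fundamental theorem of calculus applies to these integrals. *)
Lemma ex_primitive (f : R -> R) (K M c : R) : continuous f -> (forall x, `|f x| <= M) ->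
  (forall x, x <= K -> f x = c) ->
  exists F : R -> R, forall x : R, is_derive x 1 F (f x).
Proof.
move=> cf fM fc; pose g x := f x - c.
have cg : continuous g by move=> x; apply: cvgB; [exact: cf|exact: cvg_cst].
have ig u : (@lebesgue_measure R).-integrable `]-oo, u] (EFin \o g).
  have mg : measurable_fun setT g by exact: continuous_measurable_fun.
  have ind1 : (@lebesgue_measure R).-integrable `]-oo, u]
      (fun x => ((2 * M) * \1_(`[K, u]%classic : set R) x)%:E).
    apply: (integrableS (E := setT)) => //.
    under eq_fun do rewrite EFinM.
    apply: integrableZl => //; exact: integrable_indic_itv.
  apply: le_integrable ind1 => //.
  - by apply/measurable_EFinP; exact: measurable_funTS.
  - move=> x /=; rewrite in_itv/= => xu; rewrite lee_fin indicE.
    have [xK|Kx] := leP x K.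
      rewrite /g fc// subrr normr0; exact: normr_ge0.
    rewrite mem_set/= ?in_itv/= ?(ltW Kx)// mulr1.
    rewrite /g -(fc K)//; apply: le_trans (ler_norm _).
    by apply: le_trans (ler_normB _ _) _; have := fM x; have := fM K; lra.
exists (fun x => \int[lebesgue_measure]_(t in `]-oo, x]) g t + c * x)%R => x.
have x1 : x < x + 1 by rewrite ltrDl.
have [dF F'] := continuous_FTC1 x1 (ig _) (ltNyr x) (cg x).
have hF : is_derive x 1 (fun x => \int[lebesgue_measure]_(t in `]-oo, x]) g t)%R (g x).
  by apply: DeriveDef; [exact: dF|rewrite -derive1E F'].
have [h1 h2] := is_deriveD hF (is_deriveZ c (is_derive_id x 1)).
apply: DeriveDef; first exact: h1.
by rewrite [LHS]h2 /GRing.scale/= /g; ring.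
Qed.

(** The average of [f] over windows of length [r], expressed by a primitive so
    that its properties follow from rules of differentiation. *)
Definition sliding_avg (r : R) (f Af : R -> R) : Prop :=
  exists2 F : R -> R, forall x : R, is_derive x 1 F (f x) &
    forall x, Af x = (F (x + r) - F x) / r.

(** The properties that an average inherits: bounded by [M], constant to the
    left of [K], with increments at most [e] over distances at most [r]. *)
Record test_fun (M K c e r : R) (f : R -> R) : Prop := TestFun {
  test_continuous : continuous f;
  test_bounded : forall x, `|f x| <= M;
  test_left : forall x, x <= K -> f x = c;
  test_modulus : forall x z, `|x - z| <= r -> `|f x - f z| <= e }.

Lemma is_derive_translate (F f : R -> R) (r : R) :
  (forall x : R, is_derive x 1 F (f x)) ->
  forall x : R, is_derive x 1 (fun x => F (x + r)) (f (x + r)).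
Proof.
move=> dF x.
have hs : is_derive x 1 (fun x : R => x + r) 1.
  have [h1 h2] := is_deriveD (is_derive_id x 1) (is_derive_cst r x 1).
  by apply: DeriveDef; [exact: h1|rewrite [LHS]h2 addr0].
have [h1 h2] := @is_derive1_comp R F (fun x => x + r) x _ _ (dF (x + r)) hs.
by apply: DeriveDef; [exact: h1|rewrite [LHS]h2 mulr1].
Qed.

Lemma is_derive_sliding (r : R) (f Af : R -> R) : sliding_avg r f Af ->
  forall x : R, is_derive x 1 Af ((f (x + r) - f x) / r).
Proof.
move=> [F dF AfE] x.
have -> : Af = fun x => r^-1 *: (F (x + r) - F x).
  by apply/funext => z; rewrite AfE mulrC.
have [h1 h2] := is_deriveZ r^-1 (is_deriveB (is_derive_translate r dF x) (dF x)).
apply: DeriveDef; first exact: h1.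
by rewrite [LHS]h2 /GRing.scale/= mulrC.
Qed.

Lemma sliding_mean_value (r : R) (f Af : R -> R) : 0 < r -> sliding_avg r f Af ->
  forall x, exists2 s, 0 <= s <= r & Af x = f (x + s).
Proof.
move=> r0 [F dF AfE] x.
have cF : {within `[x, x + r], continuous F}.
  by apply: derivable_within_continuous => t _; have [] := dF t.
have xr : x <= x + r by rewrite lerDl ltW.
have [s] := MVT_segment xr (fun t _ => dF t) cF.
rewrite in_itv/= => /andP[xs sr] Fs; exists (s - x); first lra.
have -> : x + (s - x) = s by ring.
by rewrite AfE Fs (_ : x + r - x = r) ?mulfK ?gt_eqF//; ring.
Qed.

(** By the mean value theorem a sliding average takes values of [f] within its
    window, which gives all bounds; the increment of [Af] is itself an average
    of increments of [f]. *)
Lemma ex_sliding (M K c e r : R) (f : R -> R) : 0 < r -> test_fun M K c e r f ->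
  exists2 Af, sliding_avg r f Af &
    test_fun M (K - r) c e r Af /\ forall x, `|Af x - f x| <= e.
Proof.
move=> r0 [cf fM fK fe].
have [F dF] := ex_primitive cf fM fK.
pose Af x := (F (x + r) - F x) / r.
have sA : sliding_avg r f Af by exists F.
have mv := sliding_mean_value r0 sA.
exists Af => //; split; [split|].
- move=> x; apply/differentiable_continuous/derivable1_diffP.
  by have [] := is_derive_sliding sA x.
- by move=> x; have [s _ ->] := mv x.
- move=> x xK; have [s /andP[s0 sr] ->] := mv x; apply: fK; lra.
- move=> x z xz.
  pose G t := F (x + t) - F (z + t).
  have dG (t : R) : is_derive t 1 G (f (x + t) - f (z + t)).
    have [h1 h2] := is_deriveB (is_derive_translate x dF t) (is_derive_translate z dF t).
    rewrite /G; under eq_fun do rewrite [x + _]addrC [z + _]addrC.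
    by apply: DeriveDef; [exact: h1|rewrite [LHS]h2 ![t + _]addrC].
  have : `|G r - G 0| <= e * `|r|.
    apply: increment_bound => t _.
    by apply: fe; rewrite (_ : x + t - (z + t) = x - z)//; ring.
  rewrite /G !addr0 (gtr0_norm r0) => h.
  have -> : Af x - Af z = (F (x + r) - F (z + r) - (F x - F z)) / r.
    by rewrite /Af; ring.
  by rewrite normrM normfV (gtr0_norm r0) ler_pdivrMr.
- move=> x; have [s /andP[s0 sr] ->] := mv x; apply: fe.
  by rewrite addrC addKr ger0_norm.
Qed.

End sliding_average.

(** * Uniform second order approximation *)

Section quadratic_approximation.
Context {R : realType}.
Implicit Types (g : R -> R).

(** [g] has the second order expansion with coefficients [g1] and [g2],
    uniformly on the line. This is all that Lindeberg's argument uses of a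
    smooth test function, and it passes to averages of translates of [g]. *)
Record quad_approx (C : R) (g g1 g2 : R -> R) : Prop := QuadApprox {
  quad_meas : measurable_fun setT g;
  quad_meas1 : measurable_fun setT g1;
  quad_meas2 : measurable_fun setT g2;
  quad_bounded : forall y, `|g y| <= C;
  quad_bounded1 : forall y, `|g1 y| <= C;
  quad_bounded2 : forall y, `|g2 y| <= C;
  quad_remainder : forall y h,
    `|g (y + h) - g y - g1 y * h - g2 y * (h ^+ 2 / 2)| <=
      C * (h ^+ 2 * Num.min 1 `|h|) }.

Definition diff_quot (r : R) (u : R -> R) (x : R) : R := (u (x + r) - u x) / r.

Lemma is_derive_diff_quot (r : R) (u u' : R -> R) :
  (forall x : R, is_derive x 1 u (u' x)) ->
  forall x : R, is_derive x 1 (diff_quot r u) (diff_quot r u' x).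
Proof.
move=> du x.
have -> : diff_quot r u = fun x => r^-1 *: (u (x + r) - u x).
  by apply/funext => z; rewrite /diff_quot mulrC.
have [h1 h2] := is_deriveZ r^-1 (is_deriveB (is_derive_translate r du x) (du x)).
apply: DeriveDef; first exact: h1.
by rewrite [LHS]h2 /GRing.scale/= mulrC.
Qed.

Lemma diff_quot_bound (r M : R) (u : R -> R) : 0 < r -> (forall x, `|u x| <= M) ->
  forall x, `|diff_quot r u x| <= 2 * M / r.
Proof.
move=> r0 uM x; rewrite /diff_quot normrM normfV (gtr0_norm r0).
rewrite ler_pM2r ?invr_gt0//; apply: le_trans (ler_normB _ _) _.
by have := uM x; have := uM (x + r); lra.
Qed.

Lemma derive_measurable (u u' : R -> R) :
  (forall x : R, is_derive x 1 u (u' x)) -> measurable_fun setT u.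
Proof.
move=> du; apply: continuous_measurable_fun => x.
by apply/differentiable_continuous/derivable1_diffP; have [] := du x.
Qed.

(** Three sliding averages make [f] three times differentiable, with bounded
    derivatives given by difference quotients, and each moves it by at most
    [e]. The remainder of the quadratic expansion is controlled by the third
    derivative for small increments and by the second one for large ones. *)
Lemma ex_quad_approx (M K c e r : R) (f : R -> R) : 0 < r ->
  test_fun M K c e r f ->
  exists g g1 g2 C, [/\ quad_approx C g g1 g2, continuous g &
    forall x, `|g x - f x| <= 3 * e].
Proof.
move=> r0 tf.
have [f1 sf1 [tf1 ff1]] := ex_sliding r0 tf.
have [f2 sf2 [tf2 ff2]] := ex_sliding r0 tf1.
have [g sg [tg fg]] := ex_sliding r0 tf2.
have dg : forall x : R, is_derive x 1 g (diff_quot r f2 x) := is_derive_sliding sg.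
have dg1 : forall x : R, is_derive x 1 (diff_quot r f2) (diff_quot r (diff_quot r f1) x).
  by apply: is_derive_diff_quot; exact: is_derive_sliding sf2.
have dg2 : forall x : R, is_derive x 1 (diff_quot r (diff_quot r f1))
    (diff_quot r (diff_quot r (diff_quot r f)) x).
  by do 2 apply: is_derive_diff_quot; exact: is_derive_sliding sf1.
have b0 := test_bounded tg.
have b1 := diff_quot_bound r0 (test_bounded tf2).
have b2 := diff_quot_bound r0 (diff_quot_bound r0 (test_bounded tf1)).
have b3 := diff_quot_bound r0 (diff_quot_bound r0 (diff_quot_bound r0 (test_bounded tf))).
move: b1 b2 b3.
set B1 := 2 * M / r; set B2 := 2 * B1 / r; set B3 := 2 * B2 / r => b1 b2 b3.
have M0 : 0 <= M by exact: le_trans (b0 0).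
have B10 : 0 <= B1 by exact: le_trans (b1 0).
have B20 : 0 <= B2 by exact: le_trans (b2 0).
have B30 : 0 <= B3 by exact: le_trans (b3 0).
exists g, (diff_quot r f2), (diff_quot r (diff_quot r f1)), (M + B1 + 2 * B2 + B3).
split; last first.
- move=> x; have := fg x; have := ff2 x; have := ff1 x.
  have -> : g x - f x = (g x - f2 x) + (f2 x - f1 x) + (f1 x - f x) by ring.
  move=> h1 h2 h3; apply: le_trans (ler_normD _ _) _.
  have := ler_normD (g x - f2 x) (f2 x - f1 x); lra.
- exact: test_continuous tg.
split.
- exact: derive_measurable dg.
- exact: derive_measurable dg1.
- exact: derive_measurable dg2.
- by move=> y; have := b0 y; lra.
- by move=> y; have := b1 y; lra.
- by move=> y; have := b2 y; lra.
move=> y h.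
have shiftE (u : R -> R) : (fun t => u (y + t)) = fun t => u (t + y).
  by apply/funext => t; rewrite addrC.
have sh (u u' : R -> R) : (forall x : R, is_derive x 1 u (u' x)) ->
    forall t : R, is_derive t 1 (fun t => u (y + t)) (u' (y + t)).
  by move=> du t; rewrite shiftE addrC; exact: is_derive_translate.
have r1 := @taylor1_bound R (fun t => g (y + t)) (fun t => diff_quot r f2 (y + t)) _ h B2
  (fun t _ => sh _ _ dg t) (fun t _ => sh _ _ dg1 t) (fun t _ => b2 _).
have r2 := @taylor2_bound R (fun t => g (y + t)) (fun t => diff_quot r f2 (y + t)) _ _ h B3
  (sh _ _ dg) (sh _ _ dg1) (sh _ _ dg2) (fun t => b3 _).
rewrite !addr0 in r1 r2.
rewrite minEle; have [h1|h1] := leP 1 `|h|; last first.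
  have <- : `|h| ^+ 3 = h ^+ 2 * `|h| by rewrite exprSr real_normK ?num_real.
  rewrite mulrA; apply: le_trans r2 _.
  by rewrite ler_wpM2r ?exprn_ge0//; lra.
rewrite mulr1; set q := diff_quot r (diff_quot r f1) y.
apply: le_trans (ler_normB _ _) _.
have hq : `|q * (h ^+ 2 / 2)| <= B2 * h ^+ 2.
  rewrite normrM; apply: ler_pM => //; first exact: b2.
  by rewrite ger0_norm ?divr_ge0 ?sqr_ge0//; have := sqr_ge0 h; lra.
have := sqr_ge0 h; set h2 := h ^+ 2 => h20.
apply: (@le_trans _ _ (2 * B2 * h2)); first by rewrite /h2; lra.
by rewrite ler_wpM2r//; lra.
Qed.

End quadratic_approximation.

(** * Replacement of one summand *)

Section lindeberg.
Context {R : realType}.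

Lemma measurable_mean_param {d1 d2 : measure_display} {U : measurableType d1}
    {V : measurableType d2} (P : probability V R) (F : U * V -> R) (M : R) :
  measurable_fun setT F -> (forall z, `|F z| <= M) ->
  measurable_fun setT (fun u => mean P (fun v => F (u, v))).
Proof.
move=> mF FM.
have mFu u : measurable_fun setT (fun v => F (u, v)).
  by apply: (measurableT_comp mF); exact: measurable_pair1.
have F1 u : L1 P (fun v => F (u, v)) by apply: (@L1_bounded _ _ _ _ _ M).
have -> : (fun u => mean P (fun v => F (u, v))) =
    fun u => fine (\int[P]_v (F (u, v) + M)%:E)%E - M.
  apply/funext => u; rewrite -[fine _]/(mean P _) meanD//; last exact: L1_cst.
  by rewrite mean_cst addrK.
apply: measurable_funB => //; apply: measurableT_comp => //.
have := @measurable_fun_fubini_tonelli_F _ _ U V R P (fun z => (F z + M)%:E).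
apply; first by apply/measurable_EFinP; exact: measurable_funD.
by move=> z; rewrite lee_fin; have := FM z; rewrite ler_norml => /andP[]; lra.
Qed.

Context {d : measure_display} {T : measurableType d} (P : probability T R).
Variable X : T -> R.
Hypothesis mX : measurable_fun setT X.

Let shift_meas (g : R -> R) y : measurable_fun setT g ->
  measurable_fun setT (fun t => g (y + X t)).
Proof. by move=> mg; apply: (measurableT_comp mg); exact: measurable_funD. Qed.

Let shift_meas2 (g : R -> R) : measurable_fun setT g ->
  measurable_fun setT (fun z : R * T => g (z.1 + X z.2)).
Proof.
move=> mg; apply: (measurableT_comp mg); apply: measurable_funD => //.
exact: measurableT_comp.
Qed.

(** The class of test functions is stable under convolution with a law, with
    the same constant. This is what the replacement argument iterates. *)
Lemma quad_approx_mean C (g g1 g2 : R -> R) : quad_approx C g g1 g2 ->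
  quad_approx C (fun y => mean P (fun t => g (y + X t)))
    (fun y => mean P (fun t => g1 (y + X t)))
    (fun y => mean P (fun t => g2 (y + X t))).
Proof.
case=> mg mg1 mg2 bg bg1 bg2 rem.
have i0 (u : R -> R) y : measurable_fun setT u -> (forall y, `|u y| <= C) ->
    L1 P (fun t => u (y + X t)).
  by move=> mu uC; apply: (@L1_bounded _ _ _ _ _ C) => //; exact: shift_meas.
have b0 (u : R -> R) y : measurable_fun setT u -> (forall y, `|u y| <= C) ->
    `|mean P (fun t => u (y + X t))| <= C.
  move=> mu uC; rewrite -[leRHS](mean_cst P C).
  by apply: norm_mean_le => //; [exact: i0|exact: L1_cst].
split.
- exact: (measurable_mean_param P (shift_meas2 mg) (fun z => bg _)).
- exact: (measurable_mean_param P (shift_meas2 mg1) (fun z => bg1 _)).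
- exact: (measurable_mean_param P (shift_meas2 mg2) (fun z => bg2 _)).
- by move=> y; exact: b0.
- by move=> y; exact: b0.
- by move=> y; exact: b0.
move=> y h.
rewrite -[leRHS](mean_cst P).
have -> : mean P (fun t => g (y + h + X t)) - mean P (fun t => g (y + X t)) -
    mean P (fun t => g1 (y + X t)) * h - mean P (fun t => g2 (y + X t)) * (h ^+ 2 / 2) =
   mean P (fun t => g (y + X t + h) - g (y + X t) - h * g1 (y + X t) -
     (h ^+ 2 / 2) * g2 (y + X t)).
  rewrite !meanB ?meanZ//; try exact: i0; try by apply: L1Z; exact: i0.
  - rewrite [h * _]mulrC [h ^+ 2 / 2 * _]mulrC; congr (mean P _ - _ - _ - _).
    by apply/funext => t; rewrite addrAC.
  - have -> : (fun t => g (y + X t + h)) = fun t => g ((y + h) + X t).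
      by apply/funext => t; rewrite addrAC.
    exact: i0.
  - apply: L1B; last exact: i0.
    have -> : (fun t => g (y + X t + h)) = fun t => g ((y + h) + X t).
      by apply/funext => t; rewrite addrAC.
    exact: i0.
  - apply: L1B; last by apply: L1Z; exact: i0.
    apply: L1B; last exact: i0.
    have -> : (fun t => g (y + X t + h)) = fun t => g ((y + h) + X t).
      by apply/funext => t; rewrite addrAC.
    exact: i0.
apply: norm_mean_le.
- apply: L1B; last by apply: L1Z; exact: i0.
  apply: L1B; last by apply: L1Z; exact: i0.
  apply: L1B; last exact: i0.
  have -> : (fun t => g (y + X t + h)) = fun t => g ((y + h) + X t).
    by apply/funext => t; rewrite addrAC.
  exact: i0.
- exact: L1_cst.
- by move=> t; rewrite [h * _]mulrC [h ^+ 2 / 2 * _]mulrC; exact: rem.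
Qed.

(** The Lindeberg remainder of a summand [a * X], divided by [a ^+ 2]. *)
Definition truncated_moment (a : R) : R :=
  mean P (fun t => X t ^+ 2 * Num.min 1 (a * `|X t|)).

Let trunc_le a t : 0 <= a ->
  `|X t ^+ 2 * Num.min 1 (a * `|X t|)| <= X t ^+ 2.
Proof.
move=> a0; have m0 : 0 <= Num.min 1 (a * `|X t|).
  by rewrite le_min ler01 mulr_ge0.
rewrite [leLHS]ger0_norm; last by apply: mulr_ge0 => //; exact: sqr_ge0.
by apply: ler_piMr; [exact: sqr_ge0|rewrite ge_min lexx].
Qed.

Let trunc_meas a : measurable_fun setT (fun t => X t ^+ 2 * Num.min 1 (a * `|X t|)).
Proof.
apply: measurable_funM; first exact: measurable_funX.
apply: measurable_minr => //; apply: measurable_funM => //.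
exact: measurableT_comp.
Qed.

Lemma truncated_moment_cvg0 (a : nat -> R) : L2 P X -> (forall n, 0 <= a n) ->
  a @ \oo --> 0 -> truncated_moment (a n) @[n --> \oo] --> 0.
Proof.
move=> [_ X2] a0 ca; rewrite -[X in _ --> X](mean_cst P 0).
apply: (@dominated_mean _ _ _ P _ _ (fun t => X t ^+ 2)) => //.
- move=> t; rewrite -(mulr0 (X t ^+ 2)); apply: cvgMr.
  apply/cvgr0Pnorm_le => e e0.
  have e1 : 0 < e / (`|X t| + 1) by rewrite divr_gt0// ltr_wpDl.
  move/cvgr0Pnorm_le : ca => /(_ _ e1); apply: filterS => n.
  rewrite (ger0_norm (a0 n)) => an.
  rewrite [leLHS]ger0_norm; last by rewrite le_min ler01 mulr_ge0.
  rewrite ge_min; apply/orP; right.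
  apply: (@le_trans _ _ (e / (`|X t| + 1) * `|X t|)); first by rewrite ler_wpM2r.
  rewrite -mulrA ler_piMr ?(ltW e0)// mulrC ler_pdivrMr ?ltr_wpDl// mul1r.
  by rewrite lerDl.
- by move=> n t; exact: trunc_le.
Qed.

(** Up to the truncated moment, the mean of [g (y + a X)] depends on the law of
    [X] only through its first two moments: the linear term of the expansion
    vanishes since [X] is centered. *)
Lemma lindeberg_step C (g g1 g2 : R -> R) (a s2 y : R) : quad_approx C g g1 g2 ->
  0 <= a -> L2 P X -> mean P X = 0 -> mean P (fun t => X t ^+ 2) = s2 ->
  `|mean P (fun t => g (y + a * X t)) - (g y + g2 y * (a ^+ 2 * s2 / 2))| <=
     C * a ^+ 2 * truncated_moment a.
Proof.
case=> mg mg1 mg2 bg bg1 bg2 rem a0 X2 X0 Xs.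
have X1 := L2_L1 X2; have [_ XX] := X2.
have i0 : L1 P (fun t => g (y + a * X t)).
  apply: (@L1_bounded _ _ _ _ _ C) => //; apply: (measurableT_comp mg).
  by apply: measurable_funD => //; exact: measurable_funM.
have T1 : L1 P (fun t => X t ^+ 2 * Num.min 1 (a * `|X t|)).
  apply: L1_le XX; [exact: trunc_meas|by move=> t; exact: trunc_le].
rewrite /truncated_moment -meanZ//.
pose rm t := g (y + a * X t) - g y - (g1 y * a) * X t - (g2 y * a ^+ 2 / 2) * X t ^+ 2.
have rm1 : L1 P rm.
  apply: L1B; last exact: L1Z.
  by apply: L1B; [apply: L1B => //; exact: L1_cst|exact: L1Z].
have -> : mean P (fun t => g (y + a * X t)) - (g y + g2 y * (a ^+ 2 * s2 / 2)) = mean P rm.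
  rewrite /rm meanB; [|by apply: L1B; [apply: L1B => //; exact: L1_cst|exact: L1Z]|exact: L1Z].
  rewrite meanB; [|by apply: L1B => //; exact: L1_cst|exact: L1Z].
  rewrite meanB//; last exact: L1_cst.
  by rewrite mean_cst !meanZ// X0 Xs; ring.
apply: norm_mean_le => //; first exact: L1Z.
move=> t; have := rem y (a * X t); rewrite normrM (ger0_norm a0) /rm.
have -> : g (y + a * X t) - g y - g1 y * a * X t - g2 y * a ^+ 2 / 2 * X t ^+ 2 =
  g (y + a * X t) - g y - g1 y * (a * X t) - g2 y * ((a * X t) ^+ 2 / 2) by ring.
by move=> h; apply: le_trans h _; rewrite exprMn !mulrA.
Qed.

End lindeberg.

(** * Replacement of all summands by Gaussian ones *)

Section gaussian_convolution.
Context {R : realType}.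

(** The bounded case, by adding the bound; [c = 0] is allowed because it occurs
    when the last summand is replaced. *)
Lemma gauss_convolution (f : R -> R) (M b c r y : R) : 0 <= b -> 0 <= c -> 0 <= r ->
  b ^+ 2 + c ^+ 2 = r ^+ 2 -> continuous f -> (forall x, `|f x| <= M) ->
  mean gauss (fun x => mean gauss (fun z => f (y + b * x + c * z))) =
  mean gauss (fun u => f (y + r * u)).
Proof.
move=> b0 c0 r0 bcr cf fM.
move: c0; rewrite le_eqVlt => /predU1P[c0|c0].
  have -> : r = b.
    apply/eqP; rewrite -(eqrXn2 (n := 2))//; by rewrite -bcr -c0 expr0n addr0.
  congr mean; apply/funext => x; rewrite -[RHS](mean_cst gauss).
  by congr mean; apply/funext => z; rewrite -c0 mul0r addr0.
have rgt0 : 0 < r.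
  rewrite lt_neqAle r0 andbT; apply/negP => /eqP r00.
  have := sqr_ge0 b; have : 0 < c ^+ 2 by rewrite exprn_gt0.
  by move: bcr; rewrite -r00 expr0n /= => ? ? ?; lra.
have mf : measurable_fun setT f by exact: continuous_measurable_fun.
pose h x := f x + M.
have ch : continuous h by move=> x; apply: cvgD; [exact: cf|exact: cvg_cst].
have h0 x : 0 <= h x by have := fM x; rewrite ler_norml /h => /andP[]; lra.
have maff (s t : R) : measurable_fun setT (fun u : R => f (t + s * u)).
  apply: (measurableT_comp mf).
  by apply: measurable_funD => //; exact: measurable_funM.
have f1 (s t : R) : L1 gauss (fun u : R => f (t + s * u)).
  by apply: (@L1_bounded _ _ _ _ _ M) => //; exact: maff.
have bM (s t : R) : `|mean gauss (fun u : R => f (t + s * u))| <= M.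
  rewrite -[leRHS](mean_cst gauss M).
  by apply: norm_mean_le => //; exact: L1_cst.
have mi : measurable_fun setT (fun x : R => mean gauss (fun z => f (y + b * x + c * z))).
  apply: (@measurable_mean_param R _ _ _ _ gauss (fun w => f (y + b * w.1 + c * w.2)) M) => //.
  apply: (measurableT_comp mf).
  by apply: measurable_funD; [apply: measurable_funD => //|]; exact: measurable_funM.
have i1 : L1 gauss (fun x : R => mean gauss (fun z => f (y + b * x + c * z))).
  by apply: (@L1_bounded _ _ _ _ _ M) => // x; exact: bM.
have := gauss_convolution_ge0 y c0 rgt0 bcr ch h0.
have inner x : (\int[gauss]_z (h (y + b * x + c * z))%:E =
    (mean gauss (fun z => f (y + b * x + c * z)) + M)%:E)%E.
  rewrite -(mean_cst gauss M) -meanD ?mean_cst//; last exact: L1_cst.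
  by rewrite meanE//; apply: L1D => //; exact: L1_cst.
under eq_integral do rewrite inner.
rewrite (meanE (L1D i1 (L1_cst _ M))) (meanE (L1D (f1 r y) (L1_cst _ M))).
move=> [].
rewrite !meanD ?mean_cst//; try exact: L1_cst.
by move/addIr.
Qed.

End gaussian_convolution.

Section lindeberg_clt.
Context {R : realType} {d0 d dU : measure_display} {T0 : measurableType d0}
  {T : measurableType d} {U : measurableType dU}.
Variables (Q : probability T0 R) (Z0 : T0 -> U).
Variables (P : probability T R) (Z : nat -> T -> U).
Hypotheses (mZ0 : measurable_fun setT Z0) (iidZ : iid_copies Q Z0 P Z).
Variables (phi : U -> R) (s : R).
Hypotheses (mphi : measurable_fun setT phi) (phi2 : L2 Q (phi \o Z0))
  (phi0 : mean Q (phi \o Z0) = 0) (s0 : 0 <= s)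
  (phis : mean Q (fun t => phi (Z0 t) ^+ 2) = s ^+ 2).
Variables (C : R) (g g1 g2 : R -> R).
Hypotheses (gq : quad_approx C g g1 g2) (cg : continuous g).

Local Notation psum := (psum Z phi).

Let C0 : 0 <= C.
Proof. exact: le_trans (quad_bounded gq 0). Qed.

(** The mean of [g] at [y] plus [j] independent centered normal summands of
    standard deviation [a * s], written with a single normal variable. *)
Let smooth (a : R) (j : nat) (y : R) : R :=
  mean gauss (fun x : R => g (y + (a * s * Num.sqrt j%:R) * x)).

Let smoothq a j : exists g1' g2', quad_approx C (smooth a j) g1' g2'.
Proof.
have mX : measurable_fun setT (fun x : R => a * s * Num.sqrt j%:R * x).
  exact: measurable_funM.
eexists; eexists.
exact: (@quad_approx_mean R _ (measurableTypeR R) gauss _ mX _ _ _ _ gq).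
Qed.

Let smoothS a j y : 0 <= a ->
  smooth a j.+1 y = mean gauss (fun x : R => smooth a j (y + a * (s * x))).
Proof.
move=> a0; rewrite /smooth.
have as0 : 0 <= a * s by rewrite mulr_ge0.
have sq : (a * s) ^+ 2 + (a * s * Num.sqrt j%:R) ^+ 2 = (a * s * Num.sqrt j.+1%:R) ^+ 2 :> R.
  by rewrite !exprMn !sqr_sqrtr// -[in RHS]natr1; ring.
transitivity (mean gauss (fun x : R => mean gauss (fun z : R =>
    g (y + a * s * x + a * s * Num.sqrt j%:R * z)))).
  apply: esym; apply: (gauss_convolution y as0 _ _ sq cg (quad_bounded gq));
    by rewrite mulr_ge0.
by under eq_fun do rewrite -mulrA.
Qed.

Let gauss_scaled : [/\ L2 gauss (fun x : R => s * x), mean gauss (fun x : R => s * x) = 0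
  & mean gauss (fun x : R => (s * x) ^+ 2) = s ^+ 2].
Proof.
split.
- exact: L2Z L2_gauss.
- by rewrite meanZ ?mean_gauss ?mulr0//; exact: L2_L1 L2_gauss.
- under [X in mean _ X]eq_fun do rewrite exprMn.
  by rewrite meanZ ?mean_gauss_sqr ?mulr1//; case: (@L2_gauss R).
Qed.

Definition lindeberg_error (a : R) : R :=
  truncated_moment Q (phi \o Z0) a + truncated_moment gauss (fun x : R => s * x) a.

(** The first [k] summands are those of the sample and the other [n - k] are
    normal; [k = 0] and [k = n] are the two quantities to compare. *)
Let hybrid a n k := mean P (fun t => smooth a (n - k) (a * psum k t)).

Let iid_sqr k : mean P (fun t => phi (Z k t) ^+ 2) = s ^+ 2.
Proof.
rewrite -phis; apply: (iid_mean mZ0 iidZ k (f := fun u => phi u ^+ 2)).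
exact: measurable_funX.
Qed.

(** Two neighbouring hybrids differ in one summand, which is independent of the
    others. Both are compared with the same quadratic expansion of the smoothed
    test function, whose coefficients see only two matching moments. *)
Let hybrid_step a n k : 0 <= a -> (k < n)%N ->
  `|hybrid a n k.+1 - hybrid a n k| <= C * a ^+ 2 * lindeberg_error a.
Proof.
move=> a0 kn; rewrite /hybrid -(subnSK kn); set j := (n - k.+1)%N.
have [h1 [h2 hq]] := smoothq a j.
have [h1' [h2' hq']] := smoothq a j.+1.
have mZk : measurable_fun setT (phi \o Z k).
  by apply: measurableT_comp => //; exact: (iid_measurable iidZ).
have mps : measurable_fun setT (psum k) by exact: (measurable_psum iidZ mphi).
pose A t := mean P (fun u => smooth a j (a * psum k t + a * phi (Z k u))).
pose B t := smooth a j.+1 (a * psum k t).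
have mF2 : measurable_fun setT (fun z : R * T => smooth a j (a * z.1 + a * phi (Z k z.2))).
  apply: (measurableT_comp (quad_meas hq)); apply: measurable_funD.
    exact: measurable_funM.
  by apply: measurable_funM => //; exact: (measurableT_comp mZk).
have mA : measurable_fun setT A.
  have := measurable_mean_param P mF2 (fun z => quad_bounded hq _).
  by move=> h; exact: (measurableT_comp h mps).
have mB : measurable_fun setT B.
  by apply: (measurableT_comp (quad_meas hq')); exact: measurable_funM.
have bA t : `|A t| <= C.
  rewrite -[leRHS](mean_cst P C); apply: norm_mean_le.
  - apply: (@L1_bounded _ _ _ _ _ C); last by move=> x; exact: quad_bounded hq _.
    apply: (measurableT_comp (quad_meas hq)); apply: measurable_funD => //.
    exact: measurable_funM.
  - exact: L1_cst.
  - by move=> x; exact: quad_bounded hq _.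
have A1 : L1 P A by apply: (@L1_bounded _ _ _ _ _ C).
have B1 : L1 P B by apply: (@L1_bounded _ _ _ _ _ C) => // t; exact: quad_bounded hq' _.
have -> : mean P (fun t => smooth a j (a * psum k.+1 t)) = mean P A.
  have := @indep_mean R _ _ _ T R U P (psum k) (Z k) mps (iid_measurable iidZ k)
    (psum_indep iidZ mphi k) (fun z => smooth a j (a * (z.1 + phi z.2))).
  move=> h; transitivity (mean P (fun t => smooth a j (a * (psum k t + phi (Z k t))))).
    by congr mean; apply/funext => t; rewrite /psum big_ord_recr.
  rewrite h /=.
  - congr mean; apply/funext => t; rewrite /A; congr mean; apply/funext => u.
    by rewrite mulrDr.
  - apply: (measurableT_comp (quad_meas hq)); apply: measurable_funM => //.
    by apply: measurable_funD => //; exact: measurableT_comp.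
  - apply: (@L1_bounded _ _ _ _ _ C); last by move=> x; exact: quad_bounded hq _.
    apply: (measurableT_comp (quad_meas hq)); apply: measurable_funM => //.
    exact: measurable_funD.
rewrite -[mean P (fun t => smooth a j.+1 _)]/(mean P B) -meanB//.
rewrite -[leRHS](mean_cst P); apply: norm_mean_le; [exact: L1B|exact: L1_cst|].
move=> t; rewrite /A /B smoothS//; set y := a * psum k t.
have st1 := @lindeberg_step R _ T P (phi \o Z k) mZk C _ _ _ a (s ^+ 2) y hq a0
  (iid_L2 mZ0 iidZ k mphi phi2) (etrans (iid_mean mZ0 iidZ k mphi) phi0) (iid_sqr k).
have [gs1 gs2 gs3] := gauss_scaled.
have mX : measurable_fun setT (fun x : R => s * x) by exact: measurable_funM.
have st2 := @lindeberg_step R _ (measurableTypeR R) gauss (fun x : R => s * x) mX C _ _ _ a (s ^+ 2) y hq a0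
  gs1 gs2 gs3.
have tmE : truncated_moment P (phi \o Z k) a = truncated_moment Q (phi \o Z0) a.
  have := iid_mean mZ0 iidZ k (f := fun u => phi u ^+ 2 * Num.min 1 (a * `|phi u|)).
  apply; apply: measurable_funM; first exact: measurable_funX.
  apply: measurable_minr => //; apply: measurable_funM => //.
  exact: measurableT_comp.
rewrite tmE in st1; rewrite /lindeberg_error mulrDr.
move: st1 st2; set q := _ + h2 y * _ => st1 st2.
apply: le_trans (lerD st1 st2).
apply: le_trans (ler_distD q _ _) _.
by rewrite lerD2l distrC.
Qed.

Lemma lindeberg_bound n : (0 < n)%N ->
  `|mean P (fun t => g ((Num.sqrt n%:R)^-1 * psum n t)) -
    mean gauss (fun x : R => g (s * x))| <=
  C * lindeberg_error (Num.sqrt n%:R)^-1.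
Proof.
move=> n0; set a := (Num.sqrt n%:R)^-1.
have nR : 0 < (n%:R : R) by rewrite ltr0n.
have a0 : 0 <= a by rewrite invr_ge0.
have an : a * Num.sqrt n%:R = 1 by rewrite mulVf// gt_eqF// sqrtr_gt0.
have na : n%:R * a ^+ 2 = 1.
  by rewrite /a exprVn sqr_sqrtr// mulfV// gt_eqF.
have Hn : hybrid a n n = mean P (fun t => g (a * psum n t)).
  congr mean; apply/funext => t; rewrite /smooth subnn sqrtr0 mulr0.
  by rewrite -[RHS](mean_cst gauss); congr mean; apply/funext => x; rewrite mul0r addr0.
have H0 : hybrid a n 0 = mean gauss (fun x : R => g (s * x)).
  rewrite /hybrid -[RHS](mean_cst P); congr mean; apply/funext => t.
  rewrite /smooth subn0; congr mean; apply/funext => x.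
  have -> : a * s * Num.sqrt n%:R * x = (a * Num.sqrt n%:R) * (s * x) by ring.
  by rewrite /psum big_ord0 mulr0 add0r an mul1r.
rewrite -Hn -H0 -(telescope_sumr _ (leq0n n)).
apply: le_trans (ler_norm_sum _ _ _) _.
rewrite big_mkord.
apply: (@le_trans _ _ (\sum_(k < n) C * a ^+ 2 * lindeberg_error a)).
  by apply: ler_sum => k _; exact: hybrid_step.
rewrite sumr_const card_ord -[X in X <= _]mulr_natl.
have -> : n%:R * (C * a ^+ 2 * lindeberg_error a) =
   n%:R * a ^+ 2 * (C * lindeberg_error a) by ring.
by rewrite na mul1r.
Qed.

Lemma lindeberg_error_cvg0 :
  lindeberg_error (Num.sqrt n%:R)^-1 @[n --> \oo] --> (0 : R).
Proof.
rewrite -[X in _ --> X]addr0; apply: cvgD; apply: truncated_moment_cvg0 => //.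
- exact: measurableT_comp.
- exact: sqrt_inv_cvg0.
- exact: measurable_funM.
- by case: gauss_scaled.
- exact: sqrt_inv_cvg0.
Qed.

Lemma clt_quad_approx :
  mean P (fun t => g ((Num.sqrt n%:R)^-1 * psum n t)) @[n --> \oo] -->
  mean gauss (fun x : R => g (s * x)).
Proof.
apply/cvgrPdistC_le => e e0.
have e1 : 0 < e / (C + 1) by rewrite divr_gt0// ltr_wpDl.
have /cvgr0Pnorm_le/(_ _ e1) := lindeberg_error_cvg0.
move=> err; near=> n.
apply: le_trans (lindeberg_bound _) _; first by near: n; exists 1%N.
have : `|lindeberg_error (Num.sqrt n%:R)^-1| <= e / (C + 1) by near: n.
rewrite ler_norml => /andP[_ h].
apply: le_trans (ler_wpM2l C0 h) _.
rewrite mulrCA ler_piMr ?(ltW e0)// ler_pdivrMr ?mul1r ?lerDl// ltr_wpDl//.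
Unshelve. all: by end_near. Qed.

End lindeberg_clt.

(** * The central limit theorem *)

Section convergence_in_law.
Context {R : realType}.

Lemma mean_close {d : measure_display} {T : measurableType d} (P : probability T R)
    (u v : T -> R) (A : set T) (M e e' : R) :
  measurable_fun setT u -> measurable_fun setT v -> measurable A ->
  (forall t, `|u t| <= M) -> (forall t, `|v t| <= M) -> 0 <= e ->
  (forall t, ~ A t -> `|u t - v t| <= e) -> (P A <= e'%:E)%E ->
  `|mean P u - mean P v| <= e + 2 * M * e'.
Proof.
move=> mu mv mA uM vM e0 uv PA.
have u1 : L1 P u by apply: (@L1_bounded _ _ _ _ _ M).
have v1 : L1 P v by apply: (@L1_bounded _ _ _ _ _ M).
have i1 : L1 P (\1_A : T -> R) by exact: integrable_indic.
rewrite -meanB//.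
apply: (@le_trans _ _ (mean P (fun t => e + 2 * M * \1_A t))).
  apply: norm_mean_le; [exact: L1B|by apply: L1D; [exact: L1_cst|exact: L1Z]|].
  move=> t; have [tA|tA] := pselect (A t).
    rewrite indicE mem_set// mulr1; apply: le_trans (ler_normB _ _) _.
    by have := uM t; have := vM t; lra.
  by rewrite indicE memNset// mulr0 addr0; exact: uv.
rewrite meanD; [|exact: L1_cst|exact: L1Z].
rewrite mean_cst meanZ// lerD2l.
have M0 : 0 <= M.
  have [t _] : exists t : T, True.
    apply: contrapT => h.
    have : P setT = 0%E.
      by rewrite (_ : setT = set0) ?measure0//; apply/seteqP; split => // t _; apply: h; exists t.
    by rewrite probability_setT => /eqP; rewrite onee_eq0.
  exact: le_trans (uM t).
by apply: ler_wpM2l; [lra|rewrite -lee_fin mean_indic].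
Qed.

(** By compactness of the segment, since clamping does not increase distances. *)
Lemma clamp_uniform (f : R -> R) (K e : R) : 0 < K -> 0 < e -> continuous f ->
  exists2 r, 0 < r & forall x z, `|x - z| <= r ->
    `|f (Num.max (- K) (Num.min K x)) - f (Num.max (- K) (Num.min K z))| <= e.
Proof.
move=> K0 e0 cf; pose cl x : R := Num.max (- K) (Num.min K x).
have clK x : cl x \in `[- K, K].
  rewrite in_itv/= /cl le_max lexx/= ge_max ge_min lexx/= andbT; lra.
have max_lip (a x z : R) : `|Num.max a x - Num.max a z| <= `|x - z|.
  have h1 := ler_norm (x - z); have := ler_norm (z - x); rewrite distrC => h2.
  rewrite ler_norml; have [ax|ax] := leP a x; have [az|az] := leP a z;
    apply/andP; split; lra.
have min_lip (a x z : R) : `|Num.min a x - Num.min a z| <= `|x - z|.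
  have h1 := ler_norm (x - z); have := ler_norm (z - x); rewrite distrC => h2.
  rewrite ler_norml; have [ax|ax] := leP a x; have [az|az] := leP a z;
    apply/andP; split; lra.
have cl_lip x z : `|cl x - cl z| <= `|x - z|.
  exact: le_trans (max_lip _ _ _) (min_lip _ _ _).
have nc := (compact_near_coveringP _).1 (@segment_compact R (- K) K).
pose close (r x : R) := forall z, `|x - z| <= r -> `|f x - f z| <= e.
have hr : \forall r \near (0 : R)^'+, `[- K, K] `<=` close r.
  apply: nc.
  move=> x _; have e20 : 0 < e / 2 by lra.
  have /cvgrPdist_lt/(_ _ e20) := cf x.
  move=> /nbhs_ballP[r /= r0 hr].
  exists (ball x (r / 2), [set s | s < r / 2]).
    split => /=; first by apply: nbhsx_ballx; lra.
    by apply: nbhs_right_lt; lra.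
  move=> [x' s] /= [xx' sr] z x'z.
  have h1 : `|f x - f x'| < e / 2 by apply: hr; move: xx'; rewrite /ball/=; lra.
  have h2 : `|f x - f z| < e / 2.
    apply: hr; rewrite /ball/=; have := ler_distD x' x z.
    by move: xx'; rewrite /ball/=; lra.
  by have := ler_distD (f x) (f x') (f z); rewrite (distrC (f x') (f x)); lra.
have [s [/= s0 hs]] := filter_ex (filterI (nbhs_right_gt (0 : R)) hr).
exists s => // x z xz; apply: hs; first exact: clK.
exact: le_trans (cl_lip x z) xz.
Qed.

Context {d : measure_display} {T : measurableType d} (P : probability T R).

(** Portmanteau with Slutsky: a tight sequence whose smooth averages converge
    to those of [N(0, s^2)] converges in law, and so does every sequence at
    vanishing distance from it. *)
Lemma cvg_in_law_of_smooth (S S' : nat -> T -> R) (s : R) :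
  tightP P S -> cvpr P (fun n t => S' n t - S n t) 0 ->
  (forall n, measurable_fun setT (S' n)) ->
  (forall C g g1 g2, quad_approx C g g1 g2 -> continuous g ->
    mean P (fun t => g (S n t)) @[n --> \oo] --> mean gauss (fun x : R => g (s * x))) ->
  forall f : R -> R, continuous f -> (exists M, forall x, `|f x| <= M) ->
    mean P (fun t => f (S' n t)) @[n --> \oo] --> mean gauss (fun x : R => f (s * x)).
Proof.
move=> tS dS mS' clt f cf [M fM].
have mS n : measurable_fun setT (S n) by case: tS.
have mf : measurable_fun setT f by exact: continuous_measurable_fun.
have M0 : 0 <= M by exact: le_trans (fM 0).
have tS' : tightP P S' by exact: tightP_add tS dS.
have msx : measurable_fun setT (fun x : R => s * x) by exact: measurable_funM.
have tG : tightP gauss (fun (_ : nat) (x : R) => s * x).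
  split=> // e e0; pose v := mean gauss (fun x : R => (s * x) ^+ 2).
  have gs : L2 gauss (fun x : R => s * x) by exact: L2Z L2_gauss.
  have v0 : 0 <= v by apply: mean_ge0 => x; exact: sqr_ge0.
  have K0 : 0 < (v + 1) / e + 1 by rewrite ltr_wpDl// divr_ge0 ?ltW//; lra.
  exists ((v + 1) / e + 1) => //; apply: nearW => n.
  apply: (le_trans (chebyshev2 gs K0)); rewrite lee_fin ler_pdivrMr ?exprn_gt0// -/v.
  have h : v + 1 <= e * ((v + 1) / e + 1).
    by rewrite mulrDr mulr1 mulrC divfK ?gt_eqF//; lra.
  have h1 : 1 <= (v + 1) / e + 1 by rewrite lerDr divr_ge0 ?ltW//; lra.
  have h2 : e * ((v + 1) / e + 1) <= e * ((v + 1) / e + 1) ^+ 2.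
    by rewrite ler_pM2l// expr2 ler_peMr// ltW.
  by apply: le_trans h2; lra.
apply/cvgrPdistC_le => e e0.
(* the six comparisons b1 to b6 below add up to (8 + 6 M) e1 *)
pose e1 := e / (8 + 6 * M).
have D0 : 0 < 8 + 6 * M by lra.
have e10 : 0 < e1 by rewrite divr_gt0.
have [K1 K10 hK1] := tS'.2 _ e10.
have [K2 K20 hK2] := tG.2 _ e10.
have {hK2} hK2 : (gauss [set x | (K2 <= `|s * x|)%R] <= e1%:E)%E.
  by case: hK2 => n _ /(_ n (leqnn n)).
pose K := Num.max K1 K2.
have K0 : 0 < K by rewrite lt_max K10.
pose cl (x : R) := Num.max (- K) (Num.min K x).
pose fK x := f (cl x).
have clE x : `|x| < K -> cl x = x.
  rewrite ltr_norml => /andP[h1 h2]; rewrite /cl min_r ?ltW//.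
  by rewrite max_r// ltW.
have [r r0 hr] := clamp_uniform K0 e10 cf.
have cfK : continuous fK.
  move=> x; apply/cvgrPdist_le => e' e'0.
  have [r' r'0 hr'] := clamp_uniform K0 e'0 cf.
  near=> z; apply: hr'; rewrite ltW//; near: z; exact: cvgr_dist_lt.
have tf : test_fun M (- K) (f (- K)) e1 r fK.
  split => //.
  - by move=> x; exact: fM.
  - move=> x xK; rewrite /fK /cl min_r ?max_l//; lra.
have [g [g1 [g2 [C [gq cg gf]]]]] := ex_quad_approx r0 tf.
have mfK : measurable_fun setT fK by exact: continuous_measurable_fun.
have mg := quad_meas gq.
have limg := clt _ _ _ _ gq cg.
have /cvgrPdistC_le/(_ _ e10) near_g := limg.
have gM x : `|g x| <= M + 3 * e1.
  have := ler_normD (g x - fK x) (fK x); rewrite subrK.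
  have := gf x; have := fM (cl x); rewrite -/(fK x); lra.
near=> n.
(* clamp to [-K, K], pass from S' to S, smooth, take the limit, and go back
   under the normal law *)
have b1 : `|mean P (fun t => f (S' n t)) - mean P (fun t => fK (S' n t))| <= 0 + 2 * M * e1.
  apply: (@mean_close _ _ _ _ _ [set t | K1 <= `|S' n t|]) => //.
  - exact: (measurableT_comp mf).
  - exact: (measurableT_comp mfK).
  - exact: measurable_norm_ge.
  - by move=> t; exact: fM.
  - move=> t /= /negP; rewrite -ltNge => h.
    by rewrite /fK clE ?subrr ?normr0// lt_max h.
  - by near: n.
have b2 : `|mean P (fun t => fK (S' n t)) - mean P (fun t => fK (S n t))| <= e1 + 2 * M * e1.
  apply: (@mean_close _ _ _ _ _ [set t | r <= `|S' n t - S n t - 0|]) => //.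
  - exact: (measurableT_comp mfK).
  - exact: (measurableT_comp mfK).
  - apply: measurable_norm_ge; apply: measurable_funB => //; exact: measurable_funB.
  - by move=> t; exact: fM.
  - by move=> t; exact: fM.
  - exact: ltW.
  - by move=> t /= /negP; rewrite -ltNge subr0 => h; apply: hr; exact: ltW.
  - by near: n; have [_ /(_ _ e10)] := dS.2 _ r0.
have b3 : `|mean P (fun t => fK (S n t)) - mean P (fun t => g (S n t))| <= 3 * e1 + 2 * (M + 3 * e1) * 0.
  apply: (@mean_close _ _ _ _ _ set0) => //.
  - exact: (measurableT_comp mfK).
  - exact: (measurableT_comp mg).
  - by move=> t; apply: le_trans (fM _) _; lra.
  - lra.
  - by move=> t _; rewrite distrC; exact: gf.
  - by rewrite measure0.
have b4 : `|mean P (fun t => g (S n t)) - mean gauss (fun x : R => g (s * x))| <= e1 by near: n.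
have b5 : `|mean gauss (fun x : R => g (s * x)) - mean gauss (fun x : R => fK (s * x))| <= 3 * e1 + 2 * (M + 3 * e1) * 0.
  apply: (@mean_close _ _ _ _ _ set0) => //.
  - exact: (measurableT_comp mg).
  - exact: (measurableT_comp mfK).
  - by move=> t; apply: le_trans (fM _) _; lra.
  - lra.
  - by rewrite (@measure0 _ _ _ gauss).
have b6 : `|mean gauss (fun x : R => fK (s * x)) - mean gauss (fun x : R => f (s * x))| <= 0 + 2 * M * e1.
  apply: (@mean_close _ (measurableTypeR R) gauss _ _ [set x : R | K2 <= `|s * x|]) => //.
  - exact: (measurableT_comp mfK).
  - exact: (measurableT_comp mf).
  - exact: measurable_norm_ge.
  - by move=> t; exact: fM.
  - move=> t /= /negP; rewrite -ltNge => h.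
    by rewrite /fK clE ?subrr ?normr0// lt_max h orbT.
have eE : e = (8 + 6 * M) * e1 by rewrite /e1 mulrC divfK// gt_eqF.
have := ler_distD (mean P (fun t => fK (S' n t))) (mean P (fun t => f (S' n t))) (mean gauss (fun x : R => f (s * x))).
have := ler_distD (mean P (fun t => fK (S n t))) (mean P (fun t => fK (S' n t))) (mean gauss (fun x : R => f (s * x))).
have := ler_distD (mean P (fun t => g (S n t))) (mean P (fun t => fK (S n t))) (mean gauss (fun x : R => f (s * x))).
have := ler_distD (mean gauss (fun x : R => g (s * x))) (mean P (fun t => g (S n t))) (mean gauss (fun x : R => f (s * x))).
have := ler_distD (mean gauss (fun x : R => fK (s * x))) (mean gauss (fun x : R => g (s * x))) (mean gauss (fun x : R => f (s * x))).
lra.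
Unshelve. all: by end_near. Qed.

End convergence_in_law.

Section central_limit_theorem.
Context {R : realType} {d0 d dU : measure_display} {T0 : measurableType d0}
  {T : measurableType d} {U : measurableType dU}.
Variables (Q : probability T0 R) (Z0 : T0 -> U).
Variables (P : probability T R) (Z : nat -> T -> U).
Hypotheses (mZ0 : measurable_fun setT Z0) (iidZ : iid_copies Q Z0 P Z).

Lemma mean_expectation {d' : measure_display} {T' : measurableType d'}
    (P' : probability T' R) (f : T' -> R) M :
  measurable_fun setT f -> (forall t, `|f t| <= M) -> ('E_P'[f] = (mean P' f)%:E)%E.
Proof.
by move=> mf fM; rewrite unlock -meanE//; apply: (@L1_bounded _ _ _ _ _ M).
Qed.

(** The replacement argument gives convergence for smooth test functions, and
    tightness of the empirical process extends it to bounded continuous ones.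
    The slack between [S] and the empirical process is what an asymptotically
    linear estimator needs. *)
Theorem clt (phi : U -> R) (S : nat -> T -> R) :
  measurable_fun setT phi -> L2 Q (phi \o Z0) ->
  (forall n, measurable_fun setT (S n)) ->
  cvpr P (fun n t => S n t - emp Q Z0 Z phi n t) 0 ->
  exists2 s : R, 0 <= s & cvg_to_normal P S s.
Proof.
move=> mphi phi2 mS dS.
pose psi u := phi u - mean Q (phi \o Z0).
have mpsi : measurable_fun setT psi by exact: measurable_funB.
have psi2 : L2 Q (psi \o Z0) by apply: L2B phi2 (L2_cst _ _).
have psi0 : mean Q (psi \o Z0) = 0.
  rewrite [LHS]meanB; [by rewrite mean_cst subrr|exact: L2_L1|exact: L1_cst].
pose s := Num.sqrt (mean Q (fun t => psi (Z0 t) ^+ 2)).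
have s0 : 0 <= s by exact: sqrtr_ge0.
have ss : mean Q (fun t => psi (Z0 t) ^+ 2) = s ^+ 2.
  by rewrite sqr_sqrtr//; apply: mean_ge0 => t; exact: sqr_ge0.
exists s => // f cf fb.
have := @cvg_in_law_of_smooth R _ T P (emp Q Z0 Z phi) S s (tight_emp mZ0 iidZ mphi phi2) dS mS _ f cf fb.
have [M fM] := fb.
have mf : measurable_fun setT f by exact: continuous_measurable_fun.
have eP n : ('E_P[fun t => f (S n t)] = (mean P (fun t => f (S n t)))%:E)%E.
  by apply: (@mean_expectation _ _ _ _ M) => //; exact: (measurableT_comp mf).
have msx : measurable_fun setT (fun x : R => s * x) by exact: measurable_funM.
have eN : ('E_(normal_prob 0 1)[fun x : R => f (s * x)%R] =
    (mean gauss (fun x : R => f (s * x)))%:E)%E.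
  apply: (@mean_expectation _ (measurableTypeR R) gauss _ M) => //.
  exact: (measurableT_comp mf).
rewrite eN (_ : (fun n => _) = (fun n => (mean P (fun t => f (S n t)))%:E)); last first.
  by apply/funext => n; exact: eP.
move=> h; apply: cvg_EFin; first exact: nearW.
apply: h => C g g1 g2 gq cg.
exact: (clt_quad_approx mZ0 iidZ mpsi psi2 psi0 s0 ss gq cg).
Qed.

End central_limit_theorem.

(** * Conditional means *)

Section conditional_means.
Context {R : realType} {d dU : measure_display} {T : measurableType d}
  {U : measurableType dU}.
Variable P : probability T R.
Implicit Types (D V : T -> R) (N : set T).

Lemma set_mean D A : measurable A -> L1 P D ->
  (\int[P]_(t in A) (D t)%:E = (mean P (fun t => \1_A t * D t))%:E)%E.
Proof.
move=> mA D1; rewrite integral_mkcond -meanE.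
  apply: eq_integral => t _; rewrite patchE indicE.
  by case: ifPn => _; rewrite ?mul1r ?mul0r.
apply: L1_le (L1_norm D1); first by apply: measurable_funM => //; exact: (L1_measurable D1).
move=> t; rewrite normrM ler_piMl// indicE.
by case: (_ \in _); rewrite ?normr1 ?normr0.
Qed.

Lemma ae_mean (f g : T -> R) N : measurable N -> P N = 0%E ->
  measurable_fun setT f -> measurable_fun setT g -> (forall t, ~ N t -> f t = g t) ->
  mean P f = mean P g.
Proof.
move=> mN N0 mf mg fg; rewrite /mean; congr fine; apply: ae_eq_integral => //.
- exact/measurable_EFinP.
- exact/measurable_EFinP.
exists N; split => // t /=; apply: contra_notP => /fg E _; by rewrite E.
Qed.

Lemma ae_L1 (f g : T -> R) N : measurable N -> P N = 0%E ->
  measurable_fun setT f -> (forall t, ~ N t -> f t = g t) ->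
  L1 P g -> L1 P f.
Proof.
move=> mN N0 mf fg g1; have mg := L1_measurable g1.
apply/integrableP; split; first exact/measurable_EFinP.
have /integrableP[_] := g1; congr (_ < _)%E; apply: ae_eq_integral => //.
- by apply: measurableT_comp => //; exact/measurable_EFinP.
- by apply: measurableT_comp => //; exact/measurable_EFinP.
exists N; split => // t /=; apply: contra_notP => /fg E _; by rewrite E.
Qed.

Variable X : T -> U.
Hypothesis mX : measurable_fun setT X.

Let mXB B : measurable B -> measurable (X @^-1` B).
Proof. by move=> mB; rewrite -[X in measurable X]setTI; exact: mX. Qed.

Let mindX B : measurable B -> measurable_fun setT (fun t => \1_B (X t) : R).
Proof.
move=> mB; have h : measurable_fun setT (\1_B : U -> R) by exact: measurable_indic.
exact: (measurableT_comp h mX).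
Qed.

Definition cond_centered D : Prop :=
  L1 P D /\ forall B, measurable B -> mean P (fun t => \1_B (X t) * D t) = 0.

Lemma cond_exp_centered V (g : U -> R) : is_cond_exp P V X g ->
  cond_centered (fun t => V t - g (X t)).
Proof.
case=> mg V1 g1 h; split; first exact: L1B.
move=> B mB; have := h B mB; rewrite !set_mean//; try exact: mXB.
have i1 f : L1 P f -> L1 P (fun t => \1_B (X t) * f t).
  move=> f1; apply: L1_le (L1_norm f1).
    apply: measurable_funM; last exact: (L1_measurable f1).
    exact: mindX.
  move=> t; rewrite normrM ler_piMl// indicE.
  by case: (_ \in _); rewrite ?normr1 ?normr0.
move=> [E].
under [X in mean _ X]eq_fun do rewrite mulrBr.
rewrite meanB; [|exact: i1|exact: (i1 (g \o X))].
by apply/eqP; rewrite subr_eq0; apply/eqP/esym.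
Qed.

Let pos (x : R) := Num.max x 0.
Let neg (x : R) := Num.max (- x) 0.
Let pos_neg x : x = pos x - neg x.
Proof.
rewrite /pos /neg; have [h1|h1] := leP x 0; have [h2|h2] := leP (- x) 0; lra.
Qed.
Let pos0 x : 0 <= pos x. Proof. by rewrite /pos le_max lexx orbT. Qed.
Let neg0 x : 0 <= neg x. Proof. by rewrite /neg le_max lexx orbT. Qed.
Let pos_le x : pos x <= `|x|.
Proof. by rewrite /pos ge_max ler_norm normr_ge0. Qed.
Let neg_le x : neg x <= `|x|.
Proof. by rewrite /neg ge_max -normrN ler_norm normr_ge0. Qed.
Let mpos {d'} {T' : measurableType d'} (f : T' -> R) : measurable_fun setT f ->
  measurable_fun setT (fun t => pos (f t)).
Proof. by move=> mf; apply: measurable_maxr. Qed.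
Let mneg {d'} {T' : measurableType d'} (f : T' -> R) : measurable_fun setT f ->
  measurable_fun setT (fun t => neg (f t)).
Proof. by move=> mf; apply: measurable_maxr => //; exact: measurableT_comp. Qed.

(** Taking out what is known: the defining property of conditional means for
    indicators extends to every test function [k] of [X] for which it makes
    sense, by splitting [k] and [D] into positive and negative parts. *)
Lemma cond_centered_test D (k : U -> R) : cond_centered D ->
  measurable_fun setT k -> L1 P (fun t => k (X t) * D t) ->
  mean P (fun t => k (X t) * D t) = 0.
Proof.
move=> [D1 hD] mk kD1; have mD := L1_measurable D1.
have mkX : measurable_fun setT (fun t => k (X t)) by exact: (measurableT_comp mk).
have Dp1 : L1 P (fun t => pos (D t)).
  by apply: L1_le (L1_norm D1); [exact: mpos|move=> t; rewrite ger0_norm].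
have Dn1 : L1 P (fun t => neg (D t)).
  by apply: L1_le (L1_norm D1); [exact: mneg|move=> t; rewrite ger0_norm].
have i1 B f : measurable B -> L1 P f -> L1 P (fun t => \1_B (X t) * f t).
  move=> mB f1; apply: L1_le (L1_norm f1).
    apply: measurable_funM; last exact: (L1_measurable f1).
    exact: mindX.
  move=> t; rewrite normrM ler_piMl// indicE.
  by case: (_ \in _); rewrite ?normr1 ?normr0.
have eqB B : measurable B -> (\int[P]_(t in X @^-1` B) (pos (D t))%:E =
    \int[P]_(t in X @^-1` B) (neg (D t))%:E)%E.
  move=> mB; rewrite !set_mean//; try exact: mXB.
  congr _%:E; apply/eqP; rewrite -subr_eq0; apply/eqP.
  rewrite -[LHS]meanB; [|exact: (i1 B)|exact: (i1 B)].
  rewrite -[RHS](hD B mB); congr mean; apply/funext => t.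
  by rewrite -mulrBr -pos_neg.
have prod1 (u v : T -> R) : measurable_fun setT u -> measurable_fun setT v ->
   (forall t, 0 <= u t <= `|k (X t)|) -> (forall t, 0 <= v t <= `|D t|) ->
   L1 P (fun t => u t * v t).
  move=> mu mv hu hv; apply: L1_le (L1_norm kD1); first exact: measurable_funM.
  move=> t; have /andP[u0 uk] := hu t; have /andP[v0 vd] := hv t.
  by rewrite ger0_norm ?mulr_ge0// normrM ler_pM.
have key (u : U -> R) : measurable_fun setT u -> (forall x, 0 <= u x) ->
    L1 P (fun t => u (X t) * pos (D t)) -> L1 P (fun t => u (X t) * neg (D t)) ->
    mean P (fun t => u (X t) * pos (D t)) = mean P (fun t => u (X t) * neg (D t)).
  move=> mu u0 h1 h2.
  have := @weighted_integral_eq R _ U _ _ T T P X (fun t => pos (D t)) P X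
    (fun t => neg (D t)) (EFin \o u) mX (mpos mD) (fun t => pos0 _) mX (mneg mD)
    (fun t => neg0 _) eqB ((measurable_EFinP _ _).2 mu) (fun x => u0 x).
  by rewrite (meanE h1) (meanE h2) => -[].
have kp t : 0 <= pos (k (X t)) <= `|k (X t)| by rewrite pos0 pos_le.
have kn t : 0 <= neg (k (X t)) <= `|k (X t)| by rewrite neg0 neg_le.
have Dp t : 0 <= pos (D t) <= `|D t| by rewrite pos0 pos_le.
have Dn t : 0 <= neg (D t) <= `|D t| by rewrite neg0 neg_le.
have pp1 := prod1 _ _ (mpos mkX) (mpos mD) kp Dp.
have pn1 := prod1 _ _ (mpos mkX) (mneg mD) kp Dn.
have np1 := prod1 _ _ (mneg mkX) (mpos mD) kn Dp.
have nn1 := prod1 _ _ (mneg mkX) (mneg mD) kn Dn.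
have kp_eq := key (fun x => pos (k x)) (mpos mk) (fun x => pos0 _) pp1 pn1.
have kn_eq := key (fun x => neg (k x)) (mneg mk) (fun x => neg0 _) np1 nn1.
have -> : (fun t => k (X t) * D t) = (fun t =>
    (pos (k (X t)) * pos (D t) - pos (k (X t)) * neg (D t)) -
    (neg (k (X t)) * pos (D t) - neg (k (X t)) * neg (D t))).
  by apply/funext => t; rewrite {1}(pos_neg (k (X t))) {1}(pos_neg (D t)); ring.
rewrite meanB; [|exact: L1B|exact: L1B].
by rewrite !meanB// kp_eq kn_eq !subrr.
Qed.

(** Uniqueness of conditional expectations. *)
Lemma cond_centered_ae0 (f : U -> R) : measurable_fun setT f ->
  cond_centered (f \o X) -> P [set t | f (X t) <> 0] = 0%E.
Proof.
move=> mf [f1 hf].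
have mB : measurable [set u | f u <> 0] by exact: measurable_neqc.
(* testing against the sign of f gives the mean of its absolute value *)
pose k (u : U) : R := if 0 <= f u then 1 else -1.
have mk : measurable_fun setT k.
  by apply: measurable_fun_if => //; exact: measurable_fun_ler.
have kf u : k u * f u = `|f u|.
  rewrite /k; have [h|h] := leP 0 (f u); first by rewrite mul1r ger0_norm.
  by rewrite mulN1r ltr0_norm.
have kf1 : L1 P (fun t => k (X t) * (f \o X) t).
  by apply: eq_L1 (L1_norm f1) => t; rewrite /= kf.
have := cond_centered_test (conj f1 hf) mk kf1.
under eq_fun do rewrite /= kf.
move=> h.
have mfX : measurable_fun setT (EFin \o (f \o X)).
  by apply/measurable_EFinP; exact: measurableT_comp.
have /(ae_eq_integral_abs _ measurableT mfX) : (\int[P]_t `|(f (X t))%:E| = 0)%E.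
  have := meanE (L1_norm f1); rewrite /= => ->.
  by rewrite [mean _ _]h.
case=> N [mN N0 hN]; apply/eqP; rewrite eq_le measure_ge0 andbT -N0.
apply: le_measure; rewrite ?inE//; first exact: (mXB mB).
by move=> t /= ft; apply: (hN t) => /= h0; apply: ft; have [] := h0 Logic.I.
Qed.

End conditional_means.

(** * Conditional moments of the mixture *)

Section linear_forms.
Context {R : realType} {m : nat}.

Lemma dotE (u v : 'cV[R]_m) : dot u v = \sum_j u j 0 * v j 0.
Proof. by rewrite /dot mxE; apply: eq_bigr => j _; rewrite mxE. Qed.

Lemma dot_cvec (u : 'cV[R]_m) (x : m.-tuple R) :
  dot u (cvec x) = \sum_j u j 0 * tnth x j.
Proof. by rewrite dotE; apply: eq_bigr => j _; rewrite mxE. Qed.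

Lemma measurable_dot (u : 'cV[R]_m) :
  measurable_fun setT (fun x : m.-tuple R => dot u (cvec x)).
Proof.
under eq_fun do rewrite dot_cvec.
apply: measurable_sum => j; apply: measurable_funM => //; exact: measurable_tnth.
Qed.

Lemma measurable_etaX (l : 'cV[R]_m) : measurable_fun setT (etaX l).
Proof. exact: (measurableT_comp (measurable_dot l) measurable_fst). Qed.

End linear_forms.

Section mixture_moments.
Context {R : realType} {m : nat} {d : measure_display} {T : measurableType d}.
Variables (Q : probability T R) (X : T -> m.-tuple R) (I Y1 Y2 : T -> R)
  (p mu1 mu2 sigma1 sigma2 : R) (beta : 'cV[R]_m).
Hypothesis mix : mixture_model Q X I Y1 Y2 p mu1 mu2 sigma1 sigma2 beta.
Hypothesis X2 : forall j, L2 Q (fun t => tnth (X t) j).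

Local Notation Y := (mixture I Y1 Y2).
Let mX := mix_measX mix.
Let mI := mix_measI mix.
Let mY1 := mix_measY1 mix.
Let mY2 := mix_measY2 mix.

Definition mean1 (x : m.-tuple R) : R := mu1 + dot beta (cvec x).

Lemma measurable_mean1 : measurable_fun setT mean1.
Proof. by apply: measurable_funD => //; exact: measurable_dot. Qed.

Lemma measurable_mixture : measurable_fun setT Y.
Proof.
apply: measurable_funD; first exact: measurable_funM.
by apply: measurable_funM => //; exact: measurable_funB.
Qed.

Lemma L2_dot (u : 'cV[R]_m) : L2 Q (fun t => dot u (cvec (X t))).
Proof.
under eq_fun do rewrite dot_cvec.
by apply: L2_sum => j; exact: L2Z.
Qed.

Lemma L2_mean1 : L2 Q (fun t => mean1 (X t)).
Proof. by apply: L2D (L2_cst _ _) (L2_dot _). Qed.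

Let eps t := Y1 t - mean1 (X t).

Let eps2 : L2 Q eps.
Proof.
split; first exact: measurable_funB mY1 (measurableT_comp measurable_mean1 mX).
by have [_ [_ h _ _]] := mix_Y1 mix.
Qed.

Lemma L2_Y1 : L2 Q Y1.
Proof.
have := L2D L2_mean1 eps2; congr L2; apply/funext => t; by rewrite /eps addrC subrK.
Qed.

Lemma L2_Y2 : L2 Q Y2.
Proof. exact: L2_Lfun (mix_Y2 mix). Qed.

Lemma mean_Y2 : mean Q Y2 = mu2.
Proof.
have := mix_EY2 mix; rewrite unlock meanE; last exact: L2_L1 L2_Y2.
by case.
Qed.

Lemma mean_Y2_sqr : mean Q (fun t => Y2 t ^+ 2) = mu2 ^+ 2 + sigma2 ^+ 2.
Proof.
have := mix_VY2 mix; rewrite varianceE; last exact: mix_Y2 mix.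
rewrite (mix_EY2 mix) unlock.
have -> : (\int[Q]_w ((Y2 ^+ 2)%R w)%:E = (mean Q (fun t => Y2 t ^+ 2))%:E)%E.
  by rewrite -meanE//; case: L2_Y2.
by rewrite -EFin_expe -EFinB => -[] <-; rewrite addrC subrK.
Qed.

Let N := ~` ([set t | I t = 1] `|` [set t | I t = 0]).
Let mN : measurable N.
Proof. by apply/measurableC/measurableU; exact: measurable_eqc. Qed.
Let N0 : Q N = 0%E.
Proof.
have m1 : measurable [set t | I t = 1] by exact: measurable_eqc.
have m0 : measurable [set t | I t = 0] by exact: measurable_eqc.
have QU : Q ([set t | I t = 1] `|` [set t | I t = 0]) = 1%E.
  transitivity (p%:E + (1 - p)%:E)%E; last by rewrite -EFinD addrC subrK.
  rewrite measureU//; last first.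
    by apply/seteqP; split => // t /= [-> /eqP]; rewrite oner_eq0.
  by congr (_ + _)%E; [exact: mix_I1 mix|exact: mix_I0 mix].
by rewrite probability_setC ?QU ?subee//; exact: measurableU.
Qed.

Let indI (c : R) t : R := \1_[set c] (I t).
Let mindI c : measurable_fun setT (indI c).
Proof.
have h : measurable_fun setT (\1_[set c] : R -> R).
  by apply: measurable_indic; exact: measurable_set1.
exact: (measurableT_comp h mI).
Qed.

Let mind (B : set (m.-tuple R)) : measurable B ->
  measurable_fun setT (\1_B : m.-tuple R -> R).
Proof. by move=> mB; exact: measurable_indic. Qed.

Let indic_le1 {S : Type} (A : set S) (s : S) : `|\1_A s : R| <= 1.
Proof. by rewrite indicE; case: (_ \in _); rewrite ?normr1 ?normr0. Qed.

Let indic_L1 (B : set (m.-tuple R)) (f : T -> R) : measurable B -> L1 Q f ->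
  L1 Q (fun t => \1_B (X t) * f t).
Proof.
move=> mB f1; apply: L1_le (L1_norm f1).
  by apply: measurable_funM (L1_measurable f1); exact: (measurableT_comp (mind mB)).
by move=> t; rewrite normrM ler_piMl.
Qed.

Let mean_indI c : measurable [set t | I t = c] -> (mean Q (indI c))%:E = Q [set t | I t = c].
Proof.
by move=> mc; rewrite -(mean_indic Q mc); congr (_%:E); congr mean; apply/funext => t;
   rewrite /indI !indicE; congr (_%:R); congr nat_of_bool; apply/idP/idP; rewrite !inE.
Qed.

(** Independence of the mixing variable from all the rest. *)
Let mean_label c (F : m.-tuple R * (R * R) -> R) : measurable_fun setT F ->
  L1 Q (fun t => F (X t, (Y1 t, Y2 t))) ->
  mean Q (fun t => indI c t * F (X t, (Y1 t, Y2 t))) =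
  mean Q (indI c) * mean Q (fun t => F (X t, (Y1 t, Y2 t))).
Proof.
move=> mF F1.
pose W t := (X t, (Y1 t, Y2 t)).
have mW : measurable_fun setT W.
  by apply: measurable_fun_pair => //; exact: measurable_fun_pair.
have mc : measurable_fun setT (\1_[set c] : R -> R).
  by apply: measurable_indic; exact: measurable_set1.
have := @indep_mean R _ _ _ T _ _ Q I W mI mW (mix_indepI mix) (fun z => \1_[set c] z.1 * F z.2).
move=> ->.
- rewrite [RHS]mulrC -meanZ; last first.
    apply: (@L1_bounded _ _ _ _ _ 1) => [|t]; first exact: mindI.
    exact: indic_le1.
  by congr mean; apply/funext => t; rewrite /= meanZ// mulrC.
- apply: measurable_funM; first exact: (measurableT_comp mc).
  exact: measurableT_comp.
- apply: L1_le (L1_norm F1) => [|t].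
    by apply: measurable_funM; [exact: mindI|exact: L1_measurable F1].
  by rewrite normrM ler_piMl//; exact: indic_le1.
Qed.

(** Conditioning on the label: the mixture is [Y1] or [Y2] according to a label
    independent of everything else, and [Y2] is independent of the predictors. *)
Lemma mixture_set_mean (G : R -> R) B : measurable_fun setT G -> measurable B ->
  L1 Q (G \o Y1) -> L1 Q (G \o Y2) ->
  mean Q (fun t => \1_B (X t) * G (Y t)) =
  p * mean Q (fun t => \1_B (X t) * G (Y1 t)) +
  (1 - p) * (mean Q (fun t => \1_B (X t)) * mean Q (G \o Y2)).
Proof.
move=> mG mB G1 G2.
have mBX : measurable_fun setT (fun t => \1_B (X t) : R).
  exact: (measurableT_comp (mind mB) mX).
have B1 := indic_L1 mB G1; have B2 := indic_L1 mB G2.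
have F1 : measurable_fun setT (fun z : m.-tuple R * (R * R) => \1_B z.1 * G z.2.1).
  apply: measurable_funM; first exact: (measurableT_comp (mind mB)).
  by apply: (measurableT_comp mG); exact: (measurableT_comp measurable_fst measurable_snd).
have F2 : measurable_fun setT (fun z : m.-tuple R * (R * R) => \1_B z.1 * G z.2.2).
  apply: measurable_funM; first exact: (measurableT_comp (mind mB)).
  by apply: (measurableT_comp mG); exact: (measurableT_comp measurable_snd measurable_snd).
have e1 := mean_label 1 F1 B1; have e0 := mean_label 0 F2 B2.
have L1i c f : L1 Q f -> L1 Q (fun t => indI c t * f t).
  move=> f1; apply: L1_le (L1_norm f1) => [|t].
    by apply: measurable_funM; [exact: mindI|exact: L1_measurable f1].
  by rewrite normrM ler_piMl//; exact: indic_le1.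
have m1 : mean Q (indI 1) = p.
  have := mean_indI (measurable_eqc 1 mI); rewrite (mix_I1 mix) => -[]; exact.
have m0 : mean Q (indI 0) = 1 - p.
  have := mean_indI (measurable_eqc 0 mI); rewrite (mix_I0 mix) => -[]; exact.
have e2 : mean Q (fun t => \1_B (X t) * G (Y2 t)) =
    mean Q (fun t => \1_B (X t)) * mean Q (G \o Y2).
  have ind := @indep_mean R _ _ _ T _ _ Q Y2 X mY2 mX (mix_indepY2 mix) (fun z => G z.1 * \1_B z.2).
  rewrite mulrC; under eq_fun do rewrite mulrC.
  rewrite ind /=.
  - rewrite mulrC -meanZ//; congr mean; apply/funext => t; rewrite /= mulrC -meanZ//.
    by apply: (@L1_bounded _ _ _ _ _ 1) => // s; exact: indic_le1.
  - apply: measurable_funM; first exact: (measurableT_comp mG).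
    exact: (measurableT_comp (mind mB)).
  - by apply: eq_L1 B2 => t; rewrite mulrC.
rewrite -{1}m1 -{1}m0 -e2 -e1 -e0 -meanD; [|exact: L1i|exact: L1i].
apply: (ae_mean mN N0).
- apply: measurable_funM => //; exact: (measurableT_comp mG measurable_mixture).
- by apply: measurable_funD; exact: L1_measurable (L1i _ _ _).
have ii (a b : R) : \1_[set a] b = (b == a)%:R :> R.
  rewrite indicE; congr (_%:R); congr nat_of_bool; apply/idP/eqP; by rewrite inE.
move=> t /contrapT [/= It|/= It]; rewrite /mixture /indI It !ii eqxx.
  by rewrite oner_eq0 subrr !mul0r !addr0 !mul1r.
by rewrite eq_sym oner_eq0 subr0 !mul0r !add0r !mul1r.
Qed.

(** E(Y | X) *)
Definition regression (x : m.-tuple R) : R := p * mean1 x + (1 - p) * mu2.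

(** E(Y ^+ 2 | X) *)
Definition regression2 (x : m.-tuple R) : R :=
  p * (mean1 x ^+ 2 + sigma1 ^+ 2) + (1 - p) * (mu2 ^+ 2 + sigma2 ^+ 2).

Lemma measurable_regression2 : measurable_fun setT regression2.
Proof.
apply: measurable_funD => //; apply: measurable_funM => //.
by apply: measurable_funD => //; apply: measurable_funX; exact: measurable_mean1.
Qed.

Lemma regression2_ge x : p * mean1 x ^+ 2 <= regression2 x.
Proof.
have /andP[p0 p1] := mix_p mix; rewrite /regression2 mulrDr -addrA lerDl.
have q0 : 0 <= 1 - p by rewrite subr_ge0 ltW.
by apply: addr_ge0; apply: mulr_ge0 => //; rewrite ?addr_ge0 ?sqr_ge0// ltW.
Qed.

Lemma mixture_centered : L1 Q Y ->
  cond_centered Q X (fun t => Y t - regression (X t)).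
Proof.
move=> Y1i.
have reg1 : L1 Q (fun t => regression (X t)).
  by apply: L1D (L1Z _ (L2_L1 L2_mean1)) (L1_cst _ _).
split=> [|B mB]; first exact: L1B.
have [_ hB] := cond_exp_centered mX (mix_Y1 mix).1.
have Bm := indic_L1 mB (L2_L1 L2_mean1); have BY1 := indic_L1 mB (L2_L1 L2_Y1).
have B1 : L1 Q (fun t => \1_B (X t)) by apply: eq_L1 (indic_L1 mB (L1_cst Q 1)) => t; rewrite mulr1.
have := hB B mB; under [X in mean _ X]eq_fun do rewrite mulrBr.
rewrite meanB// => /eqP; rewrite subr_eq0 => /eqP e1.
under [X in mean _ X]eq_fun do rewrite mulrBr.
rewrite meanB; [|exact: indic_L1|exact: indic_L1].
rewrite (@mixture_set_mean id B)//; [|exact: L2_L1 L2_Y1|exact: L2_L1 L2_Y2].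
rewrite [mean Q (id \o Y2)]mean_Y2 [mean Q (fun t => \1_B (X t) * id (Y1 t))]e1.
have -> : (fun t => \1_B (X t) * regression (X t)) = (fun t =>
   p * (\1_B (X t) * mean1 (X t)) + ((1 - p) * mu2) * \1_B (X t)).
  by apply/funext => t; rewrite /regression; ring.
by rewrite meanD ?meanZ//; [ring|exact: L1Z|exact: L1Z].
Qed.

(** Given the predictors, [Y1] is the sum of [mean1 X] and an uncorrelated error
    of variance [sigma1 ^+ 2]. *)
Lemma mixture_centered2 : L1 Q (fun t => Y t ^+ 2) ->
  cond_centered Q X (fun t => Y t ^+ 2 - regression2 (X t)).
Proof.
move=> Y2i.
have [_ m2] := L2_mean1; have [_ y12] := L2_Y1; have [_ y22] := L2_Y2.
have reg1 : L1 Q (fun t => regression2 (X t)).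
  by apply: L1D (L1Z _ (L1D m2 (L1_cst _ _))) (L1_cst _ _).
split=> [|B mB]; first exact: L1B.
have Bm := indic_L1 mB m2; have BY1 := indic_L1 mB y12.
have B1 : L1 Q (fun t => \1_B (X t)) by apply: eq_L1 (indic_L1 mB (L1_cst Q 1)) => t; rewrite mulr1.
(* conditional centering of eps kills the cross term of Y1 = mean1 X + eps *)
have epsc : cond_centered Q X eps by exact: cond_exp_centered (mix_Y1 mix).1.
have cross1 : L1 Q (fun t => \1_B (X t) * mean1 (X t) * eps t).
  apply: eq_L1 (indic_L1 mB (L1_mul L2_mean1 eps2)) => t; exact: mulrA.
have cross : mean Q (fun t => \1_B (X t) * mean1 (X t) * eps t) = 0.
  apply: (cond_centered_test mX (k := fun x => \1_B x * mean1 x) epsc) => //.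
  by apply: measurable_funM; [exact: mind|exact: measurable_mean1].
have [_ hB] := cond_exp_centered mX (mix_Y1 mix).2.
have Be := indic_L1 mB eps2.2.
have esq : mean Q (fun t => \1_B (X t) * eps t ^+ 2) = sigma1 ^+ 2 * mean Q (fun t => \1_B (X t)).
  have := hB B mB; under [X in mean _ X]eq_fun do rewrite mulrBr [_ * sigma1 ^+ 2]mulrC.
  rewrite meanB//; last exact: L1Z.
  by rewrite meanZ// => /eqP; rewrite subr_eq0 => /eqP.
have e1 : mean Q (fun t => \1_B (X t) * Y1 t ^+ 2) =
    mean Q (fun t => \1_B (X t) * mean1 (X t) ^+ 2) + sigma1 ^+ 2 * mean Q (fun t => \1_B (X t)).
  have -> : (fun t => \1_B (X t) * Y1 t ^+ 2) = (fun t =>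
      (\1_B (X t) * mean1 (X t) ^+ 2 + 2 * (\1_B (X t) * mean1 (X t) * eps t)) +
      \1_B (X t) * eps t ^+ 2).
    by apply/funext => t; rewrite /eps; ring.
  rewrite meanD//; last by apply: L1D => //; exact: L1Z.
  rewrite meanD//; last exact: L1Z.
  by rewrite meanZ// cross mulr0 addr0 esq.
under [X in mean _ X]eq_fun do rewrite mulrBr.
rewrite meanB; [|exact: indic_L1|exact: indic_L1].
rewrite (@mixture_set_mean (fun y => y ^+ 2) B)//.
rewrite [mean Q (_ \o Y2)]mean_Y2_sqr e1.
have -> : (fun t => \1_B (X t) * regression2 (X t)) = (fun t =>
   p * (\1_B (X t) * mean1 (X t) ^+ 2) +
   (p * sigma1 ^+ 2 + (1 - p) * (mu2 ^+ 2 + sigma2 ^+ 2)) * \1_B (X t)).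
  by apply/funext => t; rewrite /regression2; ring.
by rewrite meanD ?meanZ//; [ring|exact: L1Z|exact: L1Z].
Qed.

(** Both [h] and the explicit function are versions of the conditional mean of
    [Y ^+ 2], so their difference is conditionally centered. *)
Lemma cond_exp_regression2 (h : m.-tuple R -> R) :
  is_cond_exp Q (fun t => Y t ^+ 2) X h ->
  Q [set t | h (X t) - regression2 (X t) <> 0] = 0%E.
Proof.
move=> hY; have [mh Y2i h1 _] := hY.
have [c1 cB] := cond_exp_centered mX hY.
have [q1 qB] := mixture_centered2 Y2i.
apply: (cond_centered_ae0 mX (f := fun x => h x - regression2 x)).
  by apply: measurable_funB => //; exact: measurable_regression2.
split.
  by apply: eq_L1 (L1B q1 c1) => t /=; ring.
move=> B mB; have := L1B (indic_L1 mB q1) (indic_L1 mB c1) => _.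
transitivity (mean Q (fun t => \1_B (X t) * (Y t ^+ 2 - regression2 (X t)) -
    \1_B (X t) * (Y t ^+ 2 - h (X t)))).
  by congr mean; apply/funext => t /=; ring.
by rewrite meanB ?qB ?cB ?subrr//; exact: indic_L1.
Qed.

(** The second moment of [X_j Y] dominates that of [X_j E(Y1 | X)], because
    E(Y ^+ 2 | X) is at least [p] times the square of E(Y1 | X). *)
Lemma L2_regressor_mean1 j : L1 Q (fun t => Y t ^+ 2) ->
  L2 Q (fun t => tnth (X t) j * Y t) -> L2 Q (fun t => tnth (X t) j * mean1 (X t)).
Proof.
move=> Y2i [_ XY2].
have /andP[p0 p1] := mix_p mix.
have mxj : measurable_fun setT (fun x : m.-tuple R => tnth x j) by exact: measurable_tnth.
have mm : measurable_fun setT (fun t => tnth (X t) j * mean1 (X t)).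
  apply: measurable_funM; first exact: (measurableT_comp mxj).
  exact: (measurableT_comp measurable_mean1).
split => //.
have [reg1 qB] := mixture_centered2 Y2i.
have r0 t : 0 <= regression2 (X t).
  by apply: le_trans (regression2_ge _); rewrite mulr_ge0 ?sqr_ge0// ltW.
have q1 : L1 Q (fun t => regression2 (X t)).
  by apply: eq_L1 (L1B Y2i reg1) => t; ring.
have mr : measurable_fun setT (fun t => regression2 (X t)).
  exact: (measurableT_comp measurable_regression2).
have eqI := @weighted_integral_eq R _ (m.-tuple R) _ _ T T Q X (fun t => Y t ^+ 2)
  Q X (fun t => regression2 (X t)) (fun x => (tnth x j ^+ 2)%:E).
have qL1 : L1 Q (fun t => tnth (X t) j ^+ 2 * regression2 (X t)).
  apply/integrableP; split.
    apply/measurable_EFinP; apply: measurable_funM => //; apply: measurable_funX.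
    exact: (measurableT_comp mxj).
  have -> : (\int[Q]_t `|(tnth (X t) j ^+ 2 * regression2 (X t))%:E| =
     \int[Q]_t ((tnth (X t) j ^+ 2)%:E * (regression2 (X t))%:E))%E.
    by apply: eq_integral => t _; rewrite -EFinM/= ger0_norm// mulr_ge0// sqr_ge0.
  rewrite -eqI//.
  - have /integrableP[_] := XY2; congr (_ < _)%E; apply: eq_integral => t _.
    by rewrite -EFinM /= ger0_norm ?sqr_ge0// exprMn.
  - exact: L1_measurable Y2i.
  - by move=> t; exact: sqr_ge0.
  - move=> B mB; rewrite !set_mean//; last 2 first.
    + by rewrite -[X in measurable X]setTI; exact: mX.
    + by rewrite -[X in measurable X]setTI; exact: mX.
    congr _%:E; apply/eqP; rewrite -subr_eq0 -[X in X == _]meanB.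
    - rewrite -[X in _ == X](qB B mB); apply/eqP; congr mean; apply/funext => t.
      by rewrite mulrBr.
    - exact: (indic_L1 mB Y2i).
    - exact: (indic_L1 mB q1).
  - by apply/measurable_EFinP; exact: measurable_funX.
  - by move=> x; rewrite lee_fin sqr_ge0.
apply: L1_le (L1Z p^-1 qL1); first exact: measurable_funX.
move=> t; rewrite ger0_norm ?sqr_ge0// exprMn [leRHS]mulrCA; apply: ler_wpM2l; first exact: sqr_ge0.
by rewrite ler_pdivlMl//; exact: regression2_ge.
Qed.

End mixture_moments.

(** * Linearization of least squares *)

Section random_matrices.
Context {R : realType} {d : measure_display} {T : measurableType d}.
Variable P : probability T R.

Lemma measurable_prod_fun (I : Type) (s : seq I) (f : I -> T -> R) :
  (forall i, measurable_fun setT (f i)) ->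
  measurable_fun setT (fun t => \prod_(i <- s) f i t).
Proof.
move=> mf; elim: s => [|i s ih].
  by under eq_fun do rewrite big_nil; exact: measurable_cst.
by under eq_fun do rewrite big_cons; exact: measurable_funM.
Qed.

Definition measurable_mx {k l} (M : T -> 'M[R]_(k, l)) : Prop :=
  forall i j, measurable_fun setT (fun t => M t i j).

Lemma measurable_det {k} (M : T -> 'M[R]_k) : measurable_mx M ->
  measurable_fun setT (fun t => \det (M t)).
Proof.
move=> mM; rewrite /determinant; apply: measurable_sum => s.
by apply: measurable_funM => //; apply: measurable_prod_fun => i; exact: mM.
Qed.

Lemma measurable_adj {k} (M : T -> 'M[R]_k) : measurable_mx M ->
  measurable_mx (fun t => \adj (M t)).
Proof.
move=> mM i j; under eq_fun do rewrite mxE /cofactor.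
apply: measurable_funM => //; apply: measurable_det => i' j'.
by under eq_fun do rewrite !mxE; exact: mM.
Qed.

Lemma measurable_mulmx {k l q} (M : T -> 'M[R]_(k, l)) (N : T -> 'M[R]_(l, q)) :
  measurable_mx M -> measurable_mx N -> measurable_mx (fun t => M t *m N t).
Proof.
move=> mM mN i j; under eq_fun do rewrite mxE.
by apply: measurable_sum => r; exact: measurable_funM.
Qed.

(** A non-invertible matrix is its own inverse by convention, whence the case
    distinction on the determinant. *)
Lemma measurable_invmx {k} (M : T -> 'M[R]_k) : measurable_mx M ->
  measurable_mx (fun t => invmx (M t)).
Proof.
move=> mM i j; have mdet := measurable_det mM.
rewrite (_ : (fun t => _) = (fun t => if \det (M t) == 0 then M t i j
    else (\det (M t))^-1 * \adj (M t) i j)).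
  apply: measurable_fun_if => //.
  - exact: (measurable_fun_eqr mdet (measurable_cst _)).
  - exact: measurable_funTS.
  - apply: measurable_funTS; apply: measurable_funM; first exact: measurable_fun_inv.
    exact: measurable_adj.
apply/funext => t; rewrite /invmx unitmxE unitfE.
by case: eqP => _ /=; rewrite ?mxE.
Qed.

Definition cvpr_mx {k l} (M : nat -> T -> 'M[R]_(k, l)) (L : 'M[R]_(k, l)) : Prop :=
  forall i j, cvpr P (fun n t => M n t i j) (L i j).

Lemma cvpr_det {k} (M : nat -> T -> 'M[R]_k) (L : 'M[R]_k) : cvpr_mx M L ->
  cvpr P (fun n t => \det (M n t)) (\det L).
Proof.
move=> cM; rewrite /determinant; apply: cvpr_sum => s.
by apply: cvprZ; apply: cvpr_prod => i; exact: cM.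
Qed.

Lemma cvpr_adj {k} (M : nat -> T -> 'M[R]_k) (L : 'M[R]_k) : cvpr_mx M L ->
  cvpr_mx (fun n t => \adj (M n t)) (\adj L).
Proof.
move=> cM i j; under eq_fun do under eq_fun do rewrite mxE /cofactor.
rewrite mxE /cofactor; apply: cvprZ; apply: cvpr_det => i' j'.
by under eq_fun do under eq_fun do rewrite !mxE; rewrite !mxE; exact: cM.
Qed.

(** Inversion is continuous at an invertible limit, through the adjugate; the
    event of a vanishing determinant, where the inverse is a convention, is
    rare. *)
Lemma cvpr_invmx {k} (M : nat -> T -> 'M[R]_k) (L : 'M[R]_k) : L \in unitmx ->
  cvpr_mx M L -> cvpr_mx (fun n t => invmx (M n t)) (invmx L).
Proof.
move=> uL cM i j.
have dL : \det L != 0 by rewrite -unitfE -unitmxE.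
have cdet := cvpr_det cM.
have mM n : measurable_mx (M n) by move=> i' j'; case: (cM i' j').
have -> : invmx L i j = (\det L)^-1 * \adj L i j by rewrite /invmx uL mxE.
have h := cvprM (cvprV dL cdet) (cvpr_adj cM i j).
apply: cvpr_near h; first by move=> n; exact: measurable_invmx.
apply: rareS (rare_eq0 dL cdet).
  move=> n; have mdet := measurable_det (mM n).
  rewrite (_ : [set _ | _] = [set t | (\det (M n t))^-1 * \adj (M n t) i j - invmx (M n t) i j <> 0]).
    apply: measurable_neqc; apply: measurable_funB; last exact: measurable_invmx.
    by apply: measurable_funM; [exact: measurable_fun_inv|exact: measurable_adj].
  apply/seteqP; split => t /=; first by move=> h1 /eqP; rewrite subr_eq0 => /eqP.
  by move=> h1 E; apply: h1; rewrite E subrr.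
apply: nearW => n t /= h1; apply: contrapT => /eqP dM; apply: h1.
by rewrite /invmx unitmxE unitfE dM [RHS]mxE.
Qed.

End random_matrices.

Section least_squares.
Context {R : realType} {m : nat} {d0 d : measure_display} {T0 : measurableType d0}
  {T : measurableType d}.
Variables (Q : probability T0 R) (Z0 : T0 -> obs R m).
Variables (P : probability T R) (Z : nat -> T -> obs R m).
Hypotheses (mZ0 : measurable_fun setT Z0) (iidZ : iid_copies Q Z0 P Z).

Lemma PPE (f : obs R m -> R) : PP Q Z0 f = mean Q (f \o Z0).
Proof. by rewrite /PP /mean unlock. Qed.

Lemma emp_sum (I : Type) (s : seq I) (c : I -> R) (f : I -> obs R m -> R) n t :
  (forall i, L1 Q (f i \o Z0)) ->
  emp Q Z0 Z (fun z => \sum_(i <- s) c i * f i z) n t =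
  \sum_(i <- s) c i * emp Q Z0 Z (f i) n t.
Proof.
move=> f1; rewrite /emp.
have -> : mean Q ((fun z => \sum_(i <- s) c i * f i z) \o Z0) =
    \sum_(i <- s) c i * mean Q (f i \o Z0).
  rewrite -[LHS]/(mean Q (fun t => \sum_(i <- s) c i * f i (Z0 t))).
  rewrite mean_sum; last by move=> i; exact: L1Z (f1 i).
  by apply: eq_bigr => i _; rewrite meanZ//; exact: f1.
under eq_bigr do rewrite -sumrB.
rewrite exchange_big/= mulr_sumr; apply: eq_bigr => i _.
rewrite mulrCA; congr (_ * _); rewrite mulr_sumr; apply: eq_bigr => k _.
by rewrite mulrBr.
Qed.

Lemma empD (f g : obs R m -> R) n t : L1 Q (f \o Z0) -> L1 Q (g \o Z0) ->
  emp Q Z0 Z (fun z => f z + g z) n t = emp Q Z0 Z f n t + emp Q Z0 Z g n t.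
Proof.
move=> f1 g1; rewrite /emp -mulrDr -big_split/=; congr (_ * _).
apply: eq_bigr => i _; rewrite -[mean _ _]/(mean Q (fun t => f (Z0 t) + g (Z0 t))).
by rewrite meanD//; ring.
Qed.

Lemma empZ (c : R) (f : obs R m -> R) n t : L1 Q (f \o Z0) ->
  emp Q Z0 Z (fun z => c * f z) n t = c * emp Q Z0 Z f n t.
Proof.
move=> f1; rewrite /emp mulrCA; congr (_ * _); rewrite mulr_sumr.
apply: eq_bigr => i _; rewrite -[mean _ _]/(mean Q (fun t => c * f (Z0 t))).
by rewrite meanZ//; ring.
Qed.

Lemma measurable_Z_x i j : measurable_fun setT (fun t => tnth (Z i t).1 j).
Proof.
have mt : measurable_fun setT (fun x : m.-tuple R => tnth x j) by exact: measurable_tnth.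
apply: (measurableT_comp mt).
exact: (measurableT_comp measurable_fst (iid_measurable iidZ i)).
Qed.

Definition regressor (k : 'I_(1 + m)) (z : obs R m) : R := tildeX z.1 k 0.

Lemma measurable_regressor k : measurable_fun setT (regressor k).
Proof.
rewrite /regressor; under eq_fun do rewrite mxE.
case: (fintype.split k) => j; under eq_fun do rewrite mxE; first exact: measurable_cst.
have mt : measurable_fun setT (fun x : m.-tuple R => tnth x j) by exact: measurable_tnth.
exact: (measurableT_comp mt measurable_fst).
Qed.

Definition gram n t : 'M[R]_(1 + m) :=
  (design n (Z ^~ t))^T *m design n (Z ^~ t).

Lemma gramE n t i j :
  gram n t i j = \sum_(k < n) regressor i (Z k t) * regressor j (Z k t).
Proof. by rewrite mxE; apply: eq_bigr => k _; rewrite /regressor !mxE. Qed.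

Lemma measurable_regressor_Z i k : measurable_fun setT (fun t => regressor i (Z k t)).
Proof. exact: (measurableT_comp (measurable_regressor i) (iid_measurable iidZ k)). Qed.

Lemma measurable_gram n : measurable_mx (gram n).
Proof.
move=> i j; under eq_fun do rewrite gramE.
by apply: measurable_sum => k; apply: measurable_funM; exact: measurable_regressor_Z.
Qed.

Lemma measurable_lambda1_hat n j :
  measurable_fun setT (fun t => lambda1_hat n (Z ^~ t) j 0).
Proof.
have h : measurable_mx (fun t => lambda1_hat n (Z ^~ t)); last exact: h.
apply: measurable_mulmx; last first.
  apply: measurable_mulmx => k l; first by under eq_fun do rewrite 3!mxE; exact: measurable_regressor_Z.
  under eq_fun do rewrite mxE.
  exact: (measurableT_comp measurable_snd (iid_measurable iidZ k)).
apply: measurable_mulmx; first by move=> k l; exact: measurable_cst.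
by apply: measurable_invmx; exact: measurable_gram.
Qed.

Definition residual (c : R) (l : 'cV[R]_m) (z : obs R m) : R :=
  z.2 - (c + dot l (cvec z.1)).

Lemma measurable_residual c l : measurable_fun setT (residual c l).
Proof.
apply: measurable_funB; first exact: measurable_snd.
apply: measurable_funD => //; exact: measurable_etaX.
Qed.

Lemma designE n (z : nat -> obs R m) c l i :
  (design n z *m col_mx (const_mx c : 'cV[R]_1) l) i 0 = c + dot l (cvec (z i).1).
Proof.
rewrite mxE big_split_ord/= big_ord1 dotE; congr (_ + _).
  by rewrite col_mxEu !mxE/= (unsplitK (inl _ ord0)) mxE mul1r.
by apply: eq_bigr => j _; rewrite col_mxEd !mxE (unsplitK (inr _ j)) mxE mulrC.
Qed.

(** Since the response is the design times [(c, l)] plus the residuals, the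
    least-squares estimator differs from [l] by the inverse Gram matrix applied
    to the sums of regressor times residual. *)
Lemma lambda1_hatE n t c l : gram n t \in unitmx ->
  lambda1_hat n (Z ^~ t) = l + Aproj *m invmx (gram n t) *m
    \col_k \sum_(i < n) regressor k (Z i t) * residual c l (Z i t).
Proof.
move=> u; pose theta : 'cV[R]_(1 + m) := col_mx (const_mx c) l.
have e : (design n (Z ^~ t))^T *m response n (Z ^~ t) = gram n t *m theta +
    \col_k \sum_(i < n) regressor k (Z i t) * residual c l (Z i t).
  rewrite /gram -mulmxA; apply/colP => k.
  rewrite [LHS]mxE [RHS]mxE [X in X + _]mxE [X in _ + X]mxE -big_split/=.
  apply: eq_bigr => i _; rewrite designE [response _ _ _ _]mxE.
  have -> : (design n (Z ^~ t))^T k i = regressor k (Z i t) by rewrite 3!mxE.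
  by rewrite /residual; ring.
rewrite /lambda1_hat e mulmxDr -/(gram n t) [in X in X + _]mulmxA -[X in X *m theta]mulmxA.
by rewrite mulVmx// mulmx1 mul_row_col mul0mx mul1mx add0r.
Qed.

Variables (c : R) (l : 'cV[R]_m).
Local Notation second_moments :=
  (\matrix_(i, j) PP Q Z0 (fun z => tildeX z.1 i 0 * tildeX z.1 j 0)).
Hypothesis reg2 : forall k, L2 Q (regressor k \o Z0).
Hypothesis unit_moments : second_moments \in unitmx.

Let psi k z := regressor k z * residual c l z.
Hypothesis psi2 : forall k, L2 Q (psi k \o Z0).
Hypothesis psi0 : forall k, mean Q (psi k \o Z0) = 0.

(** The influence function of the [j]-th coordinate of the estimator. *)
Definition ols_score j (z : obs R m) : R :=
  \sum_k (Aproj *m invmx second_moments) j k * (regressor k z * residual c l z).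

Lemma measurable_psi k : measurable_fun setT (psi k).
Proof.
by apply: measurable_funM; [exact: measurable_regressor|exact: measurable_residual].
Qed.

Lemma measurable_ols_score j : measurable_fun setT (ols_score j).
Proof. by apply: measurable_sum => k; apply: measurable_funM => //; exact: measurable_psi. Qed.

Lemma L2_ols_score j : L2 Q (ols_score j \o Z0).
Proof. by apply: L2_sum => k; apply: L2Z; exact: psi2. Qed.

Let mean_gram n t : 'M[R]_(1 + m) := n%:R^-1 *: gram n t.

Let mean_gram_cvg : cvpr_mx P mean_gram second_moments.
Proof.
move=> i j; rewrite mxE PPE.
have := wlln mZ0 iidZ (phi := fun z => regressor i z * regressor j z).
have -> : (fun n t => mean_gram n t i j) = avg Z (fun z => regressor i z * regressor j z).
  by apply/funext => n; apply/funext => t; rewrite mxE gramE.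
apply; first by apply: measurable_funM; exact: measurable_regressor.
exact: (L1_mul (reg2 i) (reg2 j)).
Qed.

(** The scaled Gram matrix converges to the invertible matrix of second moments,
    by the weak law, and multiplies a tight sequence; so it may be replaced by
    its limit. Samples with a singular Gram matrix are rare. *)
Lemma ols_linear j :
  cvpr P (fun n t => Num.sqrt n%:R * (lambda1_hat n (Z ^~ t) j 0 - l j 0) -
                     emp Q Z0 Z (ols_score j) n t) 0.
Proof.
have tight_psi k : tightP P (emp Q Z0 Z (psi k)).
  by apply: (tight_emp mZ0 iidZ); [exact: measurable_psi|exact: psi2].
have cinv := cvpr_invmx unit_moments mean_gram_cvg.
pose coef n t := Aproj *m invmx (mean_gram n t).
have ccoef k : cvpr P (fun n t => coef n t j k) ((Aproj *m invmx second_moments) j k).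
  under eq_fun do under eq_fun do rewrite mxE; rewrite mxE.
  by apply: cvpr_sum => i; apply: cvprZ; exact: cinv.
have main : cvpr P (fun n t => \sum_k (coef n t j k - (Aproj *m invmx second_moments) j k) *
    emp Q Z0 Z (psi k) n t) 0.
  have h k : cvpr P (fun n t => (coef n t j k - (Aproj *m invmx second_moments) j k) *
      emp Q Z0 Z (psi k) n t) 0.
    by apply: cvpr0_tightM (tight_psi k); exact: ((cvpr_subr0 P _ _).1 (ccoef k)).
  by have := cvpr_sum (index_enum _) h; rewrite big1.
have mS n : measurable_fun setT (fun t => Num.sqrt n%:R * (lambda1_hat n (Z ^~ t) j 0 - l j 0) -
      emp Q Z0 Z (ols_score j) n t).
  apply: measurable_funB; last by apply: (measurable_emp iidZ); exact: measurable_ols_score.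
  by apply: measurable_funM => //; apply: measurable_funB => //; exact: measurable_lambda1_hat.
apply: cvpr_near (main) => //.
have udet : \det second_moments != 0 by rewrite -unitfE -unitmxE.
apply: rareS (rare_eq0 udet (cvpr_det mean_gram_cvg)).
  move=> n; have m1 := cvpr_measurable main n.
  rewrite (_ : [set _ | _] = [set t | \sum_k (coef n t j k - (Aproj *m invmx second_moments) j k) *
    emp Q Z0 Z (psi k) n t - (Num.sqrt n%:R * (lambda1_hat n (Z ^~ t) j 0 - l j 0) -
                     emp Q Z0 Z (ols_score j) n t) <> 0]).
    by apply: measurable_neqc; exact: measurable_funB.
  apply/seteqP; split => t /=; first by move=> h1 /eqP; rewrite subr_eq0 => /eqP.
  by move=> h1 E; apply: h1; rewrite E subrr.
near=> n => t /= h1; apply: contrapT => /eqP dM; apply: h1.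
have n0 : (n%:R : R) != 0 by rewrite pnatr_eq0 -lt0n; near: n; exists 1%N.
have uM : mean_gram n t \in unitmx by rewrite unitmxE unitfE.
have gE : gram n t = n%:R *: mean_gram n t by rewrite /mean_gram scalerA mulfV// scale1r.
have uG : gram n t \in unitmx by rewrite gE unitmxZ// unitfE.
rewrite (lambda1_hatE c l uG) mxE [l j 0 + _]addrC addrK.
have iE : invmx (gram n t) = n%:R^-1 *: invmx (mean_gram n t).
  by rewrite gE invmxZ// -gE.
rewrite iE -scalemxAr -scalemxAl mxE -/(coef n t) mxE.
rewrite emp_sum; last by move=> k; exact: L2_L1 (psi2 k).
under eq_bigr do rewrite mulrBl.
rewrite sumrB; congr (_ - _).
rewrite mulrA; have -> : Num.sqrt n%:R * n%:R^-1 = (Num.sqrt (n%:R : R))^-1.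
  have s0 : Num.sqrt (n%:R : R) != 0.
    by rewrite gt_eqF// sqrtr_gt0 lt_neqAle eq_sym n0/=.
  by rewrite -{2}[n%:R]sqr_sqrtr// expr2 invfM mulrA mulfV// mul1r.
rewrite mulr_sumr; apply: eq_bigr => k _; rewrite mulrCA; congr (_ * _).
congr (_ * _); rewrite [RHS]mxE; apply: eq_bigr => i _; by rewrite psi0 subr0.
Unshelve. all: by end_near. Qed.

End least_squares.

(** * Expansion of functions of a linear predictor *)

Section column_norm.
Context {R : realType} {m : nat}.
Implicit Types (v : 'cV[R]_m).

Lemma norm_coord_le {k l} (v : 'M[R]_(k, l)) i j : `|v i j| <= `|v|.
Proof.
rewrite [leRHS]mx_normrE.
exact: (@le_bigmax _ _ _ 0 (fun ij : 'I_k * 'I_l => `|v ij.1 ij.2|) (i, j)).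
Qed.

(** The norm of matrices is the maximum of the coordinates. *)
Lemma norm_col_sqr v : `|v| ^+ 2 <= \sum_j v j 0 ^+ 2.
Proof.
have [->|v0] := eqVneq v 0.
  by rewrite normr0 expr0n; apply: sumr_ge0 => j _; exact: sqr_ge0.
have : mx_norm v != 0 by rewrite -[mx_norm v]/(`|v|) normr_eq0.
move=> /mx_norm_neq0[[i j]] /= vE; rewrite -[`|v|]/(mx_norm v) vE.
rewrite real_normK ?num_real// [j]ord1 (bigD1 i)//= lerDl.
by apply: sumr_ge0 => k _; exact: sqr_ge0.
Qed.

End column_norm.

Section differentiability_from_quadratic_remainder.
Context {R : realType} {m : nat}.

(** A linear form carried by its gradient, so that differentials and gradients
    are exchanged without computing. *)
Definition lform (g : 'cV[R]_m) (v : 'cV[R]_m) : R := dot v g.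

Let lform_is_linear g : linear (lform g).
Proof.
move=> a u v; rewrite /lform !dotE scaler_sumr -big_split/=.
by apply: eq_bigr => j _; rewrite !mxE /GRing.scale/=; ring.
Qed.

HB.instance Definition _ g := GRing.isLinear.Build R 'cV[R]_m R _ (lform g) (lform_is_linear g).

Lemma continuous_lform g : continuous (lform g).
Proof.
have dj j (v : 'cV[R]_m) : differentiable (fun v : 'cV[R]_m => v j 0 * g j 0 : R) v.
  by apply: differentiableM => //; exact: differentiable_coord.
move=> v; apply: differentiable_continuous.
have -> : lform g = \sum_j (fun v : 'cV[R]_m => v j 0 * g j 0).
  by apply/funext => u; rewrite fct_sumE; exact: dotE.
exact: differentiable_sum.
Qed.

(** A quadratic remainder is more than enough for Frechet differentiability. *)
Lemma is_diff_quadratic (f : 'cV[R]_m -> R) (g x : 'cV[R]_m) (C r : R) : 0 < r ->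
  (forall h, `|h| < r -> `|f (h + x) - f x - lform g h| <= C * `|h| ^+ 2) ->
  is_diff x f (lform g).
Proof.
move=> r0 fC.
have o : f \o shift x = cst (f x) + lform g +o_ (0 : 'cV[R]_m) id.
  apply/eqaddoP => e e0.
  have C0 : 0 < `|C| + 1 by rewrite ltr_wpDl.
  have d0 : 0 < Num.min r (e / (`|C| + 1)) by rewrite lt_min r0 divr_gt0.
  apply/nbhs_ballP; exists (Num.min r (e / (`|C| + 1))) => //= h.
  rewrite -ball_normE/= sub0r normrN lt_min => /andP[hr he].
  rewrite -[X in `|X|]/(f (h + x) - (f x + lform g h)) opprD addrA.
  apply: le_trans (fC h hr) _; rewrite expr2 mulrA ler_wpM2r//.
  apply: (@le_trans _ _ ((`|C| + 1) * `|h|)).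
    by rewrite ler_wpM2r//; have := ler_norm C; lra.
  by rewrite -ler_pdivlMl// mulrC ltW.
have dE := diff_unique (@continuous_lform g) o.
apply: DiffDef => //; apply/diff_locallyP; rewrite dE; split => //.
exact: continuous_lform.
Qed.

Lemma grad_is_diff (f : 'cV[R]_m -> R) (g x : 'cV[R]_m) :
  is_diff x f (lform g) -> grad f x = g.
Proof.
move=> [df dE]; apply/colP => j; rewrite mxE deriveE// dE /lform dotE.
rewrite (bigD1 j)//= big1 ?addr0; first by rewrite mxE !eqxx mul1r.
by move=> i ij; rewrite mxE (negbTE ij) mul0r.
Qed.

End differentiability_from_quadratic_remainder.

Section ridge_functions.
Context {R : realType} {m : nat}.

Lemma dotD (u v w : 'cV[R]_m) : dot (u + v) w = dot u w + dot v w.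
Proof. by rewrite !dotE -big_split/=; apply: eq_bigr => j _; rewrite mxE mulrDl. Qed.

Lemma dotZ (a : R) (u w : 'cV[R]_m) : dot (a *: u) w = a * dot u w.
Proof. by rewrite !dotE mulr_sumr; apply: eq_bigr => j _; rewrite mxE mulrA. Qed.

Lemma dot_delta j (w : 'cV[R]_m) : dot (delta_mx j 0) w = w j 0.
Proof.
rewrite dotE (bigD1 j)//= big1 ?addr0; first by rewrite mxE !eqxx mul1r.
by move=> i ij; rewrite mxE (negbTE ij) mul0r.
Qed.

Lemma is_derive_line (a : R) (g g' : R -> R) (u e t : R) :
  (forall u : R, is_derive u 1 g (g' u)) ->
  is_derive t 1 (fun t => a * g (u + t * e)) (a * g' (u + t * e) * e).
Proof.
move=> dg.
have h : is_derive t 1 (fun t : R => u + t * e) e.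
  have -> : (fun t : R => u + t * e) = fun t => u + e * t.
    by apply/funext => s; rewrite mulrC.
  have [h1 h2] := is_deriveD (is_derive_cst u t 1) (is_deriveZ e (is_derive_id t 1)).
  by apply: DeriveDef; [exact: h1|rewrite [LHS]h2 add0r /GRing.scale/= mulr1].
have h2 := @is_derive1_comp R g (fun t => u + t * e) t _ _ (dg (u + t * e)) h.
have [h3 h4] := is_deriveZ a h2.
apply: DeriveDef; first exact: h3.
by rewrite [LHS]h4 /GRing.scale/= mulrA.
Qed.

Definition ridge (c : R) (g : R -> R) (x : m.-tuple R) (l : 'cV[R]_m) : R :=
  c * g (dot l (cvec x)).

Lemma derive_ridge c (g g' : R -> R) x (l v : 'cV[R]_m) :
  (forall u : R, is_derive u 1 g (g' u)) ->
  'D_v (ridge c g x) l = c * g' (dot l (cvec x)) * dot v (cvec x).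
Proof.
move=> dg.
have [_] := is_derive_line c (dot l (cvec x)) (dot v (cvec x)) 0 dg.
rewrite mul0r addr0 => <-.
rewrite /derive /=.
have -> : (fun h : R => h^-1 *: ((ridge c g x \o shift l) (h *: v) - ridge c g x l)) =
  (fun h : R => h^-1 *: (((fun t => c * g (dot l (cvec x) + t * dot v (cvec x))) \o shift 0)
     (h *: 1) - c * g (dot l (cvec x) + 0 * dot v (cvec x)))) => //.
apply/funext => h /=.
rewrite /ridge dotD dotZ mul0r !addr0.
congr (h^-1 *: (c * g _ - _)).
by rewrite addrC /GRing.scale/= mulr1.
Qed.

Variables (c : R) (G G1 G2 : R -> R) (x : m.-tuple R).
Hypotheses (dG : forall u : R, is_derive u 1 G (G1 u))
  (dG1 : forall u : R, is_derive u 1 G1 (G2 u)).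

Lemma grad_ridge l j :
  grad (ridge c G x) l j 0 = c * G1 (dot l (cvec x)) * tnth x j.
Proof. by rewrite mxE (derive_ridge _ _ _ _ dG) dot_delta mxE. Qed.

Lemma hess_ridge l j k :
  hess (ridge c G x) l j k = c * G2 (dot l (cvec x)) * tnth x j * tnth x k.
Proof.
rewrite mxE.
have -> : 'D_(delta_mx j 0) (ridge c G x) = ridge (c * tnth x j) G1 x.
  by apply/funext => l'; rewrite (derive_ridge _ _ _ _ dG) dot_delta mxE /ridge; ring.
by rewrite (derive_ridge _ _ _ _ dG1) dot_delta mxE; ring.
Qed.

(** On the segment from [l0] to [h + l0] this is the one-dimensional expansion:
    the second derivative is the Hessian evaluated twice at [h], a sum of
    [m ^+ 2] terms, and the ball is convex. *)
Lemma ridge_expansion (l0 : 'cV[R]_m) (r F : R) :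
  (forall l, `|l - l0| < r -> `|hess (ridge c G x) l| <= F) ->
  forall h, `|h| < r ->
  `|ridge c G x (h + l0) - ridge c G x l0 -
    c * G1 (dot l0 (cvec x)) * dot h (cvec x)| <= m%:R ^+ 2 * F * `|h| ^+ 2.
Proof.
move=> hF h hr.
pose u := dot l0 (cvec x); pose e := dot h (cvec x).
have := @taylor1_bound R (fun t => c * G (u + t * e)) (fun t => c * G1 (u + t * e) * e)
  (fun t => c * e * G2 (u + t * e) * e) 1 (m%:R ^+ 2 * F * `|h| ^+ 2).
rewrite !mul1r !mul0r !addr0 expr1n !mulr1 /ridge dotD [dot h _ + _]addrC; apply.
- by move=> t _; exact: is_derive_line.
- move=> t _.
  have -> : (fun t => c * G1 (u + t * e) * e) = fun t => (c * e) * G1 (u + t * e).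
    by apply/funext => s; rewrite mulrAC.
  exact: is_derive_line.
move=> t; rewrite normr1 => t1.
have tF : `|hess (ridge c G x) (t *: h + l0)| <= F.
  apply: hF; rewrite addrK normrZ; apply: le_lt_trans hr.
  by rewrite ler_piMl.
have F0 : 0 <= F by exact: le_trans tF.
have -> : c * e * G2 (u + t * e) * e =
    \sum_j \sum_k h j 0 * h k 0 * hess (ridge c G x) (t *: h + l0) j k.
  rewrite (_ : u + t * e = dot (t *: h + l0) (cvec x)); last first.
    by rewrite dotD dotZ addrC.
  rewrite /e dot_cvec.
  transitivity (\sum_j \sum_k c * (h j 0 * tnth x j) *
     G2 (dot (t *: h + l0) (cvec x)) * (h k 0 * tnth x k)).
    rewrite [c * _]mulr_sumr 2!mulr_suml; apply: eq_bigr => j _.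
    by rewrite mulr_sumr; apply: eq_bigr => k _.
  by apply: eq_bigr => j _; apply: eq_bigr => k _; rewrite hess_ridge; ring.
have term j k : `|h j 0 * h k 0 * hess (ridge c G x) (t *: h + l0) j k| <= F * `|h| ^+ 2.
  rewrite !normrM mulrC expr2; apply: ler_pM => //.
    exact: le_trans (norm_coord_le _ _ _) tF.
  by apply: ler_pM => //; exact: norm_coord_le.
apply: le_trans (ler_norm_sum _ _ _) _.
apply: (@le_trans _ _ (\sum_(j < m) \sum_(k < m) (F * `|h| ^+ 2))).
  apply: ler_sum => j _; apply: le_trans (ler_norm_sum _ _ _) _.
  by apply: ler_sum => k _; exact: term.
by rewrite !sumr_const !card_ord -mulrnA -[X in X <= _]mulr_natl natrM expr2 !mulrA.
Qed.

End ridge_functions.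

(** * Calculus of plug-in expansions *)

Section plug_in.
Context {R : realType} {m : nat} {d : measure_display} {T : measurableType d}.
Variables (P : probability T R) (l0 : 'cV[R]_m).
Variable hat : nat -> T -> 'cV[R]_m.
Hypothesis mhat : forall n j, measurable_fun setT (fun t => hat n t j 0).

Definition scaled_error n t : 'cV[R]_m := Num.sqrt n%:R *: (hat n t - l0).

Hypothesis tight_error : forall j, tightP P (fun n t => scaled_error n t j 0).

Lemma tight_lform (g : 'cV[R]_m) : tightP P (fun n t => lform g (scaled_error n t)).
Proof.
rewrite /lform; under eq_fun do under eq_fun do rewrite dotE.
apply: tightP_sum => j; apply: tightPM => //; exact: cvpr_tight (cvpr_cst P _).
Qed.

(** [A n] is a statistic evaluated at [l0], [B n] the same statistic evaluated
    at the estimator, and [F l] the limit of the statistic evaluated at [l].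
    The effect of plugging in the estimator is given by the differential of
    the limit. Stated for sequences, this relation is stable under the
    algebraic operations that build the second stage. *)
Definition delta_expansion (A B : nat -> T -> R) (F : 'cV[R]_m -> R) : Prop :=
  [/\ cvpr P A (F l0), forall n, measurable_fun setT (B n) &
      exists2 g, is_diff l0 F (lform g) &
        cvpr P (fun n t => Num.sqrt n%:R * (B n t - A n t) -
                           lform g (scaled_error n t)) 0].

Lemma eq_delta_expansion A B F A' B' F' : A =2 A' -> B =2 B' -> F =1 F' ->
  delta_expansion A B F -> delta_expansion A' B' F'.
Proof.
move=> hA hB hF.
have -> : A' = A by apply/funext => n; apply/funext => t; rewrite hA.
have -> : B' = B by apply/funext => n; apply/funext => t; rewrite hB.
by have -> : F' = F by apply/funext => l; rewrite hF.
Qed.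

Lemma lformDr (g g' v : 'cV[R]_m) : lform (g + g') v = lform g v + lform g' v.
Proof. by rewrite /lform !dotE -big_split; apply: eq_bigr => j _; rewrite mxE mulrDr. Qed.

Lemma lformZr a (g v : 'cV[R]_m) : lform (a *: g) v = a * lform g v.
Proof. by rewrite /lform !dotE mulr_sumr; apply: eq_bigr => j _; rewrite mxE mulrCA. Qed.

Lemma lform0 (v : 'cV[R]_m) : lform 0 v = 0.
Proof. by rewrite /lform dotE big1// => j _; rewrite mxE mulr0. Qed.

Lemma delta_expansion_tight A B F : delta_expansion A B F ->
  tightP P (fun n t => Num.sqrt n%:R * (B n t - A n t)).
Proof. by move=> [_ _ [g _ cg]]; exact: tightP_add (tight_lform g) cg. Qed.

Lemma sqrt_nat_mulVr (n : nat) (x : R) : (0 < n)%N ->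
  (Num.sqrt n%:R)^-1 * (Num.sqrt n%:R * x) = x.
Proof.
by move=> n0; rewrite mulKf// gt_eqF// sqrtr_gt0 ltr0n.
Qed.

Lemma tight_rescale (D : nat -> T -> R) :
  (forall n, measurable_fun setT (D n)) ->
  tightP P (fun n t => Num.sqrt n%:R * D n t) -> cvpr P D 0.
Proof.
move=> mD /(tight_div_cvpr0 (@sqrt_inv_cvg0 R)); apply: eq_cvpr => //.
by near=> n => t; rewrite sqrt_nat_mulVr//; near: n; exists 1%N.
Unshelve. all: by end_near. Qed.

Lemma delta_expansion_cvpr A B F : delta_expansion A B F -> cvpr P B (F l0).
Proof.
move=> h; have [cA mB _] := h.
have mA n := cvpr_measurable cA n.
have c0 : cvpr P (fun n t => B n t - A n t) 0.
  apply: tight_rescale (delta_expansion_tight h) => n; exact: measurable_funB.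
have := cvprD cA c0; rewrite addr0; congr cvpr.
by apply/funext => n; apply/funext => t; rewrite addrC subrK.
Qed.

Lemma delta_expansion_cst c :
  delta_expansion (fun _ _ => c) (fun _ _ => c) (fun _ => c).
Proof.
split=> [|n|]; [exact: cvpr_cst|exact: measurable_cst|exists 0].
  apply: is_diff_eq (is_diff_cst c l0) _; apply/funext => v.
  by rewrite lform0.
have := cvpr_cst P 0; congr cvpr; apply/funext => n; apply/funext => t.
by rewrite subrr mulr0 lform0 subr0.
Qed.

Lemma delta_expansionD A B F A' B' F' :
  delta_expansion A B F -> delta_expansion A' B' F' ->
  delta_expansion (fun n t => A n t + A' n t) (fun n t => B n t + B' n t)
    (fun l => F l + F' l).
Proof.
move=> [cA mB [g dF cg]] [cA' mB' [g' dF' cg']].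
split; [exact: cvprD|by move=> n; exact: measurable_funD|].
exists (g + g').
  by apply: is_diff_eq (is_diffD dF dF') _; apply/funext => v; rewrite lformDr.
have := cvprD cg cg'; rewrite addr0; congr cvpr.
by apply/funext => n; apply/funext => t; rewrite lformDr; ring.
Qed.

(** Product rule: split [B B' - A A'] as [(B - A) B' + A (B' - A')] and replace
    the outer factors [B'] and [A] by their limits. *)
Lemma delta_expansionM A B F A' B' F' :
  delta_expansion A B F -> delta_expansion A' B' F' ->
  delta_expansion (fun n t => A n t * A' n t) (fun n t => B n t * B' n t)
    (fun l => F l * F' l).
Proof.
move=> h h'; have cB' := delta_expansion_cvpr h'.
have [cA mB [g dF cg]] := h; have [cA' mB' [g' dF' cg']] := h'.
split; [exact: cvprM|by move=> n; exact: measurable_funM|].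
exists (F l0 *: g' + F' l0 *: g).
  apply: is_diff_eq (is_diffM dF dF') _; apply/funext => v.
  by rewrite lformDr !lformZr.
have e1 := cvpr0_tightM cg (cvpr_tight cB').
have e2 := cvpr0_tightM ((cvpr_subr0 P _ _).1 cB') (tight_lform g).
have e3 := cvpr0_tightM cg' (cvpr_tight cA).
have e4 := cvpr0_tightM ((cvpr_subr0 P _ _).1 cA) (tight_lform g').
have := cvprD (cvprD e1 e2) (cvprD e3 e4); rewrite !addr0; congr cvpr.
apply/funext => n; apply/funext => t; rewrite lformDr !lformZr; ring.
Qed.

Lemma delta_expansionB A B F A' B' F' :
  delta_expansion A B F -> delta_expansion A' B' F' ->
  delta_expansion (fun n t => A n t - A' n t) (fun n t => B n t - B' n t)
    (fun l => F l - F' l).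
Proof.
move=> h h'.
apply: eq_delta_expansion (delta_expansionD h (delta_expansionM (delta_expansion_cst (-1)) h'));
  by do ?move=> ?; rewrite mulN1r.
Qed.

Lemma delta_expansionX A B F k : delta_expansion A B F ->
  delta_expansion (fun n t => A n t ^+ k) (fun n t => B n t ^+ k)
    (fun l => F l ^+ k).
Proof.
move=> h; elim: k => [|k ih].
  by apply: eq_delta_expansion (delta_expansion_cst 1); do ?move=> ?; rewrite expr0.
by apply: eq_delta_expansion (delta_expansionM h ih); do ?move=> ?; rewrite exprS.
Qed.

Lemma is_diff_inv (F : 'cV[R]_m -> R) g : F l0 != 0 -> is_diff l0 F (lform g) ->
  is_diff l0 (fun l => (F l)^-1) (lform (- (F l0) ^- 2 *: g)).
Proof.
move=> F0 [dF dE]; apply: DiffDef; first exact: differentiableV.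
by rewrite diffV// dE; apply/funext => v; rewrite lformZr.
Qed.

(** Quotient rule, from [B^-1 - A^-1 = - (B - A) / (A B)], which is valid off the
    rare event that [A] or [B] vanishes. *)
Lemma delta_expansionV A B F : F l0 != 0 -> delta_expansion A B F ->
  delta_expansion (fun n t => (A n t)^-1) (fun n t => (B n t)^-1)
    (fun l => (F l)^-1).
Proof.
move=> F0 h; have cB := delta_expansion_cvpr h.
have [cA mB [g dF cg]] := h; have mA n := cvpr_measurable cA n.
split; [exact: cvprV|by move=> n; exact: measurable_fun_inv|].
exists (- (F l0) ^- 2 *: g); first exact: is_diff_inv.
have cI : cvpr P (fun n t => (A n t)^-1 * (B n t)^-1) ((F l0) ^- 2).
  by rewrite expr2 invfM; apply: cvprM; exact: cvprV.
have e1 := cvpr0_tightM cg (cvpr_tight cI).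
have e2 := cvpr0_tightM ((cvpr_subr0 P _ _).1 cI) (tight_lform g).
have mL n : measurable_fun setT (fun t => lform g (scaled_error n t)).
  by case: (tight_lform g).
have e := cvprZ (-1) (cvprD e1 e2); rewrite addr0 mulr0 in e.
apply: cvpr_near (e) => [n|].
  apply: measurable_funB.
    by apply: measurable_funM => //; apply: measurable_funB; exact: measurable_fun_inv.
  by under eq_fun do rewrite lformZr; exact: measurable_funM.
apply: rareS (rareU (rare_eq0 F0 cA) (rare_eq0 F0 cB)).
  move=> n; have m1 := cvpr_measurable e n.
  rewrite -[X in measurable X]setCK; apply: measurableC.
  rewrite (_ : ~` _ = [set t | -1 * ((Num.sqrt n%:R * (B n t - A n t) - lform g (scaled_error n t)) *
     ((A n t)^-1 * (B n t)^-1) + ((A n t)^-1 * (B n t)^-1 - F l0 ^- 2) * lform g (scaled_error n t)) -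
     (Num.sqrt n%:R * ((B n t)^-1 - (A n t)^-1) - lform (- F l0 ^- 2 *: g) (scaled_error n t)) = 0]).
    apply: measurable_eqc; apply: measurable_funB => //.
    apply: measurable_funB.
      by apply: measurable_funM => //; apply: measurable_funB; exact: measurable_fun_inv.
    by under eq_fun do rewrite lformZr; exact: measurable_funM.
  apply/seteqP; split => t /=; first by move=> /contrapT ->; rewrite subrr.
  by move=> /eqP; rewrite subr_eq0 => /eqP h1; apply.
apply: nearW => n t /= h1; apply: contrapT => /not_orP[/eqP A0 /eqP B0].
apply: h1; rewrite lformZr.
have -> : (B n t)^-1 - (A n t)^-1 = - (B n t - A n t) * ((A n t)^-1 * (B n t)^-1).
  by field; rewrite ?A0 ?B0.
ring.
Qed.

End plug_in.

(** * Plug-in expansion of averages *)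

Section plug_in_averages.
Context {R : realType} {m : nat} {d0 d : measure_display}
  {T0 : measurableType d0} {T : measurableType d}.
Variables (Q : probability T0 R) (Z0 : T0 -> obs R m).
Variables (P : probability T R) (Z : nat -> T -> obs R m).
Hypotheses (mZ0 : measurable_fun setT Z0) (iidZ : iid_copies Q Z0 P Z).
Variables (l0 : 'cV[R]_m) (hat : nat -> T -> 'cV[R]_m).
Hypothesis mhat : forall n j, measurable_fun setT (fun t => hat n t j 0).
Hypothesis tight_error : forall j, tightP P (fun n t => scaled_error l0 hat n t j 0).

Variables (c : obs R m -> R) (G G1 G2 : R -> R).
Hypothesis mc : measurable_fun setT c.
Hypotheses (dG : forall u : R, is_derive u 1 G (G1 u))
  (dG1 : forall u : R, is_derive u 1 G1 (G2 u)).
Let s l (z : obs R m) := ridge (c z) G z.1 l.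
Hypothesis doms : dominated Q Z0 l0 s.

Lemma measurable_ridge l : measurable_fun setT (s l).
Proof.
apply: measurable_funM => //.
exact: (measurableT_comp (derive_measurable dG) (measurable_etaX l)).
Qed.

(** The [j]-th partial derivative of [s] at [l0]. *)
Let slope j (z : obs R m) := c z * G1 (etaX l0 z) * tnth z.1 j.

Let measurable_slope j : measurable_fun setT (slope j).
Proof.
apply: measurable_funM.
  apply: measurable_funM => //.
  exact: (measurableT_comp (derive_measurable dG1) (measurable_etaX l0)).
have mt : measurable_fun setT (fun x : m.-tuple R => tnth x j) by exact: measurable_tnth.
exact: (measurableT_comp mt measurable_fst).
Qed.

Let domination : exists F r,
  [/\ 0 < r, measurable_fun setT F, L1 Q (F \o Z0) & forall z, 0 <= F z] /\
  [/\ forall l z, `|l - l0| < r -> `|s l z| <= F z,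
   forall j z, `|slope j z| <= F z &
  (forall h z, `|h| < r -> `|s (h + l0) z - s l0 z -
      \sum_j h j 0 * slope j z| <= m%:R ^+ 2 * F z * `|h| ^+ 2)].
Proof.
have [F [mF F1 /nbhs_ballP[r /= r0 near_l0]]] := doms.
have bd l z : `|l - l0| < r -> [/\ `|s l z| <= F z, `|grad (s ^~ z) l| <= F z
            & `|hess (s ^~ z) l| <= F z].
  by move=> lr; apply: near_l0; rewrite -ball_normE/= distrC.
have r00 : `|l0 - l0| < r by rewrite subrr normr0.
exists F, r; split; split => //.
- by move=> z; have [h _ _] := bd l0 z r00; exact: le_trans h.
- by move=> l z /bd-/(_ z)[].
- move=> j z; have [_ h _] := bd l0 z r00; apply: le_trans h.
  by rewrite /slope /etaX -(grad_ridge _ _ dG); exact: norm_coord_le.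
move=> h z hr.
have := @ridge_expansion R m (c z) G G1 G2 z.1 dG dG1 l0 r (F z) _ h hr.
rewrite [dot h _]dot_cvec mulr_sumr.
under [X in _ - _ - X]eq_bigr do rewrite mulrCA.
apply => l lr; by have [_ _ ] := bd l z lr.
Qed.

Lemma L1_ridge : \forall l \near l0, L1 Q (s l \o Z0).
Proof.
have [F [r [[r0 mF F1 F0] [sF _ _]]]] := domination.
apply/nbhs_ballP; exists r => //= l; rewrite -ball_normE/= distrC => lr.
apply: L1_le F1 => [|t]; first exact: (measurableT_comp (measurable_ridge l)).
exact: sF.
Qed.

(** The expansion of averages to which the algebraic rules are applied: the
    remainder of the expansion in [l] has an integrable bound that is uniform
    over a ball, and the slopes obey the law of large numbers. *)
Lemma delta_expansion_avg : delta_expansion P l0 hat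
  (avg Z (s l0)) (fun n t => avg Z (s (hat n t)) n t)
  (fun l => PP Q Z0 (s l)).
Proof.
have [F [r [[r0 mF F1 F0] [sF DF ex]]]] := domination.
have s1 l : `|l - l0| < r -> L1 Q (s l \o Z0).
  move=> lr; apply: L1_le F1 => [|t]; first exact: (measurableT_comp (measurable_ridge l)).
  exact: sF.
have r00 : `|l0 - l0| < r by rewrite subrr normr0.
have D1 j : L1 Q (slope j \o Z0).
  by apply: L1_le F1 => [|t]; [exact: (measurableT_comp (measurable_slope j))|exact: DF].
have mB n : measurable_fun setT (fun t => avg Z (s (hat n t)) n t).
  apply: measurable_funM => //; apply: measurable_sum => i.
  apply: measurable_funM; first exact: (measurableT_comp mc (iid_measurable iidZ i)).
  apply: (measurableT_comp (derive_measurable dG)).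
  under eq_fun do rewrite dot_cvec.
  by apply: measurable_sum => j; apply: measurable_funM => //; exact: (measurable_Z_x iidZ).
split=> //; first by rewrite PPE; apply: (wlln mZ0 iidZ); [exact: measurable_ridge|exact: s1].
pose g : 'cV[R]_m := \col_j mean Q (slope j \o Z0).
exists g.
  apply: (@is_diff_quadratic _ _ _ _ _ (m%:R ^+ 2 * mean Q (F \o Z0)) r) => // h hr.
  have sh : L1 Q (s (h + l0) \o Z0) by apply: s1; rewrite addrK.
  have hD1 : L1 Q (fun t => \sum_j h j 0 * slope j (Z0 t)).
    by apply: L1_sum => j; apply: L1Z; exact: (D1 j).
  have -> : PP Q Z0 (s (h + l0)) - PP Q Z0 (s l0) - lform g h =
      mean Q (fun t => s (h + l0) (Z0 t) - s l0 (Z0 t) - \sum_j h j 0 * slope j (Z0 t)).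
    rewrite meanB//; last by apply: L1B => //; exact: s1.
    rewrite meanB//; last exact: s1.
    rewrite !PPE mean_sum; last by move=> j; apply: L1Z; exact: (D1 j).
    congr (_ - _); rewrite /lform dotE; apply: eq_bigr => j _.
    by rewrite mxE meanZ//; exact: (D1 j).
  have bF : L1 Q (fun t => m%:R ^+ 2 * `|h| ^+ 2 * F (Z0 t)) by exact: L1Z.
  apply: le_trans (norm_mean_le _ bF _) _.
  - by apply: L1B => //; apply: L1B => //; exact: s1.
  - by move=> t; apply: le_trans (ex h _ hr) _; rewrite mulrAC.
  - by rewrite meanZ// mulrAC.
have cF := wlln mZ0 iidZ mF F1.
pose delta n t j := hat n t j 0 - l0 j 0.
have eE n t j : scaled_error l0 hat n t j 0 = Num.sqrt n%:R * delta n t j.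
  by rewrite !mxE.
have cdelta j : cvpr P (fun n t => delta n t j) 0.
  apply: tight_rescale => [n|]; first exact: measurable_funB.
  by have := tight_error j; under eq_fun do under eq_fun do rewrite eE.
have csq : cvpr P (fun n t => \sum_j delta n t j ^+ 2) 0.
  have := cvpr_sum (index_enum 'I_m) (fun j => cvprX 2 (cdelta j)).
  by rewrite big1// => j _; rewrite expr0n.
have cslope : cvpr P (fun n t => \sum_j (avg Z (slope j) n t - g j 0) *
    scaled_error l0 hat n t j 0) 0.
  have h j : cvpr P (fun n t => (avg Z (slope j) n t - g j 0) *
      scaled_error l0 hat n t j 0) 0.
    apply: cvpr0_tightM (tight_error j); rewrite mxE.
    by apply: (cvpr_subr0 P _ _).1; apply: (wlln mZ0 iidZ).
  by have := cvpr_sum (index_enum 'I_m) h; rewrite big1.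
have crem : cvpr P (fun n t => (m%:R ^+ 2 * \sum_j delta n t j * scaled_error l0 hat n t j 0) *
    avg Z F n t) 0.
  apply: cvpr0_tightM (cvpr_tight cF); rewrite -[X in cvpr _ _ X](mulr0 (m%:R ^+ 2)).
  apply: cvprZ.
  have h j : cvpr P (fun n t => delta n t j * scaled_error l0 hat n t j 0) 0.
    exact: cvpr0_tightM.
  by have := cvpr_sum (index_enum 'I_m) h; rewrite big1.
pose rem n t := Num.sqrt n%:R * (avg Z (s (hat n t)) n t - avg Z (s l0) n t -
   \sum_j delta n t j * avg Z (slope j) n t).
have mrem n : measurable_fun setT (rem n).
  apply: measurable_funM => //; apply: measurable_funB.
    apply: measurable_funB => //; apply: (measurable_avg iidZ); exact: measurable_ridge.
  apply: measurable_sum => j; apply: measurable_funM; first exact: measurable_funB.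
  by apply: (measurable_avg iidZ).
have crm : cvpr P rem 0.
  (* off this rare event the estimator lies in the ball of domination *)
  have [_ /(_ (r ^+ 2) (exprn_gt0 2 r0)) far] := csq.
  apply: (cvpr0_le mrem far _ crem); apply: nearW => n t /=.
  move=> /negP; rewrite -ltNge subr0 => close.
  set h := hat n t - l0.
  have hj j : h j 0 = delta n t j by rewrite !mxE.
  have h2 : `|h| ^+ 2 <= \sum_j delta n t j ^+ 2.
    by apply: le_trans (norm_col_sqr h) _; apply: ler_sum => j _; rewrite hj.
  have hr : `|h| < r.
    rewrite -(ltr_pXn2r (n := 2)) ?nnegrE// ?ltW//.
    by apply: le_lt_trans close; apply: le_trans (ler_norm _).
  have avg_rem : avg Z (s (hat n t)) n t - avg Z (s l0) n t -
      \sum_j delta n t j * avg Z (slope j) n t =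
      n%:R^-1 * \sum_(i < n) (s (h + l0) (Z i t) - s l0 (Z i t) -
         \sum_j h j 0 * slope j (Z i t)).
    rewrite /h subrK !sumrB 2!mulrBr; congr (_ - _).
    rewrite exchange_big mulr_sumr; apply: eq_bigr => j _ /=.
    by rewrite -mulr_sumr mulrCA hj.
  have avgF0 : 0 <= avg Z F n t by rewrite mulr_ge0 ?invr_ge0// sumr_ge0.
  rewrite /rem avg_rem normrM ger0_norm ?sqrtr_ge0//.
  have sumE : \sum_j delta n t j * scaled_error l0 hat n t j 0 =
      Num.sqrt n%:R * \sum_j delta n t j ^+ 2.
    by rewrite mulr_sumr; apply: eq_bigr => j _; rewrite eE; ring.
  apply: le_trans (ler_norm _); rewrite sumE [_ ^+ 2 * (_ * _)]mulrCA -[leRHS]mulrA ler_wpM2l ?sqrtr_ge0//.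
  apply: (@le_trans _ _ (m%:R ^+ 2 * `|h| ^+ 2 * avg Z F n t)); last first.
    by rewrite ler_wpM2r// ler_wpM2l// exprn_ge0.
  rewrite normrM ger0_norm ?invr_ge0// mulrCA ler_wpM2l ?invr_ge0//.
  apply: le_trans (ler_norm_sum _ _ _) _; rewrite mulr_sumr.
  by apply: ler_sum => i _; apply: le_trans (ex h _ hr) _; rewrite mulrAC.
have := cvprD crm cslope; rewrite addr0; congr cvpr.
apply/funext => n; apply/funext => t; rewrite /rem /lform dotE mulrBr -addrA.
congr (_ + _); rewrite mulr_sumr addrC -sumrB -sumrN; apply: eq_bigr => j _.
by rewrite eE; ring.
Qed.

End plug_in_averages.

(** * Weighted averages *)

Section twice_differentiable.
Context {R : realType}.
Implicit Types G H : R -> R.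

(** Pointwise derivatives, in the form that Taylor bounds consume. *)
Definition twice_differentiable G : Prop := exists G1 G2 : R -> R,
  (forall u : R, is_derive u 1 G (G1 u)) /\ (forall u : R, is_derive u 1 G1 (G2 u)).

Let is_derive_mul G G1 H H1 : (forall u : R, is_derive u 1 G (G1 u)) ->
  (forall u : R, is_derive u 1 H (H1 u)) ->
  forall u : R, is_derive u 1 (fun u => G u * H u) (G1 u * H u + G u * H1 u).
Proof.
move=> dG dH u; have [h1 h2] := is_deriveM (dG u) (dH u).
apply: DeriveDef; first exact: h1.
by rewrite [LHS]h2 addrC /GRing.scale/= [H u * _]mulrC.
Qed.

Let is_derive_add G G1 H H1 : (forall u : R, is_derive u 1 G (G1 u)) ->
  (forall u : R, is_derive u 1 H (H1 u)) ->
  forall u : R, is_derive u 1 (fun u => G u + H u) (G1 u + H1 u).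
Proof.
move=> dG dH u; have [h1 h2] := is_deriveD (dG u) (dH u).
by apply: DeriveDef; [exact: h1|exact: h2].
Qed.

Lemma twice_differentiableM G H : twice_differentiable G ->
  twice_differentiable H -> twice_differentiable (fun u => G u * H u).
Proof.
move=> [G1 [G2 [dG dG1]]] [H1 [H2 [dH dH1]]].
exists (fun u => G1 u * H u + G u * H1 u).
exists (fun u => (G2 u * H u + G1 u * H1 u) + (G1 u * H1 u + G u * H2 u)).
by split; [exact: is_derive_mul|apply: is_derive_add; exact: is_derive_mul].
Qed.

Lemma twice_differentiable_exp k : twice_differentiable (fun u : R => u ^+ k).
Proof.
elim: k => [|k ih].
  by exists (fun=> 0), (fun=> 0); split => u; exact: is_derive_cst.
rewrite (_ : (fun u => _) = fun u : R => u * u ^+ k); last first.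
  by apply/funext => u; rewrite exprS.
apply: twice_differentiableM ih.
by exists (fun=> 1), (fun=> 0); split => u; [exact: is_derive_id|exact: is_derive_cst].
Qed.

Lemma twice_differentiable_weight G : twice_continuously_differentiable G ->
  twice_differentiable G.
Proof.
move=> [d1 d2 _]; exists (G^`())%classic, ((G^`())^`())%classic.
by split=> u; [rewrite (derive1E G)|rewrite (derive1E (G^`())%classic)];
   apply: DeriveDef.
Qed.

End twice_differentiable.

Section weighted_averages.
Context {R : realType} {m : nat} {d0 d : measure_display}
  {T0 : measurableType d0} {T : measurableType d}.
Variables (Q : probability T0 R) (Z0 : T0 -> obs R m).
Variables (P : probability T R) (Z : nat -> T -> obs R m).
Hypotheses (mZ0 : measurable_fun setT Z0) (iidZ : iid_copies Q Z0 P Z).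
Variables (w : R -> R) (l0 : 'cV[R]_m) (hat : nat -> T -> 'cV[R]_m).
Hypothesis mhat : forall n j, measurable_fun setT (fun t => hat n t j 0).
Hypothesis tight_error : forall j, tightP P (fun n t => scaled_error l0 hat n t j 0).

(** The normalizations cancel, also for the empty sample, where both sides are
    [0 / 0]. *)
Lemma Pnw_avg n t (l : 'cV[R]_m) f : Pnw w n (Z ^~ t) l f =
  avg Z (fun z => f z * w (etaX l z)) n t / avg Z (fun z => w (etaX l z)) n t.
Proof.
rewrite /Pnw /avg; have [->|n0] := eqVneq n 0%N; first by rewrite big_ord0 !(mul0r, mulr0).
by rewrite -mulf_div divff ?mul1r// invr_eq0 pnatr_eq0.
Qed.

(** The weighted versions of such families are, for a fixed observation,
    functions of the linear predictor alone, so that the expansion of averages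
    applies to them. *)
Definition smooth_family (f : 'cV[R]_m -> obs R m -> R) : Prop :=
  exists c G, [/\ measurable_fun setT c, twice_differentiable G,
    forall l z, f l z * w (etaX l z) = ridge (c z) G z.1 l &
    dominated Q Z0 l0 (fun l z => f l z * w (etaX l z))].

Lemma smooth_family_avg f : smooth_family f ->
  [/\ delta_expansion P l0 hat
    (avg Z (fun z => f l0 z * w (etaX l0 z)))
    (fun n t => avg Z (fun z => f (hat n t) z * w (etaX (hat n t) z)) n t)
    (fun l => PP Q Z0 (fun z => f l z * w (etaX l z))),
    forall l, measurable_fun setT (fun z => f l z * w (etaX l z)) &
    \forall l \near l0, L1 Q (fun t => f l (Z0 t) * w (etaX l (Z0 t)))].
Proof.
move=> [c [G [mc [G1 [G2 [dG dG1]]] fE]]].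
have -> : f = fun l z => f l z by [].
have E : (fun l z => f l z * w (etaX l z)) = fun l z => ridge (c z) G z.1 l.
  by apply/funext => l; apply/funext => z; rewrite fE.
have E' l : (fun z => f l z * w (etaX l z)) = fun z => ridge (c z) G z.1 l.
  by apply/funext => z; rewrite fE.
rewrite E => dom; split.
- apply: eq_delta_expansion (delta_expansion_avg mZ0 iidZ mhat tight_error mc dG dG1 dom).
  + by move=> n t; rewrite E'.
  + by move=> n t; rewrite E'.
  + by move=> l; rewrite E'.
- by move=> l; rewrite E'; exact: (measurable_ridge mc dG).
- apply: filterS (L1_ridge mZ0 mc dG dG1 dom) => l.
  by apply: eq_L1 => t /=; rewrite fE.
Qed.

Hypothesis weight_family : smooth_family (fun _ _ => 1).
Hypothesis Pw_neq0 : PP Q Z0 (fun z => w (etaX l0 z)) != 0.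

Lemma mul1w l : (fun z : obs R m => 1 * w (etaX l z)) = fun z => w (etaX l z).
Proof. by apply/funext => z; rewrite mul1r. Qed.

Lemma delta_expansion_Pnw f : smooth_family f ->
  delta_expansion P l0 hat
    (fun n t => Pnw w n (Z ^~ t) l0 (f l0))
    (fun n t => Pnw w n (Z ^~ t) (hat n t) (f (hat n t)))
    (fun l => Pw Q Z0 w l (f l)).
Proof.
move=> /smooth_family_avg[ef _ _]; have [ew _ _] := smooth_family_avg weight_family.
apply: eq_delta_expansion (delta_expansionM tight_error ef (delta_expansionV tight_error _ ew)).
- by move=> n t; rewrite Pnw_avg mul1w.
- by move=> n t; rewrite Pnw_avg mul1w.
- by move=> l; rewrite /Pw mul1w.
- by rewrite mul1w.
Qed.

(** A limit function with an expansion is differentiable, hence continuous. *)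
Lemma near_neq0 A B (F : 'cV[R]_m -> R) : delta_expansion P l0 hat A B F ->
  F l0 != 0 -> \forall l \near l0, F l != 0.
Proof.
move=> [_ _ [g [dF _] _]] F0.
have := differentiable_continuous dF => /cvgr_neq0; exact.
Qed.

Lemma Pnw_plim f : smooth_family f ->
  \forall l \near l0, cvpr P (fun n t => Pnw w n (Z ^~ t) l (f l)) (Pw Q Z0 w l (f l)).
Proof.
move=> /smooth_family_avg[ef mf f1]; have [ew mw w1] := smooth_family_avg weight_family.
have w0 : \forall l \near l0, PP Q Z0 (fun z => 1 * w (etaX l z)) != 0.
  by apply: (near_neq0 ew); rewrite mul1w.
near=> l.
have -> : (fun n t => Pnw w n (Z ^~ t) l (f l)) = fun n t =>
    avg Z (fun z => f l z * w (etaX l z)) n t * (avg Z (fun z => 1 * w (etaX l z)) n t)^-1.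
  by apply/funext => n; apply/funext => t; rewrite Pnw_avg mul1w.
have -> : Pw Q Z0 w l (f l) = PP Q Z0 (fun z => f l z * w (etaX l z)) *
    (PP Q Z0 (fun z => 1 * w (etaX l z)))^-1 by rewrite mul1w.
apply: cvprM; first by rewrite PPE; apply: (wlln mZ0 iidZ) => //; near: l.
apply: cvprV; first by near: l.
by rewrite PPE; apply: (wlln mZ0 iidZ) => //; near: l.
Unshelve. all: by end_near. Qed.

End weighted_averages.

(** * Coefficients of the second stage *)

Section coefficients_of_the_second_stage.
Context {R : realType} {m : nat} {d0 d : measure_display}
  {T0 : measurableType d0} {T : measurableType d}.
Variables (Q : probability T0 R) (Z0 : T0 -> obs R m).
Variables (P : probability T R) (Z : nat -> T -> obs R m).
Hypotheses (mZ0 : measurable_fun setT Z0) (iidZ : iid_copies Q Z0 P Z).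
Variables (w : R -> R) (h : m.-tuple R -> R) (l0 : 'cV[R]_m).
Hypothesis w_smooth : twice_continuously_differentiable w.
Hypothesis reg : regularity Q Z0 w h l0.
Variable hat : nat -> T -> 'cV[R]_m.
Hypothesis mhat : forall n j, measurable_fun setT (fun t => hat n t j 0).
Hypothesis tight_error : forall j, tightP P (fun n t => scaled_error l0 hat n t j 0).

Local Notation M n t := (Pnw w n (Z ^~ t)).
Local Notation Plim := (Pw Q Z0 w).
Local Notation expands c :=
  (delta_expansion P l0 hat (fun n t => c (M n t) l0) (fun n t => c (M n t) (hat n t)) (c Plim)).
Local Notation has_plim c :=
  (\forall l \near l0, cvpr P (fun n t => c (M n t) l) (c Plim l)).

Lemma smooth_eta k : (k <= 4)%N -> smooth_family Q Z0 w l0 (fun l z => etaX l z ^+ k).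
Proof.
move=> /(reg_eta reg) dom; exists (fun=> 1), (fun u => w u * u ^+ k); split.
- exact: measurable_cst.
- apply: twice_differentiableM; first exact: twice_differentiable_weight.
  exact: twice_differentiable_exp.
- by move=> l z; rewrite /ridge mul1r mulrC.
- congr dominated : dom; apply/funext => l; apply/funext => z; exact: mulrC.
Qed.

Lemma smooth_etaY k : (k <= 2)%N ->
  smooth_family Q Z0 w l0 (fun l z => etaX l z ^+ k * z.2 ^+ 2).
Proof.
move=> /(reg_etaY reg) dom; exists (fun z => z.2 ^+ 2), (fun u => w u * u ^+ k); split.
- by apply: measurable_funX; exact: measurable_snd.
- apply: twice_differentiableM; first exact: twice_differentiable_weight.
  exact: twice_differentiable_exp.
- by move=> l z; rewrite /ridge /etaX; ring.
- congr dominated : dom; apply/funext => l; apply/funext => z; exact: mulrC.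
Qed.

Let eq_smooth f g : (forall l z, f l z = g l z) -> smooth_family Q Z0 w l0 f ->
  smooth_family Q Z0 w l0 g.
Proof. by move=> fg; have -> : f = g by apply/funext => l; apply/funext => z. Qed.

Lemma smooth_cst1 : smooth_family Q Z0 w l0 (fun _ _ => 1).
Proof. by apply: eq_smooth (smooth_eta (leq0n 4)) => l z; rewrite expr0. Qed.

Lemma smooth_eta1 : smooth_family Q Z0 w l0 (@etaX R m).
Proof. by apply: eq_smooth (@smooth_eta 1%N isT) => l z; rewrite expr1. Qed.

Lemma smooth_Y : smooth_family Q Z0 w l0 (fun _ z => z.2 ^+ 2).
Proof. by apply: eq_smooth (@smooth_etaY 0%N isT) => l z; rewrite expr0 mul1r. Qed.

Lemma smooth_eta1Y : smooth_family Q Z0 w l0 (fun l z => etaX l z * z.2 ^+ 2).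
Proof. by apply: eq_smooth (@smooth_etaY 1%N isT) => l z; rewrite expr1. Qed.

Let expansion f (sf : smooth_family Q Z0 w l0 f) :=
  delta_expansion_Pnw mZ0 iidZ mhat tight_error smooth_cst1 (reg_Pw reg) sf.
Let plim f (sf : smooth_family Q Z0 w l0 f) :=
  Pnw_plim mZ0 iidZ mhat tight_error smooth_cst1 (reg_Pw reg) sf.
Let expansionB := delta_expansionB tight_error.
Let expansionM := delta_expansionM tight_error.
Let expansionV := delta_expansionV tight_error.
Let expansionX := delta_expansionX tight_error.

Lemma expansion_a1 : expands a1.
Proof.
exact: (expansionB (expansion (@smooth_eta 4%N isT))
  (expansionX 2%N (expansion (@smooth_eta 2%N isT)))).
Qed.

Lemma expansion_a2 : expands a2.
Proof.
exact: (expansionB (expansion (@smooth_eta 3%N isT))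
  (expansionM (expansion smooth_eta1) (expansion (@smooth_eta 2%N isT)))).
Qed.

Lemma expansion_a3 : expands a3.
Proof.
exact: (expansionB (expansion (@smooth_eta 2%N isT))
  (expansionX 2%N (expansion smooth_eta1))).
Qed.

Lemma expansion_b1 : expands b1.
Proof.
exact: (expansionB (expansion smooth_eta1Y)
  (expansionM (expansion smooth_eta1) (expansion smooth_Y))).
Qed.

Lemma expansion_b2 : expands b2.
Proof.
exact: (expansionB (expansion (@smooth_etaY 2%N isT))
  (expansionM (expansion (@smooth_eta 2%N isT)) (expansion smooth_Y))).
Qed.

Lemma expansion_g3 : expands g3.
Proof.
exact: (expansionB (expansionM expansion_a1 expansion_a3) (expansionX 2%N expansion_a2)).
Qed.

Lemma expansion_lambda2 : expands lambda2.
Proof.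
exact: (expansionM (expansionB (expansionM expansion_a1 expansion_b1)
  (expansionM expansion_a2 expansion_b2)) (expansionV (reg_g3 reg) expansion_g3)).
Qed.

Lemma expansion_lambda3 : expands lambda3.
Proof.
exact: (expansionM (expansionB (expansionM expansion_a3 expansion_b2)
  (expansionM expansion_a2 expansion_b1)) (expansionV (reg_g3 reg) expansion_g3)).
Qed.

Lemma plim_a1 : has_plim a1.
Proof.
near=> l; apply: cvprB; first by near: l; exact: (plim (@smooth_eta 4%N isT)).
by apply: cvprX; near: l; exact: (plim (@smooth_eta 2%N isT)).
Unshelve. all: by end_near. Qed.

Lemma plim_a2 : has_plim a2.
Proof.
near=> l; apply: cvprB; first by near: l; exact: (plim (@smooth_eta 3%N isT)).
by apply: cvprM; near: l; [exact: (plim smooth_eta1)|exact: (plim (@smooth_eta 2%N isT))].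
Unshelve. all: by end_near. Qed.

Lemma plim_a3 : has_plim a3.
Proof.
near=> l; apply: cvprB; first by near: l; exact: (plim (@smooth_eta 2%N isT)).
by apply: cvprX; near: l; exact: (plim smooth_eta1).
Unshelve. all: by end_near. Qed.

Lemma plim_b1 : has_plim b1.
Proof.
near=> l; apply: cvprB; first by near: l; exact: (plim smooth_eta1Y).
by apply: cvprM; near: l; [exact: (plim smooth_eta1)|exact: (plim smooth_Y)].
Unshelve. all: by end_near. Qed.

Lemma plim_b2 : has_plim b2.
Proof.
near=> l; apply: cvprB; first by near: l; exact: (plim (@smooth_etaY 2%N isT)).
by apply: cvprM; near: l; [exact: (plim (@smooth_eta 2%N isT))|exact: (plim smooth_Y)].
Unshelve. all: by end_near. Qed.

Lemma plim_g3 : has_plim g3.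
Proof.
near=> l; apply: cvprB; last by apply: cvprX; near: l; exact: plim_a2.
by apply: cvprM; near: l; [exact: plim_a1|exact: plim_a3].
Unshelve. all: by end_near. Qed.

Lemma g3_near : \forall l \near l0, g3 Plim l != 0.
Proof. exact: (near_neq0 expansion_g3 (reg_g3 reg)). Qed.

Lemma plim_lambda2 : has_plim lambda2.
Proof.
near=> l; apply: cvprM.
  apply: cvprB; apply: cvprM; near: l;
    [exact: plim_a1|exact: plim_b1|exact: plim_a2|exact: plim_b2].
by apply: cvprV; near: l; [exact: g3_near|exact: plim_g3].
Unshelve. all: by end_near. Qed.

Lemma plim_lambda3 : has_plim lambda3.
Proof.
near=> l; apply: cvprM.
  apply: cvprB; apply: cvprM; near: l;
    [exact: plim_a3|exact: plim_b2|exact: plim_a2|exact: plim_b1].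
by apply: cvprV; near: l; [exact: g3_near|exact: plim_g3].
Unshelve. all: by end_near. Qed.

End coefficients_of_the_second_stage.

(** The second stage solves the two normal equations of the weighted regression
    of [Y ^+ 2] on [eta] and [eta ^+ 2]. If [Y ^+ 2] is a quadratic polynomial in
    [eta] plus a residual with weighted moments [r0], [r1], [r2], its solution is
    the pair of coefficients plus a linear function of the centered residual
    moments, by Cramer's rule. *)
Section normal_equations.
Context {R : realType} {m : nat}.
Variables (M : 'cV[R]_m -> (obs R m -> R) -> R) (l : 'cV[R]_m).
Variables (c e2 e3 r0 r1 r2 : R).
Local Notation M1 := (M l (etaX l)).
Local Notation M2 := (M l (fun z => etaX l z ^+ 2)).
Local Notation M3 := (M l (fun z => etaX l z ^+ 3)).
Local Notation M4 := (M l (fun z => etaX l z ^+ 4)).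
Hypotheses
  (eq0 : M l (fun z => z.2 ^+ 2) = c + e2 * M1 + e3 * M2 + r0)
  (eq1 : M l (fun z => etaX l z * z.2 ^+ 2) = c * M1 + e2 * M2 + e3 * M3 + r1)
  (eq2 : M l (fun z => etaX l z ^+ 2 * z.2 ^+ 2) = c * M2 + e2 * M3 + e3 * M4 + r2)
  (g3_neq0 : g3 M l != 0).

Lemma lambda2_residual : lambda2 M l =
  e2 + (a1 M l * (r1 - M1 * r0) - a2 M l * (r2 - M2 * r0)) / g3 M l.
Proof.
apply: (mulIf g3_neq0); rewrite mulrDl !divfK//.
by rewrite /g3 /a1 /a2 /a3 /b1 /b2 eq0 eq1 eq2; ring.
Qed.

Lemma lambda3_residual : lambda3 M l =
  e3 + (a3 M l * (r2 - M2 * r0) - a2 M l * (r1 - M1 * r0)) / g3 M l.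
Proof.
apply: (mulIf g3_neq0); rewrite mulrDl !divfK//.
by rewrite /g3 /a1 /a2 /a3 /b1 /b2 eq0 eq1 eq2; ring.
Qed.

End normal_equations.

(** * Scores of the second stage *)

Section scores.
Context {R : realType} {m : nat} {d0 d : measure_display}
  {T0 : measurableType d0} {T : measurableType d}.
Variables (Q : probability T0 R) (Z0 : T0 -> obs R m).
Variables (P : probability T R) (Z : nat -> T -> obs R m).
Hypotheses (mZ0 : measurable_fun setT Z0) (iidZ : iid_copies Q Z0 P Z).
Variables (w : R -> R) (h : m.-tuple R -> R) (l0 : 'cV[R]_m).
Hypothesis w_smooth : twice_continuously_differentiable w.
Hypothesis reg : regularity Q Z0 w h l0.
Variables c e2 e3 : R.

Local Notation M n t := (Pnw w n (Z ^~ t)).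
Local Notation Plim := (Pw Q Z0 w).

Definition weighted_residual k (z : obs R m) : R :=
  w (etaX l0 z) * etaX l0 z ^+ k *
  (z.2 ^+ 2 - (c + e2 * etaX l0 z + e3 * etaX l0 z ^+ 2)).
Local Notation wres := weighted_residual.

Lemma weight_measurable : measurable_fun setT w.
Proof.
have [dw _ _] := w_smooth.
apply: continuous_measurable_fun => x; apply: differentiable_continuous.
exact/derivable1_diffP.
Qed.

Lemma measurable_weight_eta l k :
  measurable_fun setT (fun z : obs R m => w (etaX l z) * etaX l z ^+ k).
Proof.
apply: measurable_funM; last by apply: measurable_funX; exact: measurable_etaX.
exact: (measurableT_comp weight_measurable (measurable_etaX l)).
Qed.

Lemma measurable_weighted_residual k : measurable_fun setT (wres k).
Proof.
apply: measurable_funM; first exact: measurable_weight_eta.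
apply: measurable_funB; first by apply: measurable_funX; exact: measurable_snd.
have meta := @measurable_etaX R m l0.
by apply: measurable_funD; [apply: measurable_funD => //|]; apply: measurable_funM => //;
   exact: measurable_funX.
Qed.

Hypothesis wres2 : forall k, (k <= 2)%N -> L2 Q (wres k \o Z0).
Hypothesis wres0 : forall k, (k <= 2)%N -> mean Q (wres k \o Z0) = 0.

(** Weighted averages are ratios of values of a linear functional [V]; dividing
    the decomposition of [Y ^+ 2] by the total weight gives the normal
    equations with a residual. *)
Lemma coefficients_residual (Mw : 'cV[R]_m -> (obs R m -> R) -> R) (V : (obs R m -> R) -> R) :
  (forall f, Mw l0 f = V (fun z => f z * w (etaX l0 z)) / V (fun z => w (etaX l0 z))) ->
  (forall k, (k <= 2)%N ->
    V (fun z => etaX l0 z ^+ k * z.2 ^+ 2 * w (etaX l0 z)) =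
    c * V (fun z => etaX l0 z ^+ k * w (etaX l0 z)) +
    e2 * V (fun z => etaX l0 z ^+ k.+1 * w (etaX l0 z)) +
    e3 * V (fun z => etaX l0 z ^+ k.+2 * w (etaX l0 z)) + V (wres k)) ->
  V (fun z => w (etaX l0 z)) != 0 -> g3 Mw l0 != 0 ->
  let r k := V (wres k) / V (fun z => w (etaX l0 z)) in
  let c1 := r 1%N - Mw l0 (etaX l0) * r 0%N in
  let c2 := r 2%N - Mw l0 (fun z => etaX l0 z ^+ 2) * r 0%N in
  lambda2 Mw l0 = e2 + (a1 Mw l0 * c1 - a2 Mw l0 * c2) / g3 Mw l0 /\
  lambda3 Mw l0 = e3 + (a3 Mw l0 * c2 - a2 Mw l0 * c1) / g3 Mw l0.
Proof.
move=> ME VE W0 g0 r c1 c2.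
have E k : (k <= 2)%N -> Mw l0 (fun z => etaX l0 z ^+ k * z.2 ^+ 2) =
    c * Mw l0 (fun z => etaX l0 z ^+ k) + e2 * Mw l0 (fun z => etaX l0 z ^+ k.+1) +
    e3 * Mw l0 (fun z => etaX l0 z ^+ k.+2) + r k.
  by move=> k2; rewrite !ME VE// /r; ring.
have E0 : Mw l0 (fun z => z.2 ^+ 2) =
    c + e2 * Mw l0 (etaX l0) + e3 * Mw l0 (fun z => etaX l0 z ^+ 2) + r 0%N.
  have := E 0%N isT.
  have -> : (fun z : obs R m => etaX l0 z ^+ 0 * z.2 ^+ 2) = fun z => z.2 ^+ 2.
    by apply/funext => z; rewrite expr0 mul1r.
  have -> : Mw l0 (fun z => etaX l0 z ^+ 0) = 1.
    rewrite ME; under eq_fun do rewrite expr0 mul1r.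
    exact: divff.
  by rewrite mulr1.
have E1 := E 1%N isT; have E2 := E 2%N isT.
by split; [exact: (lambda2_residual E0 E1 E2 g0)|exact: (lambda3_residual E0 E1 E2 g0)].
Qed.

Lemma L1_weighted_eta k : (k <= 4)%N ->
  L1 Q (fun t => etaX l0 (Z0 t) ^+ k * w (etaX l0 (Z0 t))).
Proof.
move=> k4; have [F [mF F1 /nbhs_singleton near_l0]] := reg_eta reg k4.
apply: L1_le F1 => [|t]; last by rewrite mulrC; have [] := near_l0 (Z0 t).
under eq_fun do rewrite mulrC.
exact: (measurableT_comp (measurable_weight_eta l0 k) mZ0).
Qed.

Let split_residual k : (fun z : obs R m => etaX l0 z ^+ k * z.2 ^+ 2 * w (etaX l0 z)) =
  fun z => c * (etaX l0 z ^+ k * w (etaX l0 z)) +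
    e2 * (etaX l0 z ^+ k.+1 * w (etaX l0 z)) +
    e3 * (etaX l0 z ^+ k.+2 * w (etaX l0 z)) + wres k z.
Proof. by apply/funext => z; rewrite /weighted_residual !exprS; ring. Qed.

Local Notation W n t := (avg Z (fun z => w (etaX l0 z)) n t).

Let emp_centered f n t : mean Q (f \o Z0) = 0 ->
  emp Q Z0 Z f n t = Num.sqrt n%:R * avg Z f n t.
Proof.
move=> f0; rewrite /emp /avg f0; under eq_bigr do rewrite subr0.
have [->|n0] := eqVneq n 0%N; first by rewrite !big_ord0 !mulr0.
rewrite mulrA; congr (_ * _).
have s0 : Num.sqrt (n%:R : R) != 0 by rewrite gt_eqF// sqrtr_gt0 ltr0n lt0n.
by rewrite -{3}[n%:R]sqr_sqrtr// expr2 invfM mulrA divff// mul1r.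
Qed.

(** The influence function of the residual part of a second-stage estimator,
    where [a] and [b] are the limits of the coefficients of the two centered
    residual moments. *)
Definition score (a b : R) (z : obs R m) : R :=
  (g3 Plim l0 * PP Q Z0 (fun z => w (etaX l0 z)))^-1 *
  (a * (wres 1 z - Plim l0 (etaX l0) * wres 0 z) +
   b * (wres 2 z - Plim l0 (fun z => etaX l0 z ^+ 2) * wres 0 z)).

Lemma measurable_score a b : measurable_fun setT (score a b).
Proof.
have mr := measurable_weighted_residual.
apply: measurable_funM => //; apply: measurable_funD; apply: measurable_funM => //;
  by apply: measurable_funB => //; exact: measurable_funM.
Qed.

Lemma L2_score a b : L2 Q (score a b \o Z0).
Proof.
apply: (@L2Z _ _ _ Q (g3 Plim l0 * PP Q Z0 (fun z => w (etaX l0 z)))^-1); apply: L2D; apply: L2Z;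
  by apply: L2B; [exact: wres2|apply: L2Z; exact: wres2].
Qed.

Let mean_score a b : mean Q (score a b \o Z0) = 0.
Proof.
have r1 k : (k <= 2)%N -> L1 Q (fun t => wres k (Z0 t)) by move=> k2; exact: L2_L1 (wres2 k2).
have z k : (k <= 2)%N -> mean Q (fun t => wres k (Z0 t)) = 0 by move=> k2; exact: wres0.
have l j x : (j <= 2)%N -> L1 Q (fun t => wres j (Z0 t) - x * wres 0%N (Z0 t)).
  by move=> j2; apply: L1B; [exact: r1|apply: L1Z; exact: r1].
have zl j x : (j <= 2)%N -> mean Q (fun t => wres j (Z0 t) - x * wres 0%N (Z0 t)) = 0.
  move=> j2; rewrite meanB; [|exact: r1|apply: L1Z; exact: r1].
  by rewrite meanZ ?z ?mulr0 ?subr0//; exact: r1.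
rewrite -[LHS]/(mean Q (fun t => _ * (a * (wres 1%N (Z0 t) - _ * wres 0%N (Z0 t)) +
  b * (wres 2%N (Z0 t) - _ * wres 0%N (Z0 t))))).
rewrite meanZ; last by apply: L1D; apply: L1Z; exact: l.
rewrite meanD; [|by apply: L1Z; exact: l|by apply: L1Z; exact: l].
by rewrite !meanZ ?zl ?mulr0 ?addr0 ?mulr0//; exact: l.
Qed.

Let avgD (f g : obs R m -> R) n t : avg Z (fun z => f z + g z) n t = avg Z f n t + avg Z g n t.
Proof. by rewrite /avg big_split mulrDr. Qed.

Let avgZ (k : R) (f : obs R m -> R) n t : avg Z (fun z => k * f z) n t = k * avg Z f n t.
Proof. by rewrite /avg -mulr_sumr mulrCA. Qed.

Let avgB (f g : obs R m -> R) n t : avg Z (fun z => f z - g z) n t = avg Z f n t - avg Z g n t.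
Proof. by rewrite /avg sumrB mulrBr. Qed.

Let avg_score a b n t : avg Z (score a b) n t =
  (g3 Plim l0 * PP Q Z0 (fun z => w (etaX l0 z)))^-1 *
  (a * (avg Z (wres 1) n t - Plim l0 (etaX l0) * avg Z (wres 0) n t) +
   b * (avg Z (wres 2) n t - Plim l0 (fun z => etaX l0 z ^+ 2) * avg Z (wres 0) n t)).
Proof. by rewrite /score avgZ avgD !avgZ !avgB !avgZ. Qed.

Let weight_cvg : cvpr P (fun n t => W n t) (PP Q Z0 (fun z => w (etaX l0 z))).
Proof.
rewrite PPE; apply: (wlln mZ0 iidZ).
  exact: (measurableT_comp weight_measurable (measurable_etaX l0)).
by apply: eq_L1 (L1_weighted_eta (leq0n 4)) => t; rewrite expr0 mul1r.
Qed.

Let tight_wres k : (k <= 2)%N -> tightP P (fun n t => Num.sqrt n%:R * avg Z (wres k) n t).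
Proof.
move=> k2; have := tight_emp mZ0 iidZ (measurable_weighted_residual k) (wres2 k2).
congr tightP; apply/funext => n; apply/funext => t.
by rewrite emp_centered ?wres0.
Qed.

(** The residual moments are of order [n^(-1/2)], so the random coefficients may
    be replaced by their limits. *)
Let residual_limit (A B M1 M2 g : nat -> T -> R) a b :
  cvpr P A a -> cvpr P B b -> cvpr P g (g3 Plim l0) ->
  cvpr P M1 (Plim l0 (etaX l0)) -> cvpr P M2 (Plim l0 (fun z => etaX l0 z ^+ 2)) ->
  cvpr P (fun n t => Num.sqrt n%:R *
     ((A n t * (avg Z (wres 1) n t / W n t - M1 n t * (avg Z (wres 0) n t / W n t)) +
       B n t * (avg Z (wres 2) n t / W n t - M2 n t * (avg Z (wres 0) n t / W n t))) / g n t) -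
     emp Q Z0 Z (score a b) n t) 0.
Proof.
move=> cA cB cg c1 c2.
have ck : cvpr P (fun n t => (g n t * W n t)^-1)
    (g3 Plim l0 * PP Q Z0 (fun z => w (etaX l0 z)))^-1.
  by apply: cvprV; [rewrite mulf_neq0 ?(reg_g3 reg) ?(reg_Pw reg)|exact: cvprM].
set kap := (_ * _)^-1 in ck.
have h1 := cvpr0_tightM ((cvpr_subr0 P _ _).1 (cvprM ck cA)) (tight_wres (isT : 1 <= 2)%N).
have h2 := cvpr0_tightM ((cvpr_subr0 P _ _).1 (cvprM ck cB)) (tight_wres (isT : 2 <= 2)%N).
have h0 := cvpr0_tightM ((cvpr_subr0 P _ _).1 (cvprM ck (cvprD (cvprM cA c1) (cvprM cB c2))))
  (tight_wres (isT : 0 <= 2)%N).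
have := cvprB (cvprD h1 h2) h0; rewrite addr0 subr0; congr cvpr.
apply/funext => n; apply/funext => t.
rewrite (emp_centered _ _ (mean_score a b)) avg_score -/kap invfM; ring.
Qed.

Let linear_empirical n t k :
  avg Z (fun z => etaX l0 z ^+ k * z.2 ^+ 2 * w (etaX l0 z)) n t =
    c * avg Z (fun z => etaX l0 z ^+ k * w (etaX l0 z)) n t +
    e2 * avg Z (fun z => etaX l0 z ^+ k.+1 * w (etaX l0 z)) n t +
    e3 * avg Z (fun z => etaX l0 z ^+ k.+2 * w (etaX l0 z)) n t + avg Z (wres k) n t.
Proof. by rewrite split_residual !avgD !avgZ. Qed.

Variable hat : nat -> T -> 'cV[R]_m.
Hypothesis mhat : forall n j, measurable_fun setT (fun t => hat n t j 0).
Hypothesis tight_error : forall j, tightP P (fun n t => scaled_error l0 hat n t j 0).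

Let at_truth f : smooth_family Q Z0 w l0 f ->
  cvpr P (fun n t => M n t l0 (f l0)) (Plim l0 (f l0)).
Proof.
move=> sf; exact: (nbhs_singleton (Pnw_plim mZ0 iidZ mhat tight_error (smooth_cst1 w_smooth reg)
  (reg_Pw reg) sf)).
Qed.

(** The exact formula for the second stage holds off the rare event that its
    denominators vanish. *)
Let residual_equal (F G : nat -> T -> R) :
  (forall n, measurable_fun setT (G n)) -> cvpr P F 0 ->
  (forall n t, W n t <> 0 -> g3 (M n t) l0 <> 0 -> F n t = G n t) -> cvpr P G 0.
Proof.
move=> mG cF FG; apply: cvpr_near (cF) => //.
have cg := nbhs_singleton (plim_g3 mZ0 iidZ w_smooth reg mhat tight_error).
apply: rareS (rareU (rare_eq0 (reg_Pw reg) weight_cvg) (rare_eq0 (reg_g3 reg) cg)).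
  move=> n; rewrite (_ : [set _ | _] = [set t | F n t - G n t <> 0]).
    by apply/measurable_neqc/measurable_funB => //; exact: (cvpr_measurable cF).
  by apply/seteqP; split => t /= h1 E; apply: h1; [apply/eqP; rewrite -subr_eq0 E|rewrite E subrr].
apply: nearW => n t /=; apply: contra_notP => /not_orP[W0 g0].
exact: FG.
Qed.

Lemma lambda2_at_truth :
  cvpr P (fun n t => Num.sqrt n%:R * (lambda2 (M n t) l0 - e2) -
    emp Q Z0 Z (score (a1 Plim l0) (- a2 Plim l0)) n t) 0.
Proof.
have ca1 := nbhs_singleton (plim_a1 mZ0 iidZ w_smooth reg mhat tight_error).
have ca2 := nbhs_singleton (plim_a2 mZ0 iidZ w_smooth reg mhat tight_error).
have cg := nbhs_singleton (plim_g3 mZ0 iidZ w_smooth reg mhat tight_error).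
have cl := nbhs_singleton (plim_lambda2 mZ0 iidZ w_smooth reg mhat tight_error).
have c1 := at_truth (smooth_eta1 w_smooth reg).
have c2 := at_truth (smooth_eta w_smooth reg (isT : 2 <= 4)%N).
have ca2N : cvpr P (fun n t => - a2 (M n t) l0) (- a2 Plim l0).
  by have := cvprZ (-1) ca2; rewrite mulN1r; under eq_fun do under eq_fun do rewrite mulN1r.
apply: (residual_equal _ (residual_limit ca1 ca2N cg c1 c2)).
  move=> n; apply: measurable_funB; last by apply: (measurable_emp iidZ); exact: measurable_score.
  by apply: measurable_funM => //; apply: measurable_funB => //; exact: (cvpr_measurable cl).
move=> n t /eqP W0 /eqP g0; congr (_ - _); congr (_ * _).
have [-> _] := @coefficients_residual (M n t) (fun f => avg Z f n t)
  (Pnw_avg Z w n t l0) (fun k _ => linear_empirical n t k) W0 g0.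
by rewrite mulNr [e2 + _]addrC addrK.
Qed.

Lemma lambda3_at_truth :
  cvpr P (fun n t => Num.sqrt n%:R * (lambda3 (M n t) l0 - e3) -
    emp Q Z0 Z (score (- a2 Plim l0) (a3 Plim l0)) n t) 0.
Proof.
have ca3 := nbhs_singleton (plim_a3 mZ0 iidZ w_smooth reg mhat tight_error).
have ca2 := nbhs_singleton (plim_a2 mZ0 iidZ w_smooth reg mhat tight_error).
have cg := nbhs_singleton (plim_g3 mZ0 iidZ w_smooth reg mhat tight_error).
have cl := nbhs_singleton (plim_lambda3 mZ0 iidZ w_smooth reg mhat tight_error).
have c1 := at_truth (smooth_eta1 w_smooth reg).
have c2 := at_truth (smooth_eta w_smooth reg (isT : 2 <= 4)%N).
have ca2N : cvpr P (fun n t => - a2 (M n t) l0) (- a2 Plim l0).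
  by have := cvprZ (-1) ca2; rewrite mulN1r; under eq_fun do under eq_fun do rewrite mulN1r.
apply: (residual_equal _ (residual_limit ca2N ca3 cg c1 c2)).
  move=> n; apply: measurable_funB; last by apply: (measurable_emp iidZ); exact: measurable_score.
  by apply: measurable_funM => //; apply: measurable_funB => //; exact: (cvpr_measurable cl).
move=> n t /eqP W0 /eqP g0; congr (_ - _); congr (_ * _).
have [_ ->] := @coefficients_residual (M n t) (fun f => avg Z f n t)
  (Pnw_avg Z w n t l0) (fun k _ => linear_empirical n t k) W0 g0.
by rewrite mulNr [- _ + _]addrC [e3 + _]addrC addrK.
Qed.

End scores.

(** * Asymptotics of the two-stage estimator *)

Section two_stage_asymptotics.
Context {R : realType} {m : nat} {d0 d : measure_display}
  {T0 : measurableType d0} {T : measurableType d}.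
Variables (Q : probability T0 R) (Z0 : T0 -> obs R m).
Variables (P : probability T R) (Z : nat -> T -> obs R m).
Hypotheses (mZ0 : measurable_fun setT Z0) (iidZ : iid_copies Q Z0 P Z).

(** Almost sure equality under the law of one observation carries over to all
    observations of the sample simultaneously, up to a countable union of null
    events. *)
Lemma emp_ae (f g : obs R m -> R) : measurable_fun setT f -> measurable_fun setT g ->
  Q [set t | f (Z0 t) - g (Z0 t) <> 0] = 0%E ->
  cvpr P (fun n t => emp Q Z0 Z f n t - emp Q Z0 Z g n t) 0.
Proof.
move=> mf mg fg0.
have mD : measurable_fun setT (fun z => f z - g z) by exact: measurable_funB.
have mS n : measurable_fun setT (fun t => emp Q Z0 Z f n t - emp Q Z0 Z g n t).
  by apply: measurable_funB; exact: (measurable_emp iidZ).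
have mE : mean Q (f \o Z0) = mean Q (g \o Z0).
  apply: (ae_mean _ fg0).
  - by apply: measurable_neqc; exact: (measurableT_comp mD mZ0).
  - exact: measurableT_comp.
  - exact: measurableT_comp.
  - by move=> t /= /contrapT /eqP; rewrite subr_eq0 => /eqP.
pose N i := [set t | f (Z i t) - g (Z i t) <> 0].
have mN i : measurable (N i).
  by apply: measurable_neqc; exact: (measurableT_comp mD (iid_measurable iidZ i)).
have N0 i : P (N i) = 0%E.
  rewrite -fg0; have mA : measurable [set z | f z - g z <> 0] by exact: measurable_neqc.
  exact: (esym (iid_law iidZ i mA)).
have [U [mU U0 NU]] : P.-negligible (\bigcup_i N i).
  apply: negligible_bigcup => i. exists (N i); split => //; exact: N0.
apply: cvpr0_neq => //; split=> [n|e e0]; first exact: measurable_neqc.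
apply: nearW => n; apply: (@le_trans _ _ (P U)); last by rewrite U0 lee_fin ltW.
apply: le_measure; rewrite ?inE//; first exact: measurable_neqc.
move=> t /= h; apply: NU; apply: contrapT => tN; apply: h.
rewrite /emp -mE -mulrBr -sumrB big1 ?mulr0// => i _.
rewrite opprB addrA subrK; apply: contrapT => fg; apply: tN; by exists i.
Qed.

Variables (w : R -> R) (h : m.-tuple R -> R) (l0 : 'cV[R]_m).
Hypothesis w_smooth : twice_continuously_differentiable w.
Hypothesis reg : regularity Q Z0 w h l0.
Variables c e2 e3 : R.
Hypothesis mh : measurable_fun setT h.
Hypothesis h_quadratic :
  Q [set t | h (Z0 t).1 - (c + e2 * etaX l0 (Z0 t) + e3 * etaX l0 (Z0 t) ^+ 2) <> 0] = 0%E.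
Hypothesis wres2 : forall k, (k <= 2)%N -> L2 Q (weighted_residual w l0 c e2 e3 k \o Z0).
Hypothesis wres0 : forall k, (k <= 2)%N -> mean Q (weighted_residual w l0 c e2 e3 k \o Z0) = 0.

Variables (hat : nat -> T -> 'cV[R]_m) (psi : 'I_m -> obs R m -> R).
Hypothesis mhat : forall n j, measurable_fun setT (fun t => hat n t j 0).
Hypothesis mpsi : forall j, measurable_fun setT (psi j).
Hypothesis psi2 : forall j, L2 Q (psi j \o Z0).
Hypothesis hat_linear : forall j,
  cvpr P (fun n t => Num.sqrt n%:R * (hat n t j 0 - l0 j 0) - emp Q Z0 Z (psi j) n t) 0.

Lemma asymptotically_linear_tight j : tightP P (fun n t => scaled_error l0 hat n t j 0).
Proof.
under eq_fun do under eq_fun do rewrite !mxE.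
exact: tightP_add (tight_emp mZ0 iidZ (mpsi j) (psi2 j)) (hat_linear j).
Qed.
Local Notation tight_error := asymptotically_linear_tight.

Local Notation M n t := (Pnw w n (Z ^~ t)).
Local Notation Plim := (Pw Q Z0 w).
Local Notation kappa := (g3 Plim l0 * PP Q Z0 (fun z => w (etaX l0 z)))^-1.
Local Notation score := (score Q Z0 w l0 c e2 e3).
Local Notation version_score a b := (fun z => w (etaX l0 z) *
  (a * f1 Q Z0 w h l0 z + b * f2 Q Z0 w h l0 z)).

Let measurable_version_score a b : measurable_fun setT (version_score a b).
Proof.
have meta := @measurable_etaX R m l0.
have mres : measurable_fun setT (fun z : obs R m => z.2 ^+ 2 - h z.1).
  apply: measurable_funB; first by apply: measurable_funX; exact: measurable_snd.
  exact: (measurableT_comp mh measurable_fst).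
apply: measurable_funM; first exact: (measurableT_comp (weight_measurable w_smooth) meta).
apply: measurable_funD; apply: measurable_funM => //; apply: measurable_funM => //;
  apply: measurable_funB => //; exact: measurable_funX.
Qed.

Let L1_version_score a b : L1 Q (version_score a b \o Z0).
Proof.
pose r k t := w (etaX l0 (Z0 t)) * etaX l0 (Z0 t) ^+ k * ((Z0 t).2 ^+ 2 - h (Z0 t).1).
have r1 k : (k <= 2)%N -> L1 Q (r k) by move=> k2; exact: L2_L1 (L2_Lfun (reg_score reg k2)).
have h1 : L1 Q (fun t => a * (r 1%N t - Plim l0 (etaX l0) * r 0%N t) +
    b * (r 2%N t - Plim l0 (fun z => etaX l0 z ^+ 2) * r 0%N t)).
  by apply: L1D; apply: L1Z; apply: L1B; [exact: r1|apply: L1Z; exact: r1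
    |exact: r1|apply: L1Z; exact: r1].
by apply: eq_L1 h1 => t; rewrite /r /f1 /f2 /=; ring.
Qed.

(** The version [h] of the conditional mean of [Y ^+ 2] is almost surely the
    quadratic polynomial. *)
Let version_scoreE a b :
  cvpr P (fun n t => emp Q Z0 Z (score a b) n t - kappa * Gn Q Z0 n (Z ^~ t) (version_score a b)) 0.
Proof.
have e : cvpr P (fun n t => emp Q Z0 Z (score a b) n t -
    emp Q Z0 Z (fun z => kappa * version_score a b z) n t) 0.
  apply: emp_ae; first exact: measurable_score.
    by apply: measurable_funM => //; exact: measurable_version_score.
  have mq : measurable_fun setT (fun z : obs R m => h z.1 -
      (c + e2 * etaX l0 z + e3 * etaX l0 z ^+ 2)).
    have meta := @measurable_etaX R m l0.
    apply: measurable_funB; first exact: (measurableT_comp mh measurable_fst).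
    by apply: measurable_funD; [apply: measurable_funD => //|]; apply: measurable_funM => //;
      exact: measurable_funX.
  apply/eqP; rewrite eq_le measure_ge0 andbT -h_quadratic; apply: le_measure; rewrite ?inE.
  - have mk : measurable_fun setT (fun z => score a b z - kappa * version_score a b z).
      apply: measurable_funB; first exact: measurable_score.
      by apply: measurable_funM => //; exact: measurable_version_score.
    by apply: measurable_neqc; exact: (measurableT_comp mk mZ0).
  - by apply: measurable_neqc; exact: (measurableT_comp mq mZ0).
  move=> t /=; apply: contra_not => /eqP; rewrite subr_eq0 => /eqP hq.
  by rewrite /score /weighted_residual /f1 /f2 hq; ring.
move: e; congr cvpr; apply/funext => n; apply/funext => t; congr (_ - _).
by rewrite empZ; [rewrite /Gn /emp -PPE|exact: L1_version_score].
Qed.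

Lemma emp_comb (u v : R) (f g : obs R m -> R) n t : L1 Q (f \o Z0) -> L1 Q (g \o Z0) ->
  emp Q Z0 Z (fun z => u * f z + v * g z) n t = u * emp Q Z0 Z f n t + v * emp Q Z0 Z g n t.
Proof. by move=> h1 h2; rewrite empD ?empZ//; apply: L1Z. Qed.

(** A smooth second-stage statistic [lam], evaluated at the first-stage
    estimator: [theta] is its limit and [a], [b] are the limit coefficients of
    its score at the true first-stage parameter. *)
Section second_stage.
Variables (lam : ('cV[R]_m -> (obs R m -> R) -> R) -> 'cV[R]_m -> R) (theta a b : R).
Hypothesis lam_expansion : delta_expansion P l0 hat
  (fun n t => lam (M n t) l0) (fun n t => lam (M n t) (hat n t)) (lam Plim).
Hypothesis lam_at_truth :
  cvpr P (fun n t => Num.sqrt n%:R * (lam (M n t) l0 - theta) - emp Q Z0 Z (score a b) n t) 0.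
Local Notation S := (fun n t => lam (M n t) (hat n t)).

Let main : exists g, [/\ is_diff l0 (lam Plim) (lform g), grad (lam Plim) l0 = g &
  cvpr P (fun n t => Num.sqrt n%:R * (S n t - theta) -
    (lform g (scaled_error l0 hat n t) + emp Q Z0 Z (score a b) n t)) 0].
Proof.
have [_ _ [g dg cg]] := lam_expansion; exists g; split => //; first exact: grad_is_diff.
have := cvprD cg lam_at_truth; rewrite addr0; congr cvpr.
by apply/funext => n; apply/funext => t; ring.
Qed.

Lemma second_stage_measurable n : measurable_fun setT (S n).
Proof. by have [] := lam_expansion. Qed.

Lemma second_stage_differentiable : differentiable (lam Plim) l0.
Proof. by have [g [[]]] := main. Qed.

Lemma second_stage_expansion :
  cvpr P (fun n t => Num.sqrt n%:R * (S n t - theta) -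
    (Num.sqrt n%:R * dot (hat n t - l0) (grad (lam Plim) l0) +
     kappa * Gn Q Z0 n (Z ^~ t) (version_score a b))) 0.
Proof.
have [g [_ -> cg]] := main; have := cvprD cg (version_scoreE a b).
rewrite addr0; congr cvpr; apply/funext => n; apply/funext => t.
by rewrite /lform dotZ; ring.
Qed.

(** Substituting the linearization of the first stage makes the estimator
    asymptotically linear. *)
Lemma second_stage_linear : exists phi : obs R m -> R,
  [/\ measurable_fun setT phi, L2 Q (phi \o Z0) &
   cvpr P (fun n t => Num.sqrt n%:R * (S n t - theta) - emp Q Z0 Z phi n t) 0].
Proof.
have [g [_ _ cg]] := main.
have p2 : L2 Q ((fun z => \sum_j g j 0 * psi j z) \o Z0).
  by apply: L2_sum => j; apply: L2Z; exact: psi2.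
have s2 := L2_score wres2 a b.
exists (fun z => \sum_j g j 0 * psi j z + score a b z); split.
- apply: measurable_funD; last exact: measurable_score.
  by apply: measurable_sum => j; exact: measurable_funM.
- exact: L2D p2 s2.
have e : cvpr P (fun n t => \sum_j g j 0 * (Num.sqrt n%:R * (hat n t j 0 - l0 j 0) -
    emp Q Z0 Z (psi j) n t)) 0.
  have hj j := cvprZ (g j 0) (hat_linear j).
  by have := cvpr_sum (index_enum 'I_m) hj; rewrite big1// => j _; rewrite mulr0.
have := cvprD cg e; rewrite addr0; congr cvpr; apply/funext => n; apply/funext => t.
rewrite empD; [|exact: L2_L1 p2|exact: L2_L1 s2].
rewrite emp_sum; last by move=> j; exact: L2_L1 (psi2 j).
under eq_bigr do rewrite mulrBr.
rewrite sumrB /lform dotE.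
rewrite (eq_bigr (fun j => g j 0 * (Num.sqrt n%:R * (hat n t j 0 - l0 j 0)))); first ring.
by move=> j _; rewrite !mxE mulrC.
Qed.

Lemma second_stage_consistent : cvpr P S theta.
Proof.
have [phi [mphi phi2 cphi]] := second_stage_linear.
apply: (cvpr_subr0 P _ _).2; apply: tight_rescale.
  by move=> n; apply: measurable_funB => //; exact: second_stage_measurable.
exact: tightP_add (tight_emp mZ0 iidZ mphi phi2) cphi.
Qed.

End second_stage.

Lemma linear_asymptotically_normal (S : nat -> T -> R) theta (phi : obs R m -> R) :
  measurable_fun setT phi -> L2 Q (phi \o Z0) ->
  (forall n, measurable_fun setT (S n)) ->
  cvpr P (fun n t => Num.sqrt n%:R * (S n t - theta) - emp Q Z0 Z phi n t) 0 ->
  asymptotically_normal P S theta.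
Proof.
move=> mphi phi2 mS; apply: (clt mZ0 iidZ mphi phi2) => n.
by apply: measurable_funM => //; exact: measurable_funB.
Qed.

End two_stage_asymptotics.

(** * The mixture regression model *)

Section model_verification.
Context {R : realType} {m : nat} {d0 : measure_display} {T0 : measurableType d0}.
Variables (Q : probability T0 R) (X : T0 -> m.-tuple R) (I Y1 Y2 : T0 -> R)
  (p mu1 mu2 sigma1 sigma2 : R) (beta : 'cV[R]_m).
Hypothesis mix : mixture_model Q X I Y1 Y2 p mu1 mu2 sigma1 sigma2 beta.
Hypothesis X2 : forall j, L2 Q (fun t => tnth (X t) j).
Local Notation Y := (mixture I Y1 Y2).
Local Notation XY := (fun t => (X t, Y t)).
Local Notation lam1 := (p *: beta).

Lemma measurable_XY : measurable_fun setT XY.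
Proof. by apply: measurable_fun_pair; [exact: mix_measX mix|exact: measurable_mixture mix]. Qed.

Definition intercept : R := p * mu1 + (1 - p) * mu2.

Definition intercept2 : R :=
  p * (mu1 ^+ 2 + sigma1 ^+ 2) + (1 - p) * (mu2 ^+ 2 + sigma2 ^+ 2).

Lemma regression_linear x :
  regression p mu1 mu2 beta x = intercept + dot lam1 (cvec x).
Proof. by rewrite /regression /mean1 /intercept dotZ; ring. Qed.

(** With [eta = p * dot beta x], the square [p * (mu1 + eta / p) ^+ 2] has linear
    coefficient [2 * mu1] and quadratic coefficient [p^-1]: this is how the
    second stage identifies [mu1] and [p]. *)
Lemma regression2_quadratic x : regression2 p mu1 mu2 sigma1 sigma2 beta x =
  intercept2 + 2 * mu1 * dot lam1 (cvec x) + p^-1 * dot lam1 (cvec x) ^+ 2.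
Proof.
have p0 : p != 0 by have /andP[p0 _] := mix_p mix; exact: lt0r_neq0.
by rewrite /regression2 /mean1 /intercept2 dotZ; field.
Qed.

Hypothesis Y2i : L1 Q (fun t => Y t ^+ 2).
Hypothesis XY2 : forall j, L2 Q (fun t => tnth (X t) j * Y t).

Let L2Y : L2 Q Y.
Proof. by split => //; exact: measurable_mixture mix. Qed.

Lemma L2_regressor k : L2 Q (regressor k \o XY).
Proof.
rewrite /regressor /comp /=; under eq_fun do rewrite mxE.
case: (fintype.split k) => j; under eq_fun do rewrite mxE; first exact: L2_cst.
exact: X2.
Qed.

Lemma L2_regressor_residual k :
  L2 Q ((fun z => regressor k z * residual intercept lam1 z) \o XY).
Proof.
have -> : (fun z => regressor k z * residual intercept lam1 z) \o XY =
    fun t => tildeX (X t) k 0 * (Y t - regression p mu1 mu2 beta (X t)).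
  by apply/funext => t; rewrite /= /residual regression_linear.
under eq_fun do rewrite mxE.
case: (fintype.split k) => j; under eq_fun do rewrite mxE.
  rewrite [j]ord1; under eq_fun do rewrite eqxx mul1r.
  apply: L2B L2Y _; apply: L2D; last exact: L2_cst.
  by apply: L2Z; exact: L2_mean1.
have h1 : L2 Q (fun t => tnth (X t) j * Y t - (p * (tnth (X t) j * mean1 mu1 beta (X t)) +
    (1 - p) * mu2 * tnth (X t) j)).
  apply: L2B (XY2 j) _; apply: L2D; apply: L2Z => //.
  exact: (L2_regressor_mean1 mix X2 Y2i (XY2 j)).
by move: h1; congr L2; apply/funext => t; rewrite /regression; ring.
Qed.

Lemma mean_regressor_residual k :
  mean Q ((fun z => regressor k z * residual intercept lam1 z) \o XY) = 0.
Proof.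
have E : (fun z => regressor k z * residual intercept lam1 z) \o XY =
    fun t => tildeX (X t) k 0 * (Y t - regression p mu1 mu2 beta (X t)).
  by apply/funext => t; rewrite /= /residual regression_linear.
have L2E := L2_regressor_residual k; rewrite E in L2E *.
apply: (cond_centered_test (mix_measX mix) (k := fun x => tildeX x k 0)).
- exact: (mixture_centered mix X2 (L2_L1 L2Y)).
- under eq_fun do rewrite mxE.
  case: (fintype.split k) => j; under eq_fun do rewrite mxE; first exact: measurable_cst.
  exact: measurable_tnth.
- exact: L2_L1.
Qed.

Variables (w : R -> R) (h : m.-tuple R -> R).
Hypothesis w_smooth : twice_continuously_differentiable w.
Hypothesis hY : is_cond_exp Q (fun t => Y t ^+ 2) X h.
Hypothesis score2 : forall k : nat, (k <= 2)%N ->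
  L2 Q (fun t => w (etaX lam1 (XY t)) * etaX lam1 (XY t) ^+ k * (Y t ^+ 2 - h (X t))).

Lemma cond_exp_quadratic : Q [set t | h (XY t).1 -
  (intercept2 + 2 * mu1 * etaX lam1 (XY t) + p^-1 * etaX lam1 (XY t) ^+ 2) <> 0] = 0%E.
Proof.
rewrite -(cond_exp_regression2 mix X2 hY); congr (Q _).
by apply/seteqP; split => t /=; rewrite regression2_quadratic.
Qed.

Local Notation wres := (weighted_residual w lam1 intercept2 (2 * mu1) p^-1).

(** Square integrability is known for the given version [h] of the conditional
    mean, which agrees almost surely with the quadratic polynomial. *)
Lemma L2_weighted_residual k : (k <= 2)%N -> L2 Q (wres k \o XY).
Proof.
move=> /score2 [ms s2]; have mh : measurable_fun setT h by case: hY.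
have mr : measurable_fun setT (wres k \o XY).
  exact: (measurableT_comp (measurable_weighted_residual _ w_smooth _ _ _ k) measurable_XY).
split => //; apply: (ae_L1 _ cond_exp_quadratic _ _ s2).
- have meta : measurable_fun setT (fun t => etaX lam1 (XY t)).
    exact: (measurableT_comp (measurable_etaX lam1) measurable_XY).
  apply: measurable_neqc; apply: measurable_funB.
    exact: (measurableT_comp mh (mix_measX mix)).
  by apply: measurable_funD; [apply: measurable_funD => //|]; apply: measurable_funM => //;
    exact: measurable_funX.
- exact: measurable_funX.
move=> t /= /contrapT /eqP; rewrite subr_eq0 => /eqP hq.
by rewrite /weighted_residual hq.
Qed.

Lemma mean_weighted_residual k : (k <= 2)%N -> mean Q (wres k \o XY) = 0.
Proof.
move=> k2; have L2r := L2_weighted_residual k2.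
have E : wres k \o XY = fun t => (w (dot lam1 (cvec (X t))) * dot lam1 (cvec (X t)) ^+ k) *
    (Y t ^+ 2 - regression2 p mu1 mu2 sigma1 sigma2 beta (X t)).
  by apply/funext => t; rewrite /= regression2_quadratic.
rewrite E in L2r *.
apply: (cond_centered_test (mix_measX mix)
  (k := fun x => w (dot lam1 (cvec x)) * dot lam1 (cvec x) ^+ k)).
- exact: (mixture_centered2 mix X2 Y2i).
- apply: measurable_funM; last by apply: measurable_funX; exact: measurable_dot.
  exact: (measurableT_comp (weight_measurable w_smooth) (measurable_dot lam1)).
- exact: L2_L1.
Qed.

End model_verification.

Theorem theorem2p1 (R : realType) (m : nat)
  (d0 : measure_display) (T0 : measurableType d0) (Q : probability T0 R)
  (X : T0 -> m.-tuple R) (I Y1 Y2 : T0 -> R)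
  (p mu1 mu2 sigma1 sigma2 : R) (beta : 'cV[R]_m)
  (d : measure_display) (T : measurableType d) (P : probability T R)
  (Z : nat -> T -> obs R m)
  (w : R -> R) (h : m.-tuple R -> R) :
  let Y := mixture I Y1 Y2 in
  let XY := fun t => (X t, Y t) in
  let lam1 : 'cV[R]_m := p *: beta in
  let lam2 := 2 * mu1 in
  let lam3 := p^-1 in
  let Plim := Pw Q XY w in
  mixture_model Q X I Y1 Y2 p mu1 mu2 sigma1 sigma2 beta ->
  iid_copies Q XY P Z ->
  is_cond_exp Q (fun t => Y t ^+ 2) X h ->
  weight_assumption Q XY w lam1 ->
  regularity Q XY w h lam1 ->
  let hat1 := fun n t => lambda1_hat n (Z ^~ t) in
  let hat2 := fun n t => lambda2_hat w n (Z ^~ t) in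
  let hat3 := fun n t => lambda3_hat w n (Z ^~ t) in
  let is_plim := fun c : ('cV[R]_m -> (obs R m -> R) -> R) -> 'cV[R]_m -> R =>
    \forall l \near lam1,
      cvg_in_prob P (fun n t => c (Pnw w n (Z ^~ t)) l) (c Plim l) in
  [/\ [/\ is_plim a1, is_plim a2 & is_plim a3] /\
      [/\ is_plim g3, is_plim lambda2 & is_plim lambda3],
      cvg_in_prob P hat2 lam2 /\ cvg_in_prob P hat3 lam3,
      [/\ asymptotically_normal P hat2 lam2,
          asymptotically_normal P hat3 lam3
        & forall u v : R,
            asymptotically_normal P (fun n t => u * hat2 n t + v * hat3 n t)
              (u * lam2 + v * lam3)],
      differentiable (lambda2 Plim) lam1 /\
      eq_oP1 P (fun n t => Num.sqrt n%:R * (hat2 n t - lam2))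
        (fun n t =>
           Num.sqrt n%:R * dot (hat1 n t - lam1) (grad (lambda2 Plim) lam1) +
           (g3 Plim lam1 * PP Q XY (fun z => w (etaX lam1 z)))^-1 *
           Gn Q XY n (Z ^~ t) (fun z => w (etaX lam1 z) *
             (a1 Plim lam1 * f1 Q XY w h lam1 z -
              a2 Plim lam1 * f2 Q XY w h lam1 z)))
    & differentiable (lambda3 Plim) lam1 /\
      eq_oP1 P (fun n t => Num.sqrt n%:R * (hat3 n t - lam3))
        (fun n t =>
           Num.sqrt n%:R * dot (hat1 n t - lam1) (grad (lambda3 Plim) lam1) +
           (g3 Plim lam1 * PP Q XY (fun z => w (etaX lam1 z)))^-1 *
           Gn Q XY n (Z ^~ t) (fun z => w (etaX lam1 z) *
             (a3 Plim lam1 * f2 Q XY w h lam1 z -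
              a2 Plim lam1 * f1 Q XY w h lam1 z)))].
Proof.
move=> Y XY lam1 lam2 lam3 Plim mix iidZ hY [w_smooth _] reg hat1 hat2 hat3 is_plim.
have X2 j : L2 Q (fun t => tnth (X t) j) := L2_Lfun (reg_X reg j).
have XY2 j : L2 Q (fun t => tnth (X t) j * Y t) := L2_Lfun (reg_XY reg j).
have Y2i : L1 Q (fun t => Y t ^+ 2) by case: hY.
have mh : measurable_fun setT h by case: hY.
have mXY : measurable_fun setT XY := measurable_XY mix.
have hq := cond_exp_quadratic mix X2 hY.
have scores k : (k <= 2)%N -> L2 Q (fun t => w (etaX lam1 (XY t)) * etaX lam1 (XY t) ^+ k *
    (Y t ^+ 2 - h (X t))) by move=> k2; exact: L2_Lfun (reg_score reg k2).
have wres2 := L2_weighted_residual mix X2 w_smooth hY scores.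
have wres0 := mean_weighted_residual mix X2 Y2i w_smooth hY scores.
have psi2 := L2_regressor_residual mix X2 Y2i XY2.
have psi0 := mean_regressor_residual mix X2 Y2i XY2.
have reg2 := L2_regressor I Y1 Y2 X2.
have hat_linear := ols_linear mXY iidZ reg2 (reg_gram reg) psi2 psi0.
pose psi j := ols_score Q XY (intercept p mu1 mu2) lam1 j.
have mpsi j : measurable_fun setT (psi j) by exact: measurable_ols_score.
have Lpsi j : L2 Q (psi j \o XY) by exact: L2_ols_score.
have mhat n j : measurable_fun setT (fun t => hat1 n t j 0).
  exact: (measurable_lambda1_hat iidZ).
have tight := asymptotically_linear_tight mXY iidZ mpsi Lpsi hat_linear.
have e2 := expansion_lambda2 mXY iidZ w_smooth reg mhat tight.
have e3 := expansion_lambda3 mXY iidZ w_smooth reg mhat tight.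
have scoreB a b (f g : obs R m -> R) : (fun z => w (etaX lam1 z) * (a * f z - b * g z)) =
    fun z => w (etaX lam1 z) * (a * f z + - b * g z).
  by apply/funext => z; rewrite mulNr.
have scoreBC a b (f g : obs R m -> R) : (fun z => w (etaX lam1 z) * (a * f z - b * g z)) =
    fun z => w (etaX lam1 z) * (- b * g z + a * f z).
  by apply/funext => z; rewrite mulNr addrC.
have t2 := lambda2_at_truth mXY iidZ w_smooth reg wres2 wres0 mhat tight.
have t3 := lambda3_at_truth mXY iidZ w_smooth reg wres2 wres0 mhat tight.
have m2 : forall n, measurable_fun setT (hat2 n) := second_stage_measurable e2.
have m3 : forall n, measurable_fun setT (hat3 n) := second_stage_measurable e3.
have [phi2 [mphi2 Lphi2 l2]] := second_stage_linear w_smooth wres2 mpsi Lpsi hat_linear e2 t2.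
have [phi3 [mphi3 Lphi3 l3]] := second_stage_linear w_smooth wres2 mpsi Lpsi hat_linear e3 t3.
have plim_of c : (\forall l \near lam1, cvpr P (fun n t => c (Pnw w n (Z ^~ t)) l) (c Plim l)) ->
    is_plim c.
  by apply: filterS => l /cvprE[].
have normal u v : asymptotically_normal P (fun n t => u * hat2 n t + v * hat3 n t)
    (u * lam2 + v * lam3).
  apply: (linear_asymptotically_normal mXY iidZ (phi := fun z => u * phi2 z + v * phi3 z)).
  - by apply: measurable_funD; exact: measurable_funM.
  - by apply: (@L2D _ _ _ Q (fun t => u * phi2 (XY t)) (fun t => v * phi3 (XY t))); exact: L2Z.
  - by move=> n; apply: measurable_funD; exact: measurable_funM.
  have := cvprD (cvprZ u l2) (cvprZ v l3); rewrite !mulr0 addr0; congr cvpr.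
  apply/funext => n; apply/funext => t.
  rewrite emp_comb; [|exact: L2_L1|exact: L2_L1].
  rewrite /hat2 /hat3 /lambda2_hat /lambda3_hat /lam2 /lam3; ring.
split.
- split; split; apply: plim_of.
  + exact: (plim_a1 mXY iidZ w_smooth reg mhat tight).
  + exact: (plim_a2 mXY iidZ w_smooth reg mhat tight).
  + exact: (plim_a3 mXY iidZ w_smooth reg mhat tight).
  + exact: (plim_g3 mXY iidZ w_smooth reg mhat tight).
  + exact: (plim_lambda2 mXY iidZ w_smooth reg mhat tight).
  + exact: (plim_lambda3 mXY iidZ w_smooth reg mhat tight).
- split.
  + by have /cvprE[] := second_stage_consistent mXY iidZ w_smooth wres2 mpsi Lpsi hat_linear e2 t2.
  + by have /cvprE[] := second_stage_consistent mXY iidZ w_smooth wres2 mpsi Lpsi hat_linear e3 t3.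
- split => //.
  + exact: (linear_asymptotically_normal mXY iidZ mphi2 Lphi2 m2 l2).
  + exact: (linear_asymptotically_normal mXY iidZ mphi3 Lphi3 m3 l3).
- split; first exact: second_stage_differentiable e2 t2.
  rewrite scoreB.
  by have /cvprE[] := second_stage_expansion mXY iidZ w_smooth reg mh hq e2 t2.
- split; first exact: second_stage_differentiable e3 t3.
  rewrite scoreBC.
  by have /cvprE[] := second_stage_expansion mXY iidZ w_smooth reg mh hq e3 t3.
Qed.
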